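(* Let $d\ge2$ and let $V=V(x)$ be a smooth (confining) function on $\mathbb{R}^d$ such that $$\int_{\mathbb{R}^d}e^{-V(x)}dx=1$$ and $$\frac14|\nabla V|^2-\frac12\Delta V-\sum_{i,j=1}^d|\partial_i\partial_jV|\to\infty\quad\text{as }|x|\to\infty.$$ Then there is a constant $\lambda>0$ such that $$\sum_{i,j=1}^d\int_{\mathbb{R}^d}|\mathsf{X}_ib_j+\mathsf{X}_jb_i|^2dx\ge\lambda\sum_{i=1}^d\int_{\mathbb{R}^d}|b_i|^2dx$$ holds for any $b=(b_1,\dots,b_d):\mathbb{R}^d\to\mathbb{R}^d$ in $(L^2(\mathbb{R}^d))^d$ satisfying $$\int_{\mathbb{R}^d}e^{-\frac{V(x)}2}b(x)\,dx=0$$ and $$\int_{\mathbb{R}^d}e^{-\frac{V(x)}2}(x_ib_j-x_jb_i)\,dx=0,\qquad 1\le i\ne j\le d.$$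
   Context: For $1\le i\le d$, $\mathsf{X}_i=\frac12\partial_iV+\partial_i$, i.e. $\mathsf{X}_ig=e^{-V/2}\partial_i(e^{V/2}g)$, where $\partial_i=\partial_{x_i}$ (derivatives in the weak sense; an integral on the left-hand side is $+\infty$ if the corresponding function is not in $L^2$). *)

(* Defs.v *)
From HB Require Import structures.
From mathcomp Require Import all_boot all_order all_algebra.
From mathcomp Require Import all_classical all_reals all_analysis.

Set Implicit Arguments.
Unset Strict Implicit.
Unset Printing Implicit Defensive.
Import Order.TTheory GRing.Theory Num.Theory.
Import numFieldNormedType.Exports.
Local Open Scope classical_set_scope.
Local Open Scope ring_scope.

(* The product sigma-algebra (generated by the coordinate maps) on R^n, as the
   library does for tuples; it is the Borel sigma-algebra of R^n. *)
Section measurable_rV.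
Context {R : realType} (n : nat).

Let coor (i : 'I_n) (x : 'rV[R]_n) : R := x 0 i.

Let rV_set0 : g_sigma_preimage coor set0.
Proof. exact: sigma_algebra0. Qed.

Let rV_setC A : g_sigma_preimage coor A -> g_sigma_preimage coor (~` A).
Proof. exact: sigma_algebraC. Qed.

Let rV_bigcup (F : (set 'rV[R]_n)^nat) : (forall i, g_sigma_preimage coor (F i)) ->
  g_sigma_preimage coor (\bigcup_i (F i)).
Proof. exact: sigma_algebra_bigcup. Qed.

HB.instance Definition _ := @isMeasurable.Build default_measure_display
  'rV[R]_n (g_sigma_preimage coor) rV_set0 rV_setC rV_bigcup.

Lemma measurable_coord (i : 'I_n) :
  measurable_fun [set: 'rV[R]_n] (fun x => x 0 i).
Proof.
move=> _ Y mY; rewrite setTI; apply: sub_sigma_algebra => /=.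
rewrite -bigcup_seq/=; exists i => /=; first by rewrite mem_index_enum.
by exists Y => //; rewrite setTI.
Qed.

Lemma measurable_fun_rVP d (T : measurableType d) (f : T -> 'rV[R]_n) :
  (forall i, measurable_fun [set: T] (fun t => f t 0 i)) ->
  measurable_fun [set: T] f.
Proof.
move=> mf _ A mA; move: A mA.
suff : g_sigma_preimage (fun i t => coor i (f t)) `<=` measurable.
  move=> sub A mA; rewrite setTI; apply: sub.
  have := g_sigma_preimage_comp coor f.
  rewrite /comp => ->; exists A => //.
  by rewrite setTI.
apply: smallest_sub; first exact: sigma_algebra_measurable.
rewrite -bigcup_seq; apply: bigcup_sub => i _.
by move=> A [B mB <-]; exact: mf.
Qed.

End measurable_rV.

Section lebesgue_measure_rV.
Context {R : realType}.

Definition cons_rV n (p : R * 'rV[R]_n) : 'rV[R]_n.+1 :=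
  \row_i if unlift 0 i is Some j then p.2 0 j else p.1.

Lemma cons_rV0 n (p : R * 'rV[R]_n) : cons_rV p 0 0 = p.1.
Proof. by rewrite mxE unlift_none. Qed.

Lemma cons_rVS n (p : R * 'rV[R]_n) i : cons_rV p 0 (lift 0 i) = p.2 0 i.
Proof. by rewrite mxE liftK. Qed.

Lemma measurable_cons_rV n : measurable_fun setT (@cons_rV n).
Proof.
apply: measurable_fun_rVP => i; case: (unliftP 0 i) => [j ->|->].
- under eq_fun do rewrite cons_rVS.
  exact: measurableT_comp (measurable_coord j) measurable_snd.
- under eq_fun do rewrite cons_rV0.
  exact: measurable_fst.
Qed.

Section step.
Variables (n : nat) (mu : {sigma_finite_measure set 'rV[R]_n -> \bar R}).

Definition lebesgue_cons : set 'rV[R]_n.+1 -> \bar R :=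
  pushforward (@lebesgue_measure R \x mu)%E (@cons_rV n).

Let cons0 : lebesgue_cons set0 = 0%E.
Proof. by rewrite /lebesgue_cons /pushforward preimage_set0 measure0. Qed.

Let cons_ge0 A : (0 <= lebesgue_cons A)%E.
Proof. by rewrite /lebesgue_cons /pushforward measure_ge0. Qed.

Let mcons (A : set 'rV[R]_n.+1) : measurable A -> measurable (@cons_rV n @^-1` A).
Proof. by move=> mA; rewrite -[X in measurable X]setTI; exact: measurable_cons_rV. Qed.

Let cons_sigma_additive : semi_sigma_additive lebesgue_cons.
Proof.
move=> F mF tF mUF; rewrite /lebesgue_cons /pushforward preimage_bigcup.
apply: measure_semi_sigma_additive.
- by move=> k; exact: mcons.
- apply/trivIsetP => /= i j _ _ ij; rewrite -preimage_setI.
  by move/trivIsetP : tF => /(_ _ _ _ _ ij) ->//; rewrite preimage_set0.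
- by rewrite -preimage_bigcup; exact: mcons.
Qed.

HB.instance Definition _ := isMeasure.Build _ _ _
  lebesgue_cons cons0 cons_ge0 cons_sigma_additive.

Let cons_sigma_finite : sigma_finite setT lebesgue_cons.
Proof.
have /sigma_finiteP[F [TF ndF Foo]] := sigma_finiteT (@lebesgue_measure R).
have /sigma_finiteP[G [TG ndG Goo]] := sigma_finiteT mu.
pose behead (x : 'rV[R]_n.+1) : 'rV[R]_n := \row_j x 0 (lift 0 j).
have mbehead : measurable_fun setT behead.
  apply: measurable_fun_rVP => j.
  by under eq_fun do rewrite mxE; exact: measurable_coord.
exists (fun k => [set x : 'rV[R]_n.+1 | F k (x 0 0)] `&` behead @^-1` G k).
  apply/esym/seteqP; split=> // x _.
  have [k _ Fk] : (\bigcup_k F k) (x 0 0) by rewrite -TF.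
  have [l _ Gl] : (\bigcup_k G k) (behead x) by rewrite -TG.
  exists (maxn k l) => //; split => /=.
    by have /subsetPset := ndF _ _ (leq_maxl k l); exact.
  by have /subsetPset := ndG _ _ (leq_maxr k l); exact.
move=> k; have [mF Ffin] := Foo k; have [mG Gfin] := Goo k; split.
  apply: measurableI; rewrite -[X in measurable X]setTI.
    exact: measurable_coord.
  exact: mbehead.
rewrite /lebesgue_cons /pushforward.
rewrite (_ : _ @^-1` _ = F k `*` G k); first by
  rewrite product_measure1E// lte_mul_pinfty// ge0_fin_numE.
have beheadK p : behead (cons_rV p) = p.2.
  by apply/rowP => j; rewrite mxE cons_rVS.
by apply/seteqP; split=> -[a y] /=; rewrite cons_rV0 beheadK.
Qed.

HB.instance Definition _ := Measure_isSigmaFinite.Build _ _ _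
  lebesgue_cons cons_sigma_finite.

End step.

End lebesgue_measure_rV.

(* Lebesgue measure on R^n (restricted to Borel sets) as the n-fold product of
   one-dimensional Lebesgue measure; see lebesgue_rV_box. *)
Fixpoint lebesgue_rV (R : realType) n :
    {sigma_finite_measure set 'rV[R]_n -> \bar R} :=
  if n is m.+1 then lebesgue_cons (lebesgue_rV R m) else dirac (0 : 'rV[R]_0).

Lemma lebesgue_rV_box (R : realType) n (A : 'I_n -> set R) :
  (forall i, measurable (A i)) ->
  lebesgue_rV R n [set x | forall i, A i (x 0 i)] =
  (\prod_(i < n) lebesgue_measure (A i))%E.
Proof.
elim: n A => [|n IH] A mA.
  by rewrite big_ord0 /= diracE mem_set// => -[].
rewrite big_ord_recl -IH//= /lebesgue_cons /pushforward.
rewrite -product_measure1E//.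
- congr (product_measure1 _ _ _); apply/seteqP; split=> [[a y]/= H|[a y]/= [H0 H] i].
    split; first by have := H 0; rewrite cons_rV0.
    by move=> i; have := H (lift 0 i); rewrite cons_rVS.
  by case: (unliftP 0 i) => [j ->|->]; rewrite ?cons_rVS ?cons_rV0.
- exact: mA.
- have -> : (fun x : 'rV[R]_n => forall i, A (lift ord0 i) (x 0 i)) =
      \bigcap_(i in [set: 'I_n]) ((fun x => x 0 i) @^-1` A (lift ord0 i)).
    by apply/seteqP; split=> x /= H i; [move=> _; exact: H|exact: H].
  apply: fin_bigcap_measurable => // i _.
  by rewrite -[X in measurable X]setTI; exact: measurable_coord.
Qed.

Section calculus.
Context {R : realType} {d : nat}.
Implicit Types (f g h phi : 'rV[R]_d -> R) (i j : 'I_d).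

Definition partial i f : 'rV[R]_d -> R := 'D_(delta_mx 0 i) f.

(* C^infinity: all iterated partial derivatives exist and are continuous. *)
Definition smooth f :=
  forall s : seq 'I_d, let g := foldr partial f s in
    continuous g /\ forall i x, derivable g x (delta_mx 0 i).

(* The norm of the normed module 'rV[R]_d is the sup norm. *)
Definition euclidean_norm (x : 'rV[R]_d) : R := Num.sqrt (\sum_i x 0 i ^+ 2).

Definition tends_to_pinfty_at_infinity f :=
  forall M : R, exists r : R, forall x, r < euclidean_norm x -> M < f x.

Definition grad_sqr f : 'rV[R]_d -> R := fun x => \sum_i partial i f x ^+ 2.

Definition laplacian f : 'rV[R]_d -> R :=
  fun x => \sum_i partial i (partial i f) x.

Definition test_function phi :=
  smooth phi /\ compact (closure [set x | phi x != 0]).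

Definition L2 : {pred ('rV[R]_d -> R)} := Lfun (lebesgue_rV R d) 2%:E.

(* Distributions are represented by their action on test functions; they are
   only ever evaluated on test functions. *)
Definition distribution := ('rV[R]_d -> R) -> R.

Definition distr_of_fun h : distribution :=
  fun phi => \int[lebesgue_rV R d]_x (h x * phi x).

Definition weak_partial i g : distribution :=
  fun phi => - \int[lebesgue_rV R d]_x (g x * partial i phi x).

Definition represented_by (T : distribution) h :=
  forall phi, test_function phi -> T phi = distr_of_fun h phi.

(* The integral of |T|^2, to be read as +oo when T is not an L^2 function.
   The representative, when it exists, is unique almost everywhere. *)
Definition L2_sqr_norm (T : distribution) : \bar R :=
  if pselect (exists2 h, h \in L2 & represented_by T h) is left ex then
    \int[lebesgue_rV R d]_x (`|s2val (cid2 ex) x| ^+ 2)%:E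
  else +oo.

Definition weak_X (V : 'rV[R]_d -> R) i g : distribution :=
  fun phi => distr_of_fun (fun x => 2^-1 * partial i V x * g x) phi
             + weak_partial i g phi.

Definition weak_sym_X V (b : 'rV[R]_d -> 'rV[R]_d) i j : distribution :=
  fun phi => weak_X V i (fun x => b x 0 j) phi
             + weak_X V j (fun x => b x 0 i) phi.

End calculus.

(* Main.v *)
(** Write u = e^{V/2} b, so that X_i b_j + X_j b_i = e^{-V/2} (d_i u_j + d_j u_i). On a cube,
    Korn's second inequality makes u close in L^2 to a Killing field k, with a bound by the
    symmetric gradient. It is obtained without compactness: the scalar (u x - u y).(x - y) is
    controlled along segments by the symmetric gradient alone, and d + 1 well chosen points y
    determine u up to a Killing field. Put v = e^{-V/2} (u - k). Completing squares after two
    integrations by parts gives a Garding inequality in which the confinement function of the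
    hypothesis multiplies |v|^2; with cutoffs chi (x / m) and m -> oo, the region where this
    function is below 1 is absorbed by the Korn estimate on a large cube, so that
    |v|^2 <= C sum_ij |X_i b_j + X_j b_i|^2. Since b is orthogonal to e^{-V/2} k, |b| <= |v|. *)

Require Import Defs.
From mathcomp Require Import all_boot all_order all_algebra.
From mathcomp Require Import all_classical all_reals all_analysis.
From mathcomp Require Import measurable_realfun ring lra.
Import Order.TTheory GRing.Theory Num.Theory.
Import numFieldNormedType.Exports.
Local Open Scope classical_set_scope.
Local Open Scope ring_scope.
Set Implicit Arguments.
Unset Strict Implicit.
Unset Printing Implicit Defensive.

(** * Lebesgue measure and integration on R^d *)

Section norm_rV.
Context {R : realType} {d : nat}.
Implicit Types (x y : 'rV[R]_d).

(** Since [b] is merely square integrable and only the symmetric combinations are known to be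
    functions, nothing is differentiated before mollification. The factor [e^{V/2}] turns the
    operator into the symmetric gradient, which has constant coefficients and commutes with
    convolution; quadratic inequalities for smooth fields then pass to the limit on cubes, where all
    weights are bounded. Differences of the pairings with base points [y] and [y + s e_k] isolate
    the component [u_k x] up to an affine function of [x], whose matrix is nearly antisymmetric by
    the pairings among the base points. In the Garding inequality an integration by parts exchanges
    [d_i b_j d_j b_i] for [d_i b_i d_j b_j], whose sum belongs to the square of a divergence; the
    leftover Hessian of [V] is paid for by the sum of the [|d_i d_j V|]. The field [v] is not known
    to be square integrable beforehand, as [k] grows linearly. The finite mass of [e^{-V}] bounds
    its squared norm on a cube of size [m] by a constant plus a multiple of [m^2], just what the
    factor [m^-2] of the cutoff error compensates. *)

Lemma ler_coord x i : `|x 0 i| <= `|x|.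
Proof. by rewrite [leRHS]/Num.norm /= mx_normrE; apply: (le_bigmax _ (fun k => `|x k.1 k.2|) (0, i)). Qed.

Lemma norm_rV_leP x r : 0 <= r -> `|x| <= r <-> forall i, `|x 0 i| <= r.
Proof.
move=> r0; split => [xr i|H]; first exact: le_trans (ler_coord x i) xr.
rewrite [leLHS]/Num.norm /= mx_normrE; apply: bigmax_le => // -[k i] _ /=.
by rewrite (ord1 k).
Qed.

Lemma norm_rV_ltP x r : 0 < r -> `|x| < r <-> forall i, `|x 0 i| < r.
Proof.
move=> r0; split => [xr i|H]; first exact: le_lt_trans (ler_coord x i) xr.
rewrite [ltLHS]/Num.norm /= mx_normrE; apply: bigmax_lt => // -[k i] _ /=.
by rewrite (ord1 k).
Qed.

Definition cube (r : R) : set 'rV[R]_d := [set x | `|x| <= r].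

End norm_rV.

Lemma lebesgue_measure_translate {R : realType} (a : R) (A : set R) :
  measurable A -> lebesgue_measure ((fun t => t + a) @^-1` A) = lebesgue_measure A.
Proof.
move=> mA; rewrite -[LHS]/(pushforward (@lebesgue_measure R)
  ((fun t => t + a) : _ -> measurableTypeR R) A).
apply/esym/lebesgue_measure_unique => //=; first exact: measurable_funD.
move=> ms _ [[u v]] _ <-; rewrite /= /pushforward.
have -> : (fun t : R => t + a) @^-1` `]u, v]%classic = `](u - a), (v - a)]%classic.
  by apply/seteqP; split => t /=; rewrite !in_itv /= ltrBlDr lerBrDr.
rewrite !lebesgue_measure_itv /= !lte_fin ltrD2r.
by case: ifP => // _; rewrite -!EFinB; congr EFin; ring.
Qed.

Lemma prode_cst {R : realDomainType} n (c : R) :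
  (\prod_(i < n) c%:E)%E = (c ^+ n)%:E.
Proof. by elim: n => [|n IH]; rewrite ?big_ord0 // big_ord_recl IH exprS EFinM. Qed.

Section measure_rV.
Context {R : realType} {d : nat}.
Notation mu := (lebesgue_rV R d).

Definition rectangles : set (set 'rV[R]_d) :=
  [set B : set 'rV[R]_d | exists2 A : 'I_d -> set R, (forall i, measurable (A i)) &
     B = [set x : 'rV[R]_d | forall i, A i (x 0 i)]].

Lemma rectangles_measurable : rectangles `<=` measurable.
Proof.
move=> _ [A mA ->].
have -> : [set x : 'rV[R]_d | forall i, A i (x 0 i)] =
    \bigcap_(i in [set: 'I_d]) ((fun x => x 0 i) @^-1` A i).
  by apply/seteqP; split=> x /= H i; [move=> _; exact: H|exact: H].
apply: fin_bigcap_measurable => // i _.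
by rewrite -[X in measurable X]setTI; exact: measurable_coord.
Qed.

Lemma setI_closed_rectangles : setI_closed rectangles.
Proof.
move=> _ _ [A mA ->] [B mB ->]; exists (fun i => A i `&` B i).
  by move=> i; exact: measurableI.
by apply/seteqP; split => x /= => [[Ax Bx] i|H]; split => // i; case: (H i).
Qed.

Lemma measurable_rectangles : @measurable _ 'rV[R]_d = <<s rectangles >>.
Proof.
apply/seteqP; split; last first.
  by apply: smallest_sub; [exact: sigma_algebra_measurable|exact: rectangles_measurable].
apply: smallest_sub; first exact: smallest_sigma_algebra.
rewrite -bigcup_seq; apply: bigcup_sub => i _ _ [B mB <-].
apply: sub_sigma_algebra; exists (fun j => if j == i then B else setT).
  by move=> j; case: ifP.
apply/seteqP; split => x /= => [[_ Bx] j|/(_ i)]; last by rewrite eqxx.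
by case: ifP => // /eqP ->.
Qed.

Lemma cubeE (r : R) : 0 <= r ->
  cube r = [set x : 'rV[R]_d | forall i, `[- r, r]%classic (x 0 i)].
Proof.
move=> r0; apply/seteqP; split => x /= H.
  by move=> i; rewrite in_itv/= -ler_norml (le_trans (ler_coord _ _)).
by apply/norm_rV_leP => // i; have := H i; rewrite in_itv/= -ler_norml.
Qed.

Lemma cube_rectangle (r : R) : 0 <= r -> rectangles (cube r).
Proof. by move=> r0; exists (fun=> `[- r, r]%classic) => //; exact: cubeE. Qed.

Lemma measurable_cube (r : R) : measurable (cube r : set 'rV[R]_d).
Proof.
have [r0|r0] := leP 0 r; first by apply: rectangles_measurable; exact: cube_rectangle.
rewrite [X in measurable X](_ : _ = set0) //; apply/seteqP; split => // x /= xr.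
by have := le_lt_trans xr r0; rewrite normr_lt0.
Qed.

Lemma lebesgue_rV_cube (r : R) : 0 <= r -> mu (cube r) = ((r *+ 2) ^+ d)%:E.
Proof.
move=> r0.
rewrite cubeE //.
rewrite (@lebesgue_rV_box R d (fun=> `[- r, r]%classic)) //.
have -> : lebesgue_measure `[- r, r]%classic = (r *+ 2)%:E.
  rewrite lebesgue_measure_itv /= lte_fin; case: ltP => [_|rr].
    by rewrite -EFinD opprK mulr2n.
  by congr EFin; lra.
by rewrite prode_cst.
Qed.

Lemma lebesgue_rV_cube_fin (r : R) : (mu (cube r) < +oo)%E.
Proof.
have [r0|r0] := leP 0 r; first by rewrite lebesgue_rV_cube // ltry.
rewrite (_ : cube r = set0) ?measure0 //; apply/seteqP; split => // x /= xr.
by have := le_lt_trans xr r0; rewrite normr_lt0.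
Qed.

Lemma bigcup_cube : \bigcup_n cube n%:R = [set: 'rV[R]_d].
Proof.
apply/seteqP; split => // x _; exists (Num.truncn `|x|).+1 => //=.
exact/ltW/truncnS_gt.
Qed.

Lemma measurable_shift (z : 'rV[R]_d) : measurable_fun setT (fun x : 'rV[R]_d => x + z).
Proof.
apply: measurable_fun_rVP => i; under eq_fun do rewrite mxE.
by apply: measurable_funD => //; exact: measurable_coord.
Qed.

(** Both measures agree on the pi-system of rectangles, by one-dimensional invariance in each
    factor, and the cubes exhaust the space with finite measure. *)
Lemma lebesgue_rV_translate (z : 'rV[R]_d) (A : set 'rV[R]_d) : measurable A ->
  mu ((fun x => x + z) @^-1` A) = mu A.
Proof.
move=> mA; rewrite -[LHS]/(pushforward mu (fun x : 'rV[R]_d => x + z) A).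
apply/esym.
have ms := measurable_shift z.
apply: (@g_sigma_algebra_measure_unique _ _ _ _ rectangles_measurable
  (fun n => cube n%:R) _ bigcup_cube mu (pushforward mu (fun x : 'rV[R]_d => x + z))).
- by move=> n; exact: cube_rectangle.
- exact: setI_closed_rectangles.
- move=> _ [B mB ->]; transitivity (\prod_(i < d) lebesgue_measure (B i))%E.
    exact: lebesgue_rV_box.
  transitivity (mu [set x : 'rV[R]_d | forall i, ((fun t => t + z 0 i) @^-1` B i) (x 0 i)]).
    rewrite (@lebesgue_rV_box R d (fun i => (fun t => t + z 0 i) @^-1` B i)).
      by apply: eq_bigr => i _; rewrite lebesgue_measure_translate.
    move=> i; rewrite -[X in measurable X]setTI.
    suff mt : measurable_fun setT (fun t : R => t + z 0 i) by exact: mt.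
    exact: measurable_funD.
  rewrite /pushforward; congr (mu _).
  by apply/seteqP; split => x /= H i; have := H i; rewrite mxE.
- by move=> n; exact: lebesgue_rV_cube_fin.
- by rewrite -measurable_rectangles.
Qed.

End measure_rV.

(** * Real-valued integrals and square integrable functions *)

Section real_integral.
Context {dd : measure_display} {T : measurableType dd} {R : realType}.
Variable m : {measure set T -> \bar R}.
Implicit Types f g h : T -> R.

Definition ig f := m.-integrable setT (EFin \o f).

Local Notation "'I' f" := (\int[m]_x f x) (at level 10).

Lemma ig_meas f : ig f -> measurable_fun setT f.
Proof. by move=> /integrableP[/measurable_EFinP]. Qed.

Lemma ig_ext f g : (forall x, f x = g x) -> ig f -> ig g.
Proof. by move=> /funext ->. Qed.

Lemma igD f g : ig f -> ig g -> ig (fun x => f x + g x).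
Proof. by move=> hf hg; have := integrableD measurableT hf hg. Qed.

Lemma igZ (k : R) f : ig f -> ig (fun x => k * f x).
Proof. by move=> hf; have := integrableZl measurableT k hf. Qed.

Lemma igN f : ig f -> ig (fun x => - f x).
Proof. by move=> hf; have := integrableN hf. Qed.

Lemma igB f g : ig f -> ig g -> ig (fun x => f x - g x).
Proof. by move=> hf hg; have := integrableB measurableT hf hg. Qed.

Lemma ig0 : ig (fun=> 0).
Proof. exact: integrable0. Qed.

Lemma ig_sum (J : Type) (s : seq J) (P : pred J) (h : J -> T -> R) :
  (forall i, P i -> ig (h i)) -> ig (fun x => \sum_(i <- s | P i) h i x).
Proof.
move=> H; elim: s => [|a s IH].
  by under eq_fun do rewrite big_nil; exact: ig0.
under eq_fun do rewrite big_cons.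
have [Pa|_] := boolP (P a); last exact: IH.
exact: igD (H _ Pa) IH.
Qed.

Lemma ig_le f g : measurable_fun setT f -> (forall x, `|f x| <= g x) ->
  ig g -> ig f.
Proof.
move=> mf fg; apply: le_integrable => //; first exact/measurable_EFinP.
by move=> x _ /=; rewrite lee_fin (le_trans (fg x)) // ler_norm.
Qed.

Lemma ig_abs f : ig f -> ig (fun x => `|f x|).
Proof. by move=> hf; have := integrable_abse hf. Qed.

Lemma EFinI f : ig f -> (\int[m]_x (f x)%:E)%E = (I f)%:E.
Proof. by move=> hf; rewrite /Rintegral fineK //; exact: integrable_fin_num. Qed.

Lemma ID f g : ig f -> ig g -> \int[m]_x (f x + g x) = I f + I g.
Proof. by move=> hf hg; rewrite RintegralD. Qed.

Lemma IB f g : ig f -> ig g -> \int[m]_x (f x - g x) = I f - I g.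
Proof. by move=> hf hg; rewrite RintegralB. Qed.

Lemma IZ (k : R) f : ig f -> \int[m]_x (k * f x) = k * I f.
Proof. by move=> hf; rewrite RintegralZl. Qed.

Lemma IN f : ig f -> \int[m]_x (- f x) = - I f.
Proof.
by move=> hf; rewrite -mulN1r -IZ //; apply: eq_Rintegral => x _; rewrite mulN1r.
Qed.

Lemma I_ext f g : (forall x, f x = g x) -> I f = I g.
Proof. by move=> /funext ->. Qed.

Lemma I0 : \int[m]_x (0 : R) = 0.
Proof. by rewrite /Rintegral integral0. Qed.

Lemma I_sum (J : Type) (s : seq J) (P : pred J) (h : J -> T -> R) :
  (forall i, P i -> ig (h i)) ->
  \int[m]_x (\sum_(i <- s | P i) h i x) = \sum_(i <- s | P i) I (h i).
Proof.
move=> H; elim: s => [|a s IH].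
  by rewrite big_nil -[RHS]I0; apply: I_ext => x; rewrite big_nil.
rewrite big_cons; case: ifPn => Pa; last first.
  by rewrite -IH; apply: I_ext => x; rewrite big_cons (negbTE Pa).
rewrite -IH -ID; [|exact: H|exact: ig_sum].
by apply: I_ext => x; rewrite big_cons Pa.
Qed.

Lemma I_ge0 f : (forall x, 0 <= f x) -> 0 <= I f.
Proof. by move=> f0; apply: Rintegral_ge0. Qed.

Lemma I_le f g : ig f -> ig g -> (forall x, f x <= g x) -> I f <= I g.
Proof. by move=> hf hg fg; apply: le_Rintegral. Qed.

Lemma I_abs f : ig f -> `|I f| <= \int[m]_x `|f x|.
Proof. by move=> hf; apply: le_normr_Rintegral. Qed.

Lemma ig_bound f (c : R) : measurable_fun setT f -> (forall x, 0 <= f x) ->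
  (\int[m]_x (f x)%:E <= c%:E)%E -> ig f /\ I f <= c.
Proof.
move=> mf f0 H.
have hf : ig f.
  apply/integrableP; split; first exact/measurable_EFinP.
  rewrite (le_lt_trans _ (ltry c)) //; apply: le_trans H.
  by under eq_integral do rewrite /= ger0_norm //.
by split => //; rewrite -lee_fin -EFinI.
Qed.

Lemma ig_finite f : measurable_fun setT f -> (forall x, 0 <= f x) ->
  (\int[m]_x (f x)%:E < +oo)%E -> ig f.
Proof.
move=> mf f0 H; apply/integrableP; split; first exact/measurable_EFinP.
by under eq_integral do rewrite /= ger0_norm //.
Qed.

(** In the extended reals [+oo - +oo] is [-oo], so an integral equal to 0 has finite positive and
    negative parts. The vanishing moments of the theorem thus carry their own integrability, which
    is not evident for those containing [x_i]. *)
Lemma ig_eq0 f : measurable_fun setT f -> (\int[m]_x (f x)%:E = 0)%E -> ig f.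
Proof.
move=> mf f0.
have mE : measurable_fun setT (EFin \o f) by exact/measurable_EFinP.
suff : (\int[m]_x (EFin \o f)^\+ x < +oo /\ \int[m]_x (EFin \o f)^\- x < +oo)%E.
  move=> [h1 h2]; apply/integrableP; split => //.
  under eq_integral do rewrite -/((abse \o (EFin \o f)) _) fune_abse.
  rewrite ge0_integralD //; [exact: lte_add_pinfty|exact: measurable_funepos|exact: measurable_funeneg].
have p0 : (0 <= \int[m]_x (EFin \o f)^\+ x)%E by exact: integral_ge0.
have n0 : (0 <= \int[m]_x (EFin \o f)^\- x)%E by exact: integral_ge0.
move: f0; rewrite integralE -/(EFin \o f).
move: p0 n0; case: (\int[m]_x _)%E => [a| |]; case: (\int[m]_x _)%E => [b| |] //=; by rewrite ?ltry.
Qed.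

Definition L2f f := measurable_fun setT f /\ ig (fun x => f x ^+ 2).

Lemma L2_mul f g : L2f f -> L2f g -> ig (fun x => f x * g x).
Proof.
move=> [mf hf] [mg hg]; apply: (ig_le _ _ (igD hf hg)); first exact: measurable_funM.
move=> x; rewrite ler_norml; have := sqr_ge0 (f x - g x); have := sqr_ge0 (f x + g x).
by rewrite !expr2 => h1 h2; apply/andP; split; nra.
Qed.

Lemma L2D f g : L2f f -> L2f g -> L2f (fun x => f x + g x).
Proof.
move=> hf hg; split; first by apply: measurable_funD; [case: hf|case: hg].
have := igD (igD hf.2 hg.2) (igZ 2 (L2_mul hf hg)).
by apply: ig_ext => x; rewrite !expr2; ring.
Qed.

Lemma L2Z (k : R) f : L2f f -> L2f (fun x => k * f x).
Proof.
move=> [mf hf]; split; first exact: measurable_funM.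
by have := igZ (k ^+ 2) hf; apply: ig_ext => x; rewrite exprMn.
Qed.

Lemma L2B f g : L2f f -> L2f g -> L2f (fun x => f x - g x).
Proof.
move=> hf hg; have := L2D hf (L2Z (-1) hg).
by congr L2f; apply/funext => x; rewrite mulN1r.
Qed.

Lemma L2_le f g : measurable_fun setT f -> (forall x, `|f x| <= `|g x|) ->
  L2f g -> L2f f.
Proof.
move=> mf fg [mg hg]; split => //; apply: ig_le hg; first exact: measurable_funX.
by move=> x; rewrite ger0_norm ?sqr_ge0 // -[f x ^+ 2]real_normK ?num_real //
  -[g x ^+ 2]real_normK ?num_real // lerXn2r ?nnegrE.
Qed.

(* Expand the nonnegative integral of [eta (h - mean) ^ 2]. *)
Lemma jensen_sqr (eta h : T -> R) : (forall x, 0 <= eta x) -> ig eta -> I eta = 1 ->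
  ig (fun x => eta x * h x) -> ig (fun x => eta x * h x ^+ 2) ->
  (\int[m]_x (eta x * h x)) ^+ 2 <= \int[m]_x (eta x * h x ^+ 2).
Proof.
move=> e0 ie e1 i1 i2; set c := \int[m]_x _.
have : 0 <= \int[m]_x (eta x * (h x - c) ^+ 2).
  by apply: I_ge0 => x; rewrite mulr_ge0 // sqr_ge0.
rewrite (@I_ext _ (fun x => eta x * h x ^+ 2 + ((- 2 * c) * (eta x * h x) + c ^+ 2 * eta x))).
  rewrite ID //; last by apply: igD; apply: igZ.
  rewrite ID //; [|exact: igZ..].
  by rewrite !IZ // e1 -/c; rewrite expr2; lra.
by move=> x; rewrite !expr2; ring.
Qed.

End real_integral.

Arguments ig {dd T R} m f.
Arguments L2f {dd T R} m f.

(** * Measurability, translations and local integrability *)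

Section lebesgue_rV_theory.
Context {R : realType} {d : nat}.
Notation mu := (lebesgue_rV R d).
Implicit Types (f g w : 'rV[R]_d -> R) (x y z : 'rV[R]_d).

(** The sigma-algebra is generated by the coordinates, so openness has to be reduced to countably
    many boxes: those with rational centres and half-widths [1 / (n + 1)], enumerated through
    [pickle]. *)
Lemma open_measurable_rV (U : set 'rV[R]_d) : open U -> measurable U.
Proof.
move=> oU.
pose B (p : {ffun 'I_d -> rat} * nat) : set 'rV[R]_d :=
  [set x | forall i, `](ratr (p.1 i) - p.2.+1%:R^-1), (ratr (p.1 i) + p.2.+1%:R^-1)[%classic (x 0 i)].
have mB p : measurable (B p).
  by apply: rectangles_measurable; exists (fun i =>
   `](ratr (p.1 i) - p.2.+1%:R^-1), (ratr (p.1 i) + p.2.+1%:R^-1)[%classic).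
have -> : U = \bigcup_(k in [set k | if unpickle k is Some p then B p `<=` U else False])
     (if unpickle k is Some p then B p else set0).
  apply/seteqP; split => [x Ux|x [k]] /=; last first.
    by case: unpickle => // p; exact.
  have /nbhs_ballP[e /= e0 xe] : nbhs x U by exact: open_nbhs_nbhs.
  have [n] : exists n : nat, n.+1%:R^-1 < e / 2.
    exists (Num.truncn (e / 2)^-1); rewrite -[ltRHS]invrK ltf_pV2 ?posrE ?invr_gt0 ?divr_gt0 //.
    exact: truncnS_gt.
  move=> ne.
  have n0 : 0 < n.+1%:R^-1 :> R by [].
  have Hq i : exists q : rat, x 0 i - n.+1%:R^-1 < ratr q < x 0 i + n.+1%:R^-1.
    have lt : x 0 i - n.+1%:R^-1 < x 0 i + n.+1%:R^-1 by rewrite ltrD2l gtrN.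
    by have [q] := rat_in_itvoo lt; rewrite in_itv /=; exists q.
  pose q := finfun (fun i => projT1 (cid (Hq i))).
  have qP i : x 0 i - n.+1%:R^-1 < ratr (q i) < x 0 i + n.+1%:R^-1.
    by rewrite ffunE; case: (cid _).
  exists (pickle (q, n)); rewrite /= pickleK.
    move=> y By; apply: xe; rewrite -ball_normE /=.
    apply/norm_rV_ltP => // i; have := By i; rewrite /= in_itv /= !mxE => /andP[h1 h2].
    have /andP[] := qP i; rewrite ltr_norml.
    move: ne n0 h1 h2; move: (n.+1%:R^-1) (ratr (q i)) => a b ? ? ? ? ? ?.
    by apply/andP; split; lra.
  move=> i /=; rewrite in_itv /=; have /andP[h3 h4] := qP i.
  move: h3 h4 n0; move: (n.+1%:R^-1) (ratr (q i)) => a b ? ? ?.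
  by apply/andP; split; lra.
apply: bigcup_measurable => k _; by case: unpickle.
Qed.

Lemma continuous_measurable_rV f : continuous f -> measurable_fun setT f.
Proof.
move=> cf; apply: (measurability _ (RGenOInfty.measurableE R)) => //.
move=> /= _ [_ [a ->] <-]; rewrite setTI; apply: open_measurable_rV.
by apply: open_comp => // x _; exact: cf.
Qed.

Lemma ge0_integral_translate (z : 'rV[R]_d) (f : 'rV[R]_d -> \bar R) :
  measurable_fun setT f -> (forall x, 0 <= f x)%E ->
  (\int[mu]_x f (x + z)%R = \int[mu]_x f x)%E.
Proof.
move=> mf f0.
rewrite -(@ge0_integral_pushforward _ _ _ _ _ _ (measurable_shift z) mu setT f) //.
apply: eq_measure_integral => [|ms A mA _]; first exact: measurable_shift.
exact: (lebesgue_rV_translate z mA).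
Qed.

Lemma measurable_translate z f : measurable_fun setT f -> measurable_fun setT (fun x => f (x + z)).
Proof. by move=> mf; apply: (measurableT_comp mf (measurable_shift z)). Qed.

Lemma integral_translate z f : measurable_fun setT f ->
  (\int[mu]_x (f (x + z))%:E = \int[mu]_x (f x)%:E)%E.
Proof.
move=> mf; have mE : measurable_fun setT (EFin \o f) by exact/measurable_EFinP.
rewrite integralE [RHS]integralE; congr (_ - _)%E.
- rewrite -(ge0_integral_translate z (measurable_funepos mE)) //.
  by apply: eq_integral => x _; rewrite !funeposE.
- rewrite -(ge0_integral_translate z (measurable_funeneg mE)) //.
  by apply: eq_integral => x _; rewrite !funenegE.
Qed.

Lemma I_translate z f : measurable_fun setT f ->
  \int[mu]_x (f (x + z)) = \int[mu]_x (f x).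
Proof. by move=> mf; congr fine; exact: integral_translate. Qed.

Lemma ig_translate z f : ig mu f -> ig mu (fun x => f (x + z)).
Proof.
move=> hf; have mf := ig_meas hf; apply/integrableP; split.
  by apply/measurable_EFinP; exact: measurable_translate.
have /integrableP[_] := hf.
rewrite -(ge0_integral_translate z) //.
by apply: measurableT_comp => //; exact/measurable_EFinP.
Qed.

Lemma L2_translate z f : L2f mu f -> L2f mu (fun x => f (x + z)).
Proof. by move=> [mf hf]; split; [exact: measurable_translate|exact: (ig_translate z hf)]. Qed.

(** Bounded support in the sup norm, with an explicit radius: products, derivatives and translates
    keep track of it without closures. *)
Definition bsupp (r : R) f := forall x, r < `|x| -> f x = 0.

Lemma compact_cube (r : R) : compact (cube r : set 'rV[R]_d).
Proof.
have [r0|r0] := leP 0 r.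
  rewrite cubeE //.
  exact: (@rV_compact _ _ (fun=> `[- r, r]%classic) (fun=> @segment_compact _ _ _)).
rewrite (_ : cube r = set0); first exact: compact0.
by apply/seteqP; split => // x /= /le_lt_trans /(_ r0); rewrite normr_lt0.
Qed.

Lemma continuous_bounded_cube (r : R) f : continuous f ->
  exists2 M, 0 < M & forall x, `|x| <= r -> `|f x| <= M.
Proof.
move=> cf; have [c0|/set0P x0] := eqVneq (cube r : set 'rV[R]_d) set0.
  by exists 1 => // x xr; have : cube r x by []; rewrite c0.
have cn : continuous (fun x => `|f x|).
  by move=> x; apply: (continuous_comp (cf x)); exact: norm_continuous.
have [c cr H] := @EVT_max_rV R d _ _ x0 (@compact_cube r) (continuous_subspaceT cn).
exists (`|f c| + 1); first by rewrite ltr_wpDl.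
by move=> x xr; rewrite (le_trans (H x _)) ?inE // lerDl.
Qed.

Lemma bsupp_bounded (r : R) f : continuous f -> bsupp r f ->
  exists2 M, 0 < M & forall x, `|f x| <= M.
Proof.
move=> cf sf; have [M M0 H] := continuous_bounded_cube r cf.
exists M => // x; have [xr|xr] := leP `|x| r; first exact: H.
by rewrite sf // normr0 ltW.
Qed.

Lemma measurable_indic_cube (r : R) : measurable_fun setT (\1_(cube r) : 'rV[R]_d -> R).
Proof. by apply: measurable_indic; exact: measurable_cube. Qed.

Lemma ig_indic_cube (r : R) : ig mu (\1_(cube r)).
Proof.
apply: ig_finite; first exact: measurable_indic_cube.
  by move=> x; rewrite indicE.
rewrite integral_indic ?setIT; [|exact: measurableT|exact: measurable_cube].
exact: lebesgue_rV_cube_fin.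
Qed.

Lemma ig_bsupp (r M : R) f : measurable_fun setT f -> bsupp r f ->
  (forall x, `|f x| <= M) -> ig mu f.
Proof.
move=> mf sf bf; apply: (ig_le _ _ (igZ M (ig_indic_cube r))) => // x.
rewrite indicE; have [xr|xr] := leP `|x| r.
  by rewrite mem_set // mulr1.
by rewrite sf // memNset ?mulr0 ?normr0 //= => H; rewrite ltNge H in xr.
Qed.

Lemma ig_cc (r : R) f : continuous f -> bsupp r f -> ig mu f.
Proof.
move=> cf sf; have [M _ bM] := bsupp_bounded cf sf.
by apply: ig_bsupp sf bM; exact: continuous_measurable_rV.
Qed.

(** Local square integrability is all that survives multiplication by the unbounded weight
    [e^{V/2}]. *)
Definition L2loc f := measurable_fun setT f /\
  forall r, ig mu (fun x => \1_(cube r) x * f x ^+ 2).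

Lemma L2_indic_cube (r : R) : L2f mu (\1_(cube r)).
Proof.
split; first exact: measurable_indic_cube.
by apply: ig_ext (ig_indic_cube r) => x; rewrite indicE; case: (_ \in _); rewrite /= ?expr1n ?expr0n.
Qed.

Lemma L2_L2loc f : L2f mu f -> L2loc f.
Proof.
move=> [mf hf]; split => // r; apply: ig_le hf.
  apply: measurable_funM; [exact: measurable_indic_cube|exact: measurable_funX].
move=> x; rewrite indicE ger0_norm; last by apply: mulr_ge0 => //; exact: sqr_ge0.
by rewrite ler_piMl ?sqr_ge0 //; case: (x \in _).
Qed.

Lemma L2loc_indic r f : L2loc f -> L2f mu (fun x => \1_(cube r) x * f x).
Proof.
move=> [mf hf]; split.
  by apply: measurable_funM => //; exact: measurable_indic_cube.
apply: ig_ext (hf r) => x; rewrite indicE.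
by case: (x \in _); rewrite /= ?(mul1r, mul0r) // expr0n.
Qed.

Lemma L2loc_mul_L2 (r M : R) w f : measurable_fun setT w -> bsupp r w ->
  (forall x, `|w x| <= M) -> L2loc f -> L2f mu (fun x => w x * f x).
Proof.
move=> mw sw bw hf; have := L2Z M (L2loc_indic r hf).
apply: L2_le; first by apply: measurable_funM => //; case: hf.
move=> x; rewrite indicE; have [xr|xr] := leP `|x| r.
  by rewrite mem_set //= mul1r !normrM ler_wpM2r // (le_trans (bw x)) // ler_norm.
by rewrite sw // mul0r normr0.
Qed.

Lemma L2loc_mul_continuous w f : continuous w -> L2loc f -> L2loc (fun x => w x * f x).
Proof.
move=> cw hf; have mw := continuous_measurable_rV cw; split.
  by apply: measurable_funM => //; case: hf.
move=> r; have [M M0 bM] := continuous_bounded_cube r cw.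
have m1 := measurable_indic_cube r.
have := (L2Z M (L2loc_indic r hf)).2; apply: ig_le.
  by apply: measurable_funM => //; apply: measurable_funX; apply: measurable_funM => //; case: hf.
move=> x; rewrite indicE; have [xr|xr] := leP `|x| r.
  rewrite mem_set //= !mul1r ger0_norm ?sqr_ge0 // !exprMn ler_wpM2r ?sqr_ge0 //.
  rewrite -[w x ^+ 2]real_normK ?num_real // lerXn2r ?nnegrE ?bM //; exact: ltW.
rewrite memNset ?mul0r ?normr0 //; first by rewrite ?(mul0r, mulr0, expr0n).
by move=> /= H; rewrite ltNge H in xr.
Qed.

Lemma L2loc_bsupp_ig (r M : R) w f : measurable_fun setT w -> bsupp r w ->
  (forall x, `|w x| <= M) -> L2loc f -> ig mu (fun x => w x * f x).
Proof.
move=> mw sw bw hf.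
apply: ig_ext (L2_mul (L2_indic_cube r) (L2loc_mul_L2 mw sw bw hf)) => x.
rewrite indicE; have [xr|xr] := leP `|x| r; first by rewrite mem_set // mul1r.
by rewrite sw // !mul0r mulr0.
Qed.

Lemma L2locD f g : L2loc f -> L2loc g -> L2loc (fun x => f x + g x).
Proof.
move=> hf hg; split; first by apply: measurable_funD; [case: hf|case: hg].
move=> r; have := (L2D (L2loc_indic r hf) (L2loc_indic r hg)).2.
apply: ig_ext => x; rewrite -mulrDr indicE.
by case: (x \in _); rewrite /= ?(mul1r, mul0r) // expr0n.
Qed.

Lemma L2loc_continuous f : continuous f -> L2loc f.
Proof.
move=> cf; have := L2loc_mul_continuous cf (_ : L2loc (fun=> 1)).
have -> : (fun x => f x * 1) = f by apply/funext => x; rewrite mulr1.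
apply; split => // r; apply: ig_ext (ig_indic_cube r) => x; by rewrite expr1n mulr1.
Qed.

End lebesgue_rV_theory.
Arguments L2loc {R d} f.
Arguments bsupp {R d} r f.

(** * Smooth functions *)

Section directional.
Context {R : realType} {V : normedModType R}.
Implicit Types (f g : V -> R) (x v : V).

Lemma is_derive_line f x v (t l : R) : is_derive (x + t *: v) v f l ->
  is_derive t (1:R) (fun s : R => f (x + s *: v)) l.
Proof.
move=> [df dl].
have E : (fun h : R => h^-1 *: (((fun s : R => f (x + s *: v)) \o shift t) (h *: (1:R)) - f (x + t *: v))) =
    (fun h : R => h^-1 *: ((f \o shift (x + t *: v)) (h *: v) - f (x + t *: v))).
  apply/funext => h; rewrite /= [h *: (1:R)]mulr1; congr (_ *: (f _ - _)).
  by rewrite scalerDl addrCA addrA.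
by apply: DeriveDef; [rewrite /derivable E|rewrite /derive E].
Qed.

Lemma line_is_derive f x v (l : R) : is_derive (0:R) (1:R) (fun s : R => f (x + s *: v)) l ->
  is_derive x v f l.
Proof.
move=> [df dl].
have E : (fun h : R => h^-1 *: (((fun s : R => f (x + s *: v)) \o shift (0:R)) (h *: (1:R)) - f (x + (0:R) *: v))) =
    (fun h : R => h^-1 *: ((f \o shift x) (h *: v) - f x)).
  apply/funext => h; rewrite /= [h *: (1:R)]mulr1 addr0; congr (_ *: (f _ - f _)).
    by rewrite addrC.
  by rewrite scale0r addr0.
by apply: DeriveDef; [rewrite /derivable -E|rewrite /derive -E].
Qed.

(** Only a directional derivative of [g] is available, so the chain rule is applied to the
    restriction of [g] to a line, where derivability and differentiability coincide. *)
Lemma is_derive_comp1 (F : R -> R) g x v (dF dg : R) :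
  is_derive x v g dg -> is_derive (g x) 1 F dF -> is_derive x v (fun y => F (g y)) (dF * dg).
Proof.
move=> hg hF; apply: line_is_derive.
have hl : is_derive (0:R) (1:R) (fun s : R => g (x + s *: v)) dg.
  by apply: is_derive_line; rewrite scale0r addr0.
have E0 : g (x + (0 : R) *: v) = g x by rewrite scale0r addr0.
have d1 : derivable (fun s : R => g (x + s *: v)) 0 1 by case: hl.
have d2 : derivable F (g (x + (0 : R) *: v)) 1 by rewrite E0; case: hF.
apply: DeriveDef.
  apply/derivable1_diffP; apply: (differentiable_comp (g := F)); exact/derivable1_diffP.
have := derive1_comp d1 d2; rewrite !derive1E E0 => ->.
by rewrite (derive_val (is_derive := hl)) (derive_val (is_derive := hF)).
Qed.

End directional.

Section affine.
Context {R : realType} {V : normedModType R}.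
Implicit Types (f g : V -> R) (x v : V).

Lemma is_derive_affine f (c : R) (z x v : V) l : is_derive (c *: x + z) v f l ->
  is_derive x v (fun y => f (c *: y + z)) (c * l).
Proof.
move=> hf; apply: line_is_derive.
have -> : (fun s : R => f (c *: (x + s *: v) + z)) =
   (fun s => (fun t : R => f ((c *: x + z) + t *: v)) (c * s)).
  by apply/funext => s; rewrite scalerDr scalerA addrAC.
rewrite mulrC; apply: (@is_derive_comp1 R R (fun t : R => f ((c *: x + z) + t *: v)) (fun s => c * s) 0 1 l c).
  have := is_deriveZ c (is_derive_id (0:R) (1:R)).
  by rewrite [c *: 1]mulr1.
by rewrite mulr0; apply: is_derive_line; rewrite scale0r addr0.
Qed.

End affine.

Section smooth_functions.
Context {R : realType} {d : nat}.
Implicit Types (f g : 'rV[R]_d -> R) (x y z v : 'rV[R]_d) (i j : 'I_d).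

(** A relation rather than a function: one derivation yields both the existence of the partial
    derivative and its value. *)
Definition pd i f f' := forall x, is_derive x (delta_mx 0 i : 'rV[R]_d) f (f' x).

Lemma pd_partial i f f' : pd i f f' -> partial i f = f'.
Proof. by move=> H; apply/funext => x; apply: (derive_val (is_derive := H x)). Qed.

Lemma pd_derivable i f f' x : pd i f f' -> derivable f x (delta_mx 0 i).
Proof. by move=> /(_ x) []. Qed.

Lemma derivable_pd i f : (forall x, derivable f x (delta_mx 0 i)) -> pd i f (partial i f).
Proof. by move=> H x; exact/derivableP. Qed.

Lemma pd_cst i (c : R) : pd i (fun=> c) (fun=> 0).
Proof. by move=> x; exact: is_derive_cst. Qed.

Lemma pdD i f f' g g' : pd i f f' -> pd i g g' -> pd i (fun x => f x + g x) (fun x => f' x + g' x).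
Proof. by move=> hf hg x; exact: (is_deriveD (hf x) (hg x)). Qed.

Lemma pdM i f f' g g' : pd i f f' -> pd i g g' ->
  pd i (fun x => f x * g x) (fun x => f' x * g x + f x * g' x).
Proof.
move=> hf hg x; apply: is_derive_eq (is_deriveM (hf x) (hg x)) _.
by rewrite addrC [g x *: _]mulrC.
Qed.

Lemma pdZ i f f' (c : R) : pd i f f' -> pd i (fun x => c * f x) (fun x => c * f' x).
Proof. by move=> hf x; exact: (is_deriveZ c (hf x)). Qed.

Lemma pdN i f f' : pd i f f' -> pd i (fun x => - f x) (fun x => - f' x).
Proof. by move=> hf x; exact: (is_deriveN (hf x)). Qed.

Lemma pd_coord i j : pd i (fun x => x 0 j) (fun=> (i == j)%:R).
Proof.
move=> x; apply: line_is_derive.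
have -> : (fun s : R => (x + s *: (delta_mx 0 i : 'rV[R]_d)) 0 j) =
    (fun s => x 0 j + (i == j)%:R * s).
  by apply/funext => s; rewrite !mxE eqxx eq_sym mulrC.
have := is_deriveD (is_derive_cst (x 0 j) (0 : R) (1 : R))
   (is_deriveZ ((i == j)%:R : R) (is_derive_id (0 : R) (1 : R))).
by rewrite add0r [_ *: 1]mulr1.
Qed.

Lemma pd_comp1 i (F F' : R -> R) g g' : (forall t : R, is_derive t (1 : R) F (F' t)) -> pd i g g' ->
  pd i (fun x => F (g x)) (fun x => F' (g x) * g' x).
Proof. by move=> hF hg x; exact: is_derive_comp1. Qed.

Lemma pd_expR i g g' : pd i g g' -> pd i (fun x => expR (g x)) (fun x => expR (g x) * g' x).
Proof. by apply: pd_comp1 => t; exact: is_derive_expR. Qed.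

Lemma pd_affine i f f' (c : R) z : pd i f f' ->
  pd i (fun x => f (c *: x + z)) (fun x => c * f' (c *: x + z)).
Proof. by move=> hf x; exact: is_derive_affine. Qed.

(** Finite-order differentiability, defined by recursion on the order. Closure under products and
    compositions is proved by induction on [n], for which the words of partial derivatives in
    [smooth] are unsuited; [smoothP] translates between the two. *)
Fixpoint Cn n f : Prop := if n is n'.+1 then
  continuous f /\ forall i, (forall x, derivable f x (delta_mx 0 i)) /\ Cn n' (partial i f)
  else continuous f.

Lemma CnS n f : continuous f -> (forall i, exists2 f', pd i f f' & Cn n f') -> Cn n.+1 f.
Proof.
move=> cf H; split => // i; have [f' pf cf'] := H i; split.
  by move=> x; exact: pd_derivable pf.
by rewrite (pd_partial pf).
Qed.

Lemma CnSP n f : Cn n.+1 f -> continuous f /\ forall i, pd i f (partial i f) /\ Cn n (partial i f).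
Proof. by move=> [cf H]; split => // i; have [h1 h2] := H i; split => //; exact: derivable_pd. Qed.

Lemma CnW n f : Cn n.+1 f -> Cn n f.
Proof.
elim: n f => [|n IH] f; first by case.
by move=> [cf H]; split => // i; have [h1 h2] := H i; split => //; exact: IH.
Qed.

Lemma smoothP f : smooth f <-> forall n, Cn n f.
Proof.
split.
  move=> sf n; rewrite -[f]/(foldr partial f [::]).
  move: [::]; elim: n => [|n IH] s; first by case: (sf s).
  by have [h1 h2] := sf s; split => // i; split => //; exact: (IH (i :: s)).
move=> H; suff S n s : Cn n.+1 (foldr partial f s).
  move=> s g; have [h1 h2] := S 0 s; split => //.
  by move=> i x; have [] := h2 i.
elim: s n => [|i s IH] n; first exact: H.
by have [_ /(_ i) []] := IH n.+1.
Qed.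

Lemma smooth_continuous f : smooth f -> continuous f.
Proof. by move=> /(_ [::]) []. Qed.

Lemma smooth_pd i f : smooth f -> pd i f (partial i f).
Proof. by move=> /(_ [::]) [_ H]; apply: derivable_pd => x; exact: H. Qed.

Lemma smooth_partial i f : smooth f -> smooth (partial i f).
Proof. by move=> /smoothP H; apply/smoothP => n; have [_ /(_ i) []] := H n.+1. Qed.

Lemma Cn_cst n (c : R) : Cn n (fun=> c).
Proof.
elim: n c => [|n IH] c; first exact: cst_continuous.
apply: CnS => [|i]; first exact: cst_continuous.
by exists (fun=> 0); [exact: pd_cst|exact: IH].
Qed.

Lemma CnD n f g : Cn n f -> Cn n g -> Cn n (fun x => f x + g x).
Proof.
elim: n f g => [|n IH] f g; first by move=> cf cg x; exact: cvgD (cf x) (cg x).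
move=> /CnSP[cf hf] /CnSP[cg hg]; apply: CnS => [x|i]; first exact: cvgD (cf x) (cg x).
have [pf cf'] := hf i; have [pg cg'] := hg i.
by eexists; [exact: pdD pf pg|exact: IH].
Qed.

Lemma CnM n f g : Cn n f -> Cn n g -> Cn n (fun x => f x * g x).
Proof.
elim: n f g => [|n IH] f g; first by move=> cf cg x; exact: cvgM (cf x) (cg x).
move=> Cf Cg; have Cf1 := CnW Cf; have Cg1 := CnW Cg.
move: Cf Cg => /CnSP[cf hf] /CnSP[cg hg]; apply: CnS => [x|i]; first exact: cvgM (cf x) (cg x).
have [pf cf'] := hf i; have [pg cg'] := hg i.
by eexists; [exact: pdM pf pg|apply: CnD; exact: IH].
Qed.

Lemma Cn_expR n f : Cn n f -> Cn n (fun x => expR (f x)).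
Proof.
elim: n f => [|n IH] f.
  by move=> cf x; apply: (continuous_comp (cf x)); exact: continuous_expR.
move=> Cf; have Cf1 := CnW Cf; move: Cf => /CnSP[cf hf]; apply: CnS => [x|i].
  by apply: (continuous_comp (cf x)); exact: continuous_expR.
have [pf cf'] := hf i.
by eexists; [exact: pd_expR pf|apply: CnM => //; exact: IH].
Qed.

Lemma continuous_affine f (c : R) z : continuous f -> continuous (fun x => f (c *: x + z)).
Proof.
move=> cf x; apply: (@continuous_comp _ _ _ (fun x => c *: x + z) f); last exact: cf.
by apply: continuousD; [exact: scaler_continuous|exact: cst_continuous].
Qed.

Lemma Cn_affine n f (c : R) z : Cn n f -> Cn n (fun x => f (c *: x + z)).
Proof.
elim: n f => [|n IH] f; first exact: continuous_affine.
move=> /CnSP[cf hf]; apply: CnS; first exact: continuous_affine.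
move=> i; have [pf cf'] := hf i.
by eexists; [exact: pd_affine pf|apply: CnM; [exact: Cn_cst|exact: IH]].
Qed.

Lemma smooth_cst (c : R) : smooth (fun _ : 'rV[R]_d => c).
Proof. by apply/smoothP => n; exact: Cn_cst. Qed.

Lemma smoothD f g : smooth f -> smooth g -> smooth (fun x => f x + g x).
Proof. by move=> /smoothP hf /smoothP hg; apply/smoothP => n; exact: CnD. Qed.

Lemma smoothM f g : smooth f -> smooth g -> smooth (fun x => f x * g x).
Proof. by move=> /smoothP hf /smoothP hg; apply/smoothP => n; exact: CnM. Qed.

Lemma smoothZ (c : R) f : smooth f -> smooth (fun x => c * f x).
Proof. by apply: smoothM; exact: smooth_cst. Qed.

Lemma smoothN f : smooth f -> smooth (fun x => - f x).
Proof. by move=> /(smoothZ (-1)); congr smooth; apply/funext => x; rewrite mulN1r. Qed.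

Lemma smoothB f g : smooth f -> smooth g -> smooth (fun x => f x - g x).
Proof. by move=> sf /smoothN; exact: smoothD. Qed.

Lemma smooth_expR f : smooth f -> smooth (fun x => expR (f x)).
Proof. by move=> /smoothP hf; apply/smoothP => n; exact: Cn_expR. Qed.

Lemma smooth_affine (c : R) z f : smooth f -> smooth (fun x => f (c *: x + z)).
Proof. by move=> /smoothP hf; apply/smoothP => n; exact: Cn_affine. Qed.

Lemma continuous_coord i : continuous (fun x => x 0 i).
Proof. by move=> x; exact: coord_continuous. Qed.

Lemma smooth_coord i : smooth (fun x => x 0 i).
Proof.
apply/smoothP => -[|n]; first exact: continuous_coord.
apply: CnS; first exact: continuous_coord.
by move=> j; eexists; [exact: pd_coord|exact: Cn_cst].
Qed.

Lemma smooth_sum (J : Type) (s : seq J) (h : J -> 'rV[R]_d -> R) :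
  (forall k, smooth (h k)) -> smooth (fun x => \sum_(k <- s) h k x).
Proof.
move=> H; elim: s => [|a s IH].
  rewrite (_ : (fun x => _) = (fun=> 0)); first exact: smooth_cst.
  by apply/funext => x; rewrite big_nil.
rewrite (_ : (fun x => _) = (fun x => h a x + \sum_(k <- s) h k x)).
  exact (smoothD (H a) IH).
by apply/funext => x; rewrite big_cons.
Qed.

Lemma smooth_prod (J : Type) (s : seq J) (h : J -> 'rV[R]_d -> R) :
  (forall k, smooth (h k)) -> smooth (fun x => \prod_(k <- s) h k x).
Proof.
move=> H; elim: s => [|a s IH].
  rewrite (_ : (fun x => _) = (fun=> 1)); first exact: smooth_cst.
  by apply/funext => x; rewrite big_nil.
rewrite (_ : (fun x => _) = (fun x => h a x * \prod_(k <- s) h k x)).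
  exact (smoothM (H a) IH).
by apply/funext => x; rewrite big_cons.
Qed.

Lemma bsupp_partial r i f : smooth f -> bsupp r f -> bsupp r (partial i f).
Proof.
move=> sf bf x rx.
have H : \forall y \near x, r < `|y|.
  have : \forall t \near `|x|, r < t by exact: lt_nbhsr.
  exact: (@norm_continuous _ _ x).
apply: (derive_val (is_derive := _)).
apply: near_eq_is_derive (is_derive_cst (0 : R) x _).
by apply: filterS H => y /bf ->.
Qed.

End smooth_functions.

Lemma mean_value0 {R : realType} (g g' : R -> R) (t : R) :
  (forall s : R, is_derive s (1 : R) g (g' s)) ->
  exists2 c, `|c| <= `|t| & g t - g 0 = t * g' c.
Proof.
move=> dg; have cg : continuous g.
  move=> s; apply/differentiable_continuous/derivable1_diffP.
  by case: (dg s).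
have cw a b : {within `[a, b], continuous g} by exact: continuous_subspaceT.
have [t0|t0|->] := ltgtP t 0.
- have [c] := MVT t0 (fun x _ => dg x) (cw _ _).
  rewrite in_itv /= sub0r => /andP[c1 c2] E; exists c.
    by rewrite !ltr0_norm // lerN2 ltW.
  by rewrite -opprB E mulrN opprK mulrC.
- have [c] := MVT t0 (fun x _ => dg x) (cw _ _).
  rewrite in_itv /= subr0 => /andP[c1 c2] E; exists c.
    by rewrite !gtr0_norm // ltW.
  by rewrite E mulrC.
- by exists 0; rewrite ?normr0 // subrr mul0r.
Qed.

(** * Directional derivatives, mean values and symmetry of second derivatives *)

Section multivariate.
Context {R : realType} {d : nat}.
Implicit Types (f g : 'rV[R]_d -> R) (x y z v : 'rV[R]_d) (i j : 'I_d).
Local Notation e i := (delta_mx 0 i : 'rV[R]_d).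

Lemma mean_value_line f f' x v (t : R) :
  (forall s, is_derive (x + s *: v) v f (f' (x + s *: v))) ->
  exists2 c : R, `|c| <= `|t| & f (x + t *: v) - f x = t * f' (x + c *: v).
Proof.
move=> H; have [s|c ct E] := @mean_value0 R (fun s => f (x + s *: v)) (fun s => f' (x + s *: v)) t.
  exact: is_derive_line.
by exists c => //; rewrite -E scale0r addr0.
Qed.

Lemma norm_delta (a : R) i : `|a *: e i| <= `|a|.
Proof.
apply/norm_rV_leP => // k; rewrite !mxE /=; case: (_ == _); rewrite ?mulr1 ?mulr0 ?normr0 //.
Qed.

(** The increment is taken one coordinate at a time; each step is a mean value along a basis vector,
    at a point that stays within [delta] of [x]. *)
Lemma increment_estimate f (f' : 'I_d -> 'rV[R]_d -> R) x (delta eps : R) :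
  (forall i, pd i f (f' i)) ->
  (forall i y, `|y - x| < delta -> `|f' i y - f' i x| <= eps) ->
  forall (l : seq 'I_d) (w : 'I_d -> R), \sum_(j <- l) `|w j| < delta ->
  `|f (x + \sum_(j <- l) w j *: e j) - f x - \sum_(j <- l) w j * f' j x| <=
     eps * \sum_(j <- l) `|w j|.
Proof.
move=> pf near; elim=> [|i l IH] w.
  by rewrite !big_nil addr0 !subrr mulr0 normr0.
rewrite !big_cons => wd.
have wd' : \sum_(j <- l) `|w j| < delta by apply: le_lt_trans wd; rewrite lerDr.
have := IH _ wd'; set y := \sum_(j <- l) _ *: _; set S := \sum_(j <- l) _ * _ => IHw.
have [c cw E] := mean_value_line (w i) (fun s => pf i (x + y + s *: e i)).
have -> : f (x + (w i *: e i + y)) - f x - (w i * f' i x + S) =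
   w i * (f' i (x + y + c *: e i) - f' i x) + (f (x + y) - f x - S).
  by rewrite mulrBr -E addrA addrAC; ring.
apply: (le_trans (ler_normD _ _)); rewrite [leRHS]mulrDr lerD // normrM mulrC ler_wpM2r //.
apply: near; have -> : x + y + c *: e i - x = c *: e i + y by apply/rowP => k; rewrite !mxE; ring.
apply: le_lt_trans wd; apply: (le_trans (ler_normD _ _)); apply: lerD.
  exact: le_trans (norm_delta _ _) cw.
apply: (le_trans (ler_norm_sum _ _ _)); apply: ler_sum => j _; exact: norm_delta.
Qed.

(** Smoothness speaks of basis directions only; continuity of the partial derivatives extends them
    to all directions, as needed along the segments in Korn's inequality. *)
Lemma smooth_is_derive f x v : smooth f ->
  is_derive x v f (\sum_i v 0 i * partial i f x).
Proof.
move=> sf; set L := \sum_i _.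
suff H : (fun h : R => h^-1 *: (f (h *: v + x) - f x)) @ 0^' --> L.
  by apply: DeriveDef; [apply/cvg_ex; exists L|apply: cvg_lim H].
apply/cvgrPdist_le => eps eps0.
(* The summand 1 keeps [N] positive for [v = 0]. *)
pose N := 1 + \sum_i `|v 0 i|.
have N0 : 0 < N by rewrite ltr_pwDl // sumr_ge0.
have [delta d0 Hd] : exists2 delta, 0 < delta & forall i y, `|y - x| < delta ->
    `|partial i f y - partial i f x| <= eps / N.
  have H i : \forall y \near x, `|partial i f x - partial i f y| <= eps / N.
    have /cvgrPdist_le := smooth_continuous (smooth_partial i sf) (x := x).
    by apply; rewrite divr_gt0.
  have nH : \forall y \near x, forall i, `|partial i f x - partial i f y| <= eps / N.
    exact: (filter_forall (f := fun i y => `|partial i f x - partial i f y| <= eps / N) _ H).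
  have [delta /= d0 Hd] := (nbhs_ballP _ _).1 nH.
  exists delta => // i y xy; rewrite distrC; apply: Hd => //.
  by rewrite -ball_normE /= distrC.
near=> h.
have h0 : h != 0 by near: h; exact: nbhs_dnbhs_neq.
have hd : `|h| < delta / N by near: h; apply: dnbhs0_lt; rewrite divr_gt0.
have E : h *: v + x = x + \sum_(j <- index_enum 'I_d) (h * v 0 j) *: e j.
  rewrite addrC; congr (_ + _); rewrite [v in LHS]row_sum_delta scaler_sumr.
  by apply: eq_bigr => j _; rewrite scalerA.
have S : \sum_(j <- index_enum 'I_d) `|h * v 0 j| = `|h| * (N - 1).
  rewrite /N addrAC subrr add0r mulr_sumr; apply: eq_bigr => j _; exact: normrM.
have H1 : \sum_(j <- index_enum 'I_d) `|h * v 0 j| < delta.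
  rewrite S; move: hd; rewrite ltr_pdivlMr // => /(le_lt_trans _); apply.
  by rewrite ler_wpM2l // gerBl.
have := increment_estimate (fun i => smooth_pd i sf) Hd H1.
rewrite -E S => H.
have -> : L - h^-1 *: (f (h *: v + x) - f x) = - h^-1 * (f (h *: v + x) - f x - \sum_(j <- index_enum 'I_d) h * v 0 j * partial j f x).
  have -> : \sum_(j <- index_enum 'I_d) h * v 0 j * partial j f x = h * L.
    by rewrite /L mulr_sumr; apply: eq_bigr => j _; rewrite mulrA.
  by rewrite mulNr mulrBr mulKf // opprB.
rewrite normrM normrN normfV ler_pdivrMl ?normr_gt0 //; apply: (le_trans H).
rewrite mulrCA ler_wpM2l // mulrAC ler_pdivrMr // ler_wpM2l ?ltW // gtrBl //.
Unshelve. all: by end_near. Qed.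

Lemma mean_value_smooth f x z : smooth f ->
  exists2 c : R, `|c| <= 1 & f (x + z) - f x = \sum_i z 0 i * partial i f (x + c *: z).
Proof.
move=> sf; have [c c1 E] := @mean_value_line f (fun y => \sum_i z 0 i * partial i f y) x z 1
  (fun s => smooth_is_derive _ _ sf).
by exists c; [rewrite normr1 in c1|rewrite scale1r mul1r in E].
Qed.

Lemma smooth_lipschitz r f : smooth f -> bsupp r f ->
  exists2 L, 0 < L & forall x z, `|f (x + z) - f x| <= L * `|z|.
Proof.
move=> sf bf.
have H i : exists M, forall x, `|partial i f x| <= M.
  have [M _ HM] := bsupp_bounded (smooth_continuous (smooth_partial i sf)) (bsupp_partial i sf bf).
  by exists M.
pose M i := projT1 (cid (H i)).
have HM i x : `|partial i f x| <= M i by rewrite /M; case: cid.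
have M0 i : 0 <= M i by apply: le_trans (HM i 0).
exists (1 + \sum_i M i); first by rewrite ltr_pwDl // sumr_ge0.
move=> x z; have [c _ ->] := mean_value_smooth x z sf.
apply: (le_trans (ler_norm_sum _ _ _)); rewrite mulrDl mul1r.
apply: (@le_trans _ _ ((\sum_i M i) * `|z|)); last by rewrite lerDr.
rewrite mulr_suml; apply: ler_sum => i _; rewrite normrM mulrC.
by rewrite ler_pM // ler_coord.
Qed.

(** Two mean values: along [e i] for the increment of [f] in direction [e j], then along [e j] for
    [partial i f]. *)
Lemma mixed_difference f x i j (s : R) : smooth f -> exists2 p, `|p - x| <= `|s| + `|s| &
  f (x + s *: e i + s *: e j) - f (x + s *: e i) - f (x + s *: e j) + f x =
  s * (s * partial j (partial i f) p).
Proof.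
move=> sf.
pose g y := f (y + s *: e j) - f y.
have pg : pd i g (fun y => partial i f (y + s *: e j) - partial i f y).
  move=> y; apply: (is_deriveB _ (smooth_pd i sf y)).
  have := @pd_affine R d i f _ 1 (s *: e j) (smooth_pd i sf) y.
  by rewrite mul1r scale1r; under eq_fun do rewrite scale1r.
have [c cs E] := mean_value_line s (fun t => pg (x + t *: e i)).
have [c' cs' E'] := mean_value_line s (fun t => smooth_pd j (smooth_partial i sf) (x + c *: e i + t *: e j)).
exists (x + c *: e i + c' *: e j).
  have -> : x + c *: e i + c' *: e j - x = c *: e i + c' *: e j by apply/rowP => k; rewrite !mxE; ring.
  apply: (le_trans (ler_normD _ _)).
  by apply: lerD; apply: le_trans (norm_delta _ _) _.
by rewrite -E' -E /g; ring.
Qed.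

(** The second difference is symmetric in [i] and [j], so the two mixed derivatives agree at two
    points within [2 |s|] of [x]; their continuity does the rest. *)
Lemma partialC f i j : smooth f -> partial i (partial j f) = partial j (partial i f).
Proof.
move=> sf; apply/funext => x; apply/eqP; rewrite -subr_eq0 -normr_le0.
apply/ler_addgt0Pr => eps eps0; rewrite add0r.
pose A := partial i (partial j f); pose B := partial j (partial i f).
have cA : continuous A by apply: smooth_continuous; do 2 apply: smooth_partial.
have cB : continuous B by apply: smooth_continuous; do 2 apply: smooth_partial.
have nA : \forall y \near x, `|A x - A y| <= eps / 2.
  by have /cvgrPdist_le := cA x; apply; rewrite divr_gt0.
have nB : \forall y \near x, `|B x - B y| <= eps / 2.
  by have /cvgrPdist_le := cB x; apply; rewrite divr_gt0.
have [delta /= d0 Hd] := (nbhs_ballP _ _).1 (filterI nA nB).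
pose s := delta / 4.
have s0 : 0 < s by rewrite divr_gt0.
have sd : `|s| + `|s| < delta by rewrite gtr0_norm // /s; lra.
have inball p : `|p - x| <= `|s| + `|s| -> ball x delta p.
  by rewrite -ball_normE /= distrC => /le_lt_trans; apply.
have [p /inball/Hd[_ hp] E] := mixed_difference x i j s sf.
have [q /inball/Hd[hq _] E'] := mixed_difference x j i s sf.
have ring_swap (a b c t u v : R) : a - b - c + t = u -> a - c - b + t = v -> v = u.
  by move=> <- <-; ring.
have E2 : x + s *: e j + s *: e i = x + s *: e i + s *: e j by rewrite addrAC.
rewrite E2 in E'.
have AB : A q = B p.
  by apply: (mulfI (lt0r_neq0 s0)); apply: (mulfI (lt0r_neq0 s0)); exact: ring_swap E E'.
have tri (a b a' b' : R) : a' = b' -> `|a - a'| <= eps / 2 -> `|b - b'| <= eps / 2 ->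
    `|a - b| <= eps.
  move=> <- h1 h2; have -> : a - b = (a - a') - (b - a') by ring.
  by apply: (le_trans (ler_normB _ _)); rewrite [eps]splitr lerD.
exact: tri AB hq hp.
Qed.

End multivariate.

(** * Bump functions *)

Section bump_profile.
Context {R : realType}.
Implicit Types (s t : R) (k n : nat).

(* The family over [k] is closed under differentiation up to linear combinations. *)
Definition flat k t : R := if 0 < t then expR (- t^-1) * t^-1 ^+ k else 0.

Lemma flat_ge0 k t : 0 <= flat k t.
Proof.
rewrite /flat; case: ifP => // t0; rewrite mulr_ge0 ?expR_ge0 // exprn_ge0 // invr_ge0; exact: ltW.
Qed.

Lemma flat0_gt0 t : (0 < flat 0 t) = (0 < t).
Proof.
by rewrite /flat; case: ifP => t0; [rewrite expr0 mulr1 expR_gt0|rewrite ltxx].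
Qed.

Lemma exprn_le_expR n s : 0 <= s -> s ^+ n.+1 <= n.+1%:R ^+ n.+1 * expR s.
Proof.
move=> s0.
have n0 : 0 < n.+1%:R :> R by [].
have -> : expR s = expR (s / n.+1%:R) ^+ n.+1.
  by rewrite -expRM_natl mulrC divfK // lt0r_neq0.
rewrite -exprMn lerXn2r ?nnegrE // ?mulr_ge0 ?expR_ge0 //.
rewrite -ler_pdivrMl // mulrC.
by apply: le_trans (expR_ge1Dx _); rewrite lerDr.
Qed.

(** With [s = t^-1] this is [s^(k+1) <= (k+1)^(k+1) e^s]. A bound linear in [t] for every [k] yields
    the zero derivative at 0, since the difference quotient there is [flat k.+1]. *)
Lemma flat_bound k t : `|flat k t| <= k.+1%:R ^+ k.+1 * `|t|.
Proof.
rewrite ger0_norm ?flat_ge0 // /flat; case: ifP => t0; last by rewrite mulr_ge0 ?exprn_ge0.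
rewrite gtr0_norm // expRN -ler_pdivrMr // -mulrA -exprSr mulrC ler_pdivrMr ?expR_gt0 //.
by apply: exprn_le_expR; rewrite invr_ge0 ltW.
Qed.

Lemma flat_quotient k t : t^-1 * flat k t = flat k.+1 t.
Proof.
rewrite /flat; case: ifP => _; last by rewrite mulr0.
by rewrite mulrCA -exprS.
Qed.

Lemma is_derive_flat k t :
  is_derive t (1 : R) (flat k) (flat k.+2 t - k%:R * flat k.+1 t).
Proof.
have [t0|t0|t0] := ltgtP t 0.
- have -> : flat k.+2 t - k%:R * flat k.+1 t = 0.
    by rewrite /flat ltNge (ltW t0) /= mulr0 subrr.
  apply: near_eq_is_derive (is_derive_cst (0 : R) t (1 : R)).
  have : \forall s \near t, s < 0 by exact: lt_nbhsl.
  by apply: filterS => s s0; rewrite /flat ltNge (ltW s0).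
- have tn0 : t != 0 by rewrite gt_eqF.
  have dV : is_derive t (1 : R) (fun s : R => s^-1) (- t^-1 ^+ 2).
    apply: is_derive_eq (@is_deriveV R id t 1 1 tn0 (is_derive_id _ _)) _.
    by rewrite -exprVn; rewrite [LHS]mulr1.
  have d1 : is_derive t (1 : R) (fun s : R => expR (- s^-1)) (expR (- t^-1) * t^-1 ^+ 2).
    apply: (@is_derive_comp1 R R expR (fun s => - s^-1)).
    by apply: is_derive_eq (is_deriveN dV) _; rewrite opprK.
  have d2 : is_derive t (1 : R) (fun s : R => s^-1 ^+ k) (k%:R * t^-1 ^+ k.-1 * - t^-1 ^+ 2).
    by have := is_deriveX k dV; rewrite exprfctE.
  apply: near_eq_is_derive (is_derive_eq (is_deriveM d1 d2) _).
    have : \forall s \near t, 0 < s by exact: lt_nbhsr.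
    by apply: filterS => s s0; rewrite /flat s0.
  rewrite /flat t0 /GRing.scale /=.
  by case: (k) => [|k']; rewrite /= !exprS ?expr0; ring.
- rewrite t0.
  have -> : flat k.+2 0 - k%:R * flat k.+1 0 = 0 :> R.
    by rewrite /flat ltxx mulr0 subrr.
  suff H : (fun h : R => h^-1 *: (flat k (h *: 1 + 0) - flat k 0)) @ 0^' --> (0 : R).
    by apply: DeriveDef; [apply/cvg_ex; exists 0|apply: cvg_lim H].
  apply/cvgrPdist_le => eps eps0; near=> h.
  have c0 : 0 < k.+2%:R ^+ k.+2 :> R by rewrite exprn_gt0.
  have -> : flat k (0 : R) = 0 by rewrite /flat ltxx.
  rewrite subr0 addr0 [h *: 1]mulr1 sub0r normrN [_ *: _]flat_quotient //.
  apply: (le_trans (flat_bound _ _)).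
  rewrite -ler_pdivlMl // ltW //.
  near: h; apply: dnbhs0_lt; rewrite mulr_gt0 // invr_gt0 //.
Unshelve. all: by end_near. Qed.

Lemma continuous_flat k : continuous (@flat k).
Proof.
move=> s; apply/differentiable_continuous/derivable1_diffP.
by case: (is_derive_flat k s).
Qed.

End bump_profile.

Section bump.
Context {R : realType} {d : nat}.
Notation mu := (lebesgue_rV R d).
Implicit Types (f g : 'rV[R]_d -> R).

Lemma Cn_flat n k g : Cn n g -> Cn n (fun x => flat k (g x)).
Proof.
elim: n k g => [|n IH] k g.
  by move=> cg x; apply: (continuous_comp (cg x)); exact: continuous_flat.
move=> Cg; have Cg1 := CnW Cg; move: Cg => /CnSP[cg hg]; apply: CnS => [x|i].
  by apply: (continuous_comp (cg x)); exact: continuous_flat.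
have [pg cg'] := hg i.
eexists; first exact: (pd_comp1 (is_derive_flat k) pg).
apply: CnM => //; apply: CnD; first exact: IH.
have -> : (fun x => - (k%:R * flat k.+1 (g x))) = (fun x => (- k%:R) * flat k.+1 (g x)).
  by apply/funext => x; rewrite mulNr.
by apply: CnM; [exact: Cn_cst|exact: IH].
Qed.

Lemma smooth_flat k g : smooth g -> smooth (fun x => flat k (g x)).
Proof. by move=> /smoothP hg; apply/smoothP => n; exact: Cn_flat. Qed.

Lemma I_gt0 f (r : R) : continuous f -> bsupp r f -> (forall x, 0 <= f x) -> 0 < f 0 ->
  0 < \int[mu]_x f x.
Proof.
move=> cf bf f0 fp.
have nf : \forall x \near (0 : 'rV[R]_d), f 0 / 2 < f x.
  have H : \forall t \near f 0, f 0 / 2 < t by apply: lt_nbhsr; lra.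
  exact: (cf 0 _ H).
have [delta /= d0 Hd] := (nbhs_ballP _ _).1 nf.
apply: (@lt_le_trans _ _ (\int[mu]_x (f 0 / 2 * \1_(cube (delta / 2)) x))).
  rewrite IZ; last exact: ig_indic_cube.
  have -> : \int[mu]_x \1_(cube (delta / 2)) x = (delta / 2 *+ 2) ^+ d.
    rewrite /Rintegral integral_indic ?setIT; [|exact: measurableT|exact: measurable_cube].
    by apply: (congr1 fine (lebesgue_rV_cube _)); rewrite divr_ge0 // ltW.
  by rewrite mulr_gt0 ?divr_gt0 // exprn_gt0 // pmulrn_rgt0 // divr_gt0.
apply: I_le => [||x]; first by apply: igZ; exact: ig_indic_cube.
- exact: ig_cc bf.
- rewrite indicE; have [xc|xc] := boolP (x \in _); last by rewrite mulr0.
  rewrite mulr1; apply: ltW; apply: Hd; rewrite -ball_normE /= sub0r normrN.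
  have : `|x| <= delta / 2 by rewrite inE in xc.
  by move=> /le_lt_trans; apply; lra.
Qed.

Lemma bump_exists (r : R) : 0 < r -> exists2 eta : 'rV[R]_d -> R, smooth eta &
  [/\ bsupp r eta, forall x, 0 <= eta x & \int[mu]_x eta x = 1].
Proof.
move=> r0.
pose f (x : 'rV[R]_d) := \prod_(i < d) (flat 0 (r - x 0 i) * flat 0 (r + x 0 i)).
have sf : smooth f.
  apply: smooth_prod => i; apply: smoothM; apply: smooth_flat.
    by apply: smoothB; [exact: smooth_cst|exact: smooth_coord].
  by apply: smoothD; [exact: smooth_cst|exact: smooth_coord].
have bf : bsupp r f.
  move=> x rx; have [i ri] : exists i, r < `|x 0 i|.
    apply: contrapT => /forallNP H; move: rx; rewrite ltNge => /negP; apply.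
    by apply/norm_rV_leP => [|i]; [exact: ltW|rewrite leNgt; apply/negP/H].
  rewrite /f (bigD1 i) //= (_ : flat 0 _ * flat 0 _ = 0) ?mul0r //.
  have [x0|x0] := lerP 0 (x 0 i).
    rewrite ger0_norm // in ri.
    by rewrite [flat 0 (r - _)]/flat subr_gt0 ltNge ltW ?mul0r.
  rewrite ltr0_norm // in ri.
  have h : (0 < r + x 0 i) = false by apply: le_gtF; lra.
  have -> : flat 0 (r + x 0 i) = 0 by rewrite /flat h.
  by rewrite mulr0.
have f0 x : 0 <= f x by apply: prodr_ge0 => i _; rewrite mulr_ge0 ?flat_ge0.
have fp : 0 < f 0.
  by apply: prodr_gt0 => i _; rewrite mxE subr0 addr0 mulr_gt0 ?flat0_gt0.
have If := I_gt0 (smooth_continuous sf) bf f0 fp.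
exists (fun x => (\int[mu]_x f x)^-1 * f x); first exact: smoothZ.
split => [x /bf -> |x|]; first by rewrite mulr0.
- by rewrite mulr_ge0 // invr_ge0 ltW.
- by rewrite IZ ?mulVf ?gt_eqF //; apply: ig_cc bf; exact: smooth_continuous.
Qed.

Lemma test_functionP (r : R) f : smooth f -> bsupp r f -> test_function f.
Proof.
move=> sf bf; split => //.
have cc : closed (cube r : set 'rV[R]_d).
  by apply: compact_closed; [exact: norm_hausdorff|exact: compact_cube].
apply: (@subclosed_compact _ _ (cube r)); [exact: closed_closure|exact: compact_cube|].
rewrite [X in _ `<=` X]((closure_id _).1 cc); apply: closure_subset => x /= /eqP fx.
by rewrite /cube /= leNgt; apply/negP => /bf.
Qed.

End bump.

(** * Mollification *)

(** The form of all later choices of a small increment; [K + 1] in place of [K] covers a vanishing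
    integral [K]. *)
Lemma mulr_le_of_lt_div {R : realFieldType} (L a K eps : R) : 0 < L -> 0 <= K -> 0 <= a ->
  a < eps / (L * (K + 1)) -> L * a * K <= eps.
Proof.
move=> L0 K0 a0; rewrite ltr_pdivlMr ?mulr_gt0 ?ltr_wpDl // => /ltW; apply: le_trans.
by rewrite mulrCA mulrA ler_wpM2l ?mulr_ge0 ?(ltW L0) // lerDl.
Qed.

Section mollification.
Context {R : realType} {d : nat}.
Notation mu := (lebesgue_rV R d).
Implicit Types (f g eta : 'rV[R]_d -> R) (x y z : 'rV[R]_d) (i : 'I_d).

(** The kernel is [eta (y - x)], not [eta (x - y)]: the value at [x] is then literally the pairing
    of [f] with a translated test function, and no symmetry of [eta] is involved. The price is a
    minus sign in [pd_moll]. *)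
Definition moll eta f x := \int[mu]_y (eta (y - x) * f y).

Lemma bsupp_shift r eta x : bsupp r eta -> bsupp (r + `|x|) (fun y => eta (y - x)).
Proof.
move=> be y ry; apply: be; rewrite -(ltrD2r `|x|); apply: (lt_le_trans ry).
by apply: le_trans (ler_normD _ _); rewrite subrK.
Qed.

Lemma bsuppMl r f g : bsupp r f -> bsupp r (fun x => f x * g x).
Proof. by move=> bf x /bf ->; rewrite mul0r. Qed.

Lemma continuous_shift eta x : continuous eta -> continuous (fun y => eta (y - x)).
Proof.
move=> ce; have := @continuous_affine R d eta 1 (- x) ce.
by under eq_fun do rewrite scale1r.
Qed.

Lemma moll_ig r eta f x : continuous eta -> bsupp r eta -> L2loc f ->
  ig mu (fun y => eta (y - x) * f y).
Proof.
move=> ce be hf; have [M _ HM] := bsupp_bounded ce be.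
apply: (L2loc_bsupp_ig (r := r + `|x|) (M := M)) => //.
- by apply: continuous_measurable_rV; exact: continuous_shift.
- exact: bsupp_shift.
Qed.

Lemma L2loc_indic_ig r f : L2loc f -> ig mu (fun y => \1_(cube r) y * `|f y|).
Proof.
move=> hf; have := @L2loc_bsupp_ig R d r 1 (\1_(cube r)) f _ _ _ hf.
have m1 := @measurable_indic_cube R d r.
move=> H; have /ig_abs : ig mu (fun x => \1_(cube r) x * f x).
  apply: H => // [x rx|x]; rewrite indicE; last by rewrite ger0_norm // lern1 leq_b1.
  by rewrite memNset //= => xr; rewrite ltNge xr in rx.
by apply: ig_ext => y; rewrite normrM ger0_norm // indicE.
Qed.

Lemma moll_estimate (c K r : R) (w f : 'rV[R]_d -> R) : ig mu (fun y => w y * f y) ->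
  L2loc f -> bsupp r w -> 0 <= c -> (forall y, `|w y| <= c) ->
  `|\int[mu]_y (w y * f y)| <= c * \int[mu]_y (\1_(cube r) y * `|f y|).
Proof.
move=> iw hf bw c0 Hw; apply: (le_trans (I_abs iw)).
rewrite -IZ; last exact: L2loc_indic_ig.
apply: I_le => [||y]; [exact: ig_abs|by apply: igZ; exact: L2loc_indic_ig|].
rewrite normrM indicE; have [yr|yr] := leP `|y| r.
  by rewrite mem_set // mul1r ler_wpM2r.
by rewrite bw // normr0 mul0r mulr_ge0 // mulr_ge0.
Qed.

Lemma continuous_moll r eta f : smooth eta -> bsupp r eta -> L2loc f -> continuous (moll eta f).
Proof.
move=> se be hf x; have ce := smooth_continuous se.
have [L L0 HL] := smooth_lipschitz se be.
pose K := \int[mu]_y (\1_(cube (r + `|x| + 1)) y * `|f y|).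
have K0 : 0 <= K by apply: I_ge0 => y; rewrite mulr_ge0 // indicE.
suff H : forall eps, 0 < eps -> \forall y \near nbhs x, `|moll eta f x - moll eta f y| <= eps.
  by apply/(@cvgrPdist_le _ _ _ (nbhs x) (nbhs_filter x)).
move=> eps eps0.
have dlt0 : 0 < Num.min 1 (eps / (L * (K + 1))).
  by rewrite lt_min ltr01 divr_gt0 // mulr_gt0 // ltr_wpDl.
apply/(nbhs_ballP _ _).2; exists (Num.min 1 (eps / (L * (K + 1)))) => //= y.
rewrite -ball_normE /= lt_min => /andP[xy1 xy].
have i1 := moll_ig x ce be hf; have i2 := moll_ig y ce be hf.
rewrite /moll -IB //.
have E : (fun u => eta (u - x) * f u - eta (u - y) * f u) = (fun u => (eta (u - x) - eta (u - y)) * f u).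
  by apply/funext => u; rewrite mulrBl.
have := @moll_estimate (L * `|x - y|) K (r + `|x| + 1) (fun u => eta (u - x) - eta (u - y)) f.
rewrite -E => /(_ (igB i1 i2) hf) H.
apply: (le_trans (H _ _ _)) => [u ru||u|].
- rewrite (bsupp_shift (x := x) be) ?(bsupp_shift (x := y) be) ?subrr //.
    apply: le_lt_trans ru; rewrite -addrA lerD2l.
    have -> : y = x - (x - y) by rewrite opprB addrC subrK.
    by apply: (le_trans (ler_normB _ _)); rewrite lerD2l ltW.
  by apply: le_lt_trans ru; rewrite lerDl.
- by rewrite mulr_ge0 // ltW.
- have -> : u - x = (u - y) + (y - x) by rewrite addrA subrK.
  by apply: (le_trans (HL _ _)); rewrite distrC.
- exact: mulr_le_of_lt_div.
Qed.

(** The error of the difference quotient is again an integral of [f] against a kernel [w]. By the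
    mean value theorem and the Lipschitz bound on [partial i eta], [|w| <= L |h|], and [w] vanishes
    outside a cube independent of [h]. *)
Lemma pd_moll i r eta f : smooth eta -> bsupp r eta -> L2loc f ->
  pd i (moll eta f) (fun x => - moll (partial i eta) f x).
Proof.
move=> se be hf x; have ce := smooth_continuous se.
have se' := smooth_partial i se; have be' := bsupp_partial i se be.
have ce' := smooth_continuous se'.
have [L L0 HL] := smooth_lipschitz se' be'.
pose K := \int[mu]_y (\1_(cube (r + `|x| + 1)) y * `|f y|).
have K0 : 0 <= K by apply: I_ge0 => y; rewrite mulr_ge0 // indicE.
set T' := - moll _ _ _.
suff H : (fun h : R => h^-1 *: (moll eta f (h *: delta_mx 0 i + x) - moll eta f x)) @ 0^' --> T'.
  by apply: DeriveDef; [apply/cvg_ex; exists T'|apply: cvg_lim H].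
apply/cvgrPdist_le => eps eps0; near=> h.
have h0 : h != 0 by near: h; exact: nbhs_dnbhs_neq.
have h1 : `|h| < 1 by near: h; exact: dnbhs0_lt.
have hd : `|h| < eps / (L * (K + 1)).
  by near: h; apply: dnbhs0_lt; rewrite divr_gt0 // mulr_gt0 // ltr_wpDl.
set v : 'rV[R]_d := h *: delta_mx 0 i.
have vh : `|v| <= `|h| by exact: norm_delta.
have i1 := moll_ig x ce be hf; have i2 := moll_ig (v + x) ce be hf.
have i3 := moll_ig x ce' be' hf.
pose w u := partial i eta (u - x) + h^-1 * (eta (u - (v + x)) - eta (u - x)).
have E : (fun u => partial i eta (u - x) * f u + h^-1 * (eta (u - (v + x)) * f u - eta (u - x) * f u)) =
   (fun u => w u * f u).
  by apply/funext => u; rewrite /w; ring.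
have iw : ig mu (fun u => w u * f u) by rewrite -E; apply: igD => //; apply: igZ; exact: igB.
have -> : T' - h^-1 *: (moll eta f (v + x) - moll eta f x) = - \int[mu]_u (w u * f u).
  rewrite -E ID //; last by apply: igZ; exact: igB.
  rewrite IZ; last exact: igB.
  by rewrite IB // opprD.
rewrite normrN.
have H := @moll_estimate (L * `|h|) K (r + `|x| + 1) w f iw hf.
apply: (le_trans (H _ _ _)) => [u ru||u|].
- have ru' : r + `|x| < `|u| by apply: le_lt_trans ru; rewrite lerDl.
  have ru2 : r + `|v + x| < `|u|.
    apply: le_lt_trans ru; rewrite -addrA lerD2l (le_trans (ler_normD _ _)) //.
    by rewrite [leRHS]addrC lerD2r (le_trans vh) // ltW.
  rewrite /w (bsupp_shift be' ru') (bsupp_shift (x := x) be ru') (bsupp_shift be ru2).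
  by rewrite subrr mulr0 addr0.
- by rewrite mulr_ge0 // ltW.
- rewrite /w; have [c ch Ec] := mean_value_line (- h) (fun s => smooth_pd i se ((u - x) + s *: delta_mx 0 i)).
  have -> : u - (v + x) = u - x + - h *: delta_mx 0 i by rewrite scaleNr -/v opprD addrCA addrC.
  rewrite Ec mulNr mulrN mulKf // distrC.
  apply: (le_trans (HL _ _)); rewrite ler_wpM2l ?(ltW L0) //.
  by apply: le_trans (norm_delta _ _) _; apply: (le_trans ch); rewrite normrN.
- exact: mulr_le_of_lt_div.
Unshelve. all: by end_near. Qed.

Lemma smooth_moll r eta f : smooth eta -> bsupp r eta -> L2loc f -> smooth (moll eta f).
Proof.
move=> se be hf; apply/smoothP => n; elim: n eta se be => [|n IH] eta se be.
  exact: continuous_moll se be hf.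
apply: CnS => [|i]; first exact: continuous_moll se be hf.
eexists; first exact: pd_moll se be hf.
have -> : (fun x => - moll (partial i eta) f x) = (fun x => -1 * moll (partial i eta) f x).
  by apply/funext => x; rewrite mulN1r.
apply: CnM; first exact: Cn_cst.
by apply: IH; [exact: smooth_partial|exact: bsupp_partial].
Qed.

Lemma mollE r eta f x : continuous eta -> bsupp r eta -> L2loc f ->
  ig mu (fun z => eta z * f (z + x)) /\ moll eta f x = \int[mu]_z (eta z * f (z + x)).
Proof.
move=> ce be hf; have h := moll_ig x ce be hf.
have E : (fun z => eta z * f (z + x)) = (fun z => (fun y => eta (y - x) * f y) (z + x)).
  by apply/funext => z; rewrite addrK.
split; first by rewrite E; exact: (ig_translate x h).
rewrite E; apply/esym; apply: (@I_translate R d x (fun y => eta (y - x) * f y)); exact: ig_meas h.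
Qed.

End mollification.

(** * Continuity of translations in L^2 and convergence of mollifications *)

Section translation_continuity.
Context {R : realType} {d : nat}.

(** A second generating pi-system besides the rectangles: indicators of open boxes are pointwise
    limits of smooth functions that they dominate. *)
Definition obox (a b : 'I_d -> R) : set 'rV[R]_d := [set x | forall i, a i < x 0 i < b i].

Definition oboxes : set (set 'rV[R]_d) := [set B | exists a b, B = obox a b].

Lemma measurable_obox a b : measurable (obox a b).
Proof.
by apply: rectangles_measurable; exists (fun i => `]a i, b i[%classic).
Qed.

Lemma setI_closed_oboxes : setI_closed oboxes.
Proof.
move=> _ _ [a [b ->]] [a' [b' ->]].
exists (fun i => Num.max (a i) (a' i)), (fun i => Num.min (b i) (b' i)).
apply/seteqP; split => x /=.
  by move=> [h h'] i; rewrite gt_max lt_min; have /andP[-> ->] := h i; have /andP[-> ->] := h' i.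
by move=> h; split => i; have := h i; rewrite gt_max lt_min => /andP[/andP[h1 h2] /andP[h3 h4]];
  apply/andP.
Qed.

Lemma measurable_oboxes : @measurable _ 'rV[R]_d = <<s oboxes >>.
Proof.
apply/seteqP; split; last first.
  apply: smallest_sub; first exact: sigma_algebra_measurable.
  by move=> _ [a [b ->]]; exact: measurable_obox.
apply: smallest_sub; first exact: smallest_sigma_algebra.
rewrite -bigcup_seq; apply: bigcup_sub => i _.
rewrite [X in preimage_set_system _ _ X](_ : _ = (@RGenOpens.G R).-sigma.-measurable); last first.
  exact: RGenOpens.measurableE.
rewrite -(@g_sigma_preimageE _ R setT (fun x : 'rV[R]_d => x 0 i) (@RGenOpens.G R)).
apply: smallest_sub; first exact: smallest_sigma_algebra.
move=> _ [_ [u [v ->]] <-].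
have -> : [set: 'rV[R]_d] `&` (fun x => x 0 i) @^-1` `]u, v[%classic =
   \bigcup_n obox (fun j => if j == i then u else - n%:R) (fun j => if j == i then v else n%:R).
  apply/seteqP; split => x /= => [[_]|[n _ /(_ i)]]; rewrite in_itv /=; last by rewrite eqxx.
  move=> uv; exists (Num.truncn `|x|).+1 => //= j.
  case: eqP => [-> //|_]; rewrite -ltr_norml.
  by apply: le_lt_trans (ler_coord x j) _; exact: truncnS_gt.
pose GT : sigmaRingType _ := g_sigma_algebraType oboxes.
apply: (@bigcupT_measurable _ GT) => n.
by apply: sub_sigma_algebra; eexists; eexists.
Qed.

Notation mu := (lebesgue_rV R d).
Implicit Types (f g eta : 'rV[R]_d -> R) (x y z : 'rV[R]_d).

Definition tcont f := forall delta : R, 0 < delta -> exists2 rho, 0 < rho &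
  forall z, `|z| <= rho -> \int[mu]_x ((f (x + z) - f x) ^+ 2) <= delta.

(** The class to be identified with all of L^2. It is enlarged from smooth functions to indicators
    of open boxes, of bounded Borel sets, and then to limits of simple functions. *)
Definition good f := L2f mu f /\ tcont f.

Lemma good_approx f : L2f mu f ->
  (forall delta, 0 < delta -> exists2 g, good g & \int[mu]_x ((f x - g x) ^+ 2) <= delta) ->
  good f.
Proof.
move=> hf H; split => // delta delta0.
(* Three errors enter through [(p + q + r)^2 <= 3 (p^2 + q^2 + r^2)]; a ninth of [delta] for each
   adds up to [delta]. *)
have [|g [hg tg] fg] := H (delta / 9); first by rewrite divr_gt0.
have [|rho rho0 Hrho] := tg (delta / 9); first by rewrite divr_gt0.
exists rho => // z /Hrho zg.
have h1 : L2f mu (fun x => f (x + z) - g (x + z)) := L2_translate z (L2B hf hg).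
have h2 : L2f mu (fun x => g (x + z) - g x) := L2B (L2_translate z hg) hg.
have h3 : L2f mu (fun x => f x - g x) := L2B hf hg.
have h4 : L2f mu (fun x => f (x + z) - f x) := L2B (L2_translate z hf) hf.
have E1 : \int[mu]_x ((f (x + z) - g (x + z)) ^+ 2) <= delta / 9.
  apply: le_trans fg; rewrite -(I_translate z (f := fun x => (f x - g x) ^+ 2)) //.
  exact: ig_meas h3.2.
apply: (@le_trans _ _ (\int[mu]_x (3 * (f (x + z) - g (x + z)) ^+ 2 +
   (3 * (g (x + z) - g x) ^+ 2 + 3 * (f x - g x) ^+ 2)))).
  apply: I_le => [||x]; first exact: h4.2.
    by apply: igD; [|apply: igD]; apply: igZ; [exact: h1.2|exact: h2.2|exact: h3.2].
  move: (f (x + z)) (g (x + z)) (f x) (g x) => a b c e.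
  rewrite -subr_ge0 [X in 0 <= X](_ : _ = (a - b - (b - e)) ^+ 2 + (a - b - (e - c)) ^+ 2 + (b - e - (e - c)) ^+ 2).
    by rewrite !addr_ge0 // sqr_ge0.
  by ring.
rewrite ID; [|apply: igZ; exact: h1.2|apply: igD; apply: igZ; [exact: h2.2|exact: h3.2]].
rewrite ID; [|apply: igZ; exact: h2.2|apply: igZ; exact: h3.2].
rewrite !IZ; [|exact: h3.2|exact: h2.2|exact: h1.2].
by move: fg zg E1; lra.
Qed.

Lemma goodZ (k : R) f : good f -> good (fun x => k * f x).
Proof.
move=> [hf tf]; split => [|delta delta0]; first exact: L2Z.
have [|rho rho0 H] := tf (delta / (k ^+ 2 + 1)).
  by rewrite divr_gt0 // ltr_wpDl // sqr_ge0.
exists rho => // z /H; rewrite ler_pdivlMr ?ltr_wpDl ?sqr_ge0 // => Hz.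
have h : L2f mu (fun x => f (x + z) - f x) := L2B (L2_translate z hf) hf.
apply: le_trans Hz.
rewrite (@I_ext _ _ _ _ _ (fun x => k ^+ 2 * (f (x + z) - f x) ^+ 2)); last first.
  by move=> x; rewrite -mulrBr exprMn.
rewrite IZ; last exact: h.2.
by rewrite mulrC ler_wpM2l ?lerDl // I_ge0 // => x; exact: sqr_ge0.
Qed.

Lemma goodD f g : good f -> good g -> good (fun x => f x + g x).
Proof.
move=> [hf tf] [hg tg]; split => [|delta delta0]; first exact: L2D.
have [|r1 r10 H1] := tf (delta / 4); first by rewrite divr_gt0.
have [|r2 r20 H2] := tg (delta / 4); first by rewrite divr_gt0.
exists (Num.min r1 r2) => [|z]; first by rewrite lt_min r10.
rewrite le_min => /andP[/H1 z1 /H2 z2].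
have h1 : L2f mu (fun x => f (x + z) - f x) := L2B (L2_translate z hf) hf.
have h2 : L2f mu (fun x => g (x + z) - g x) := L2B (L2_translate z hg) hg.
have h3 : L2f mu (fun x => f (x + z) + g (x + z) - (f x + g x)).
  exact: (L2B (L2_translate z (L2D hf hg)) (L2D hf hg)).
apply: (@le_trans _ _ (\int[mu]_x (2 * (f (x + z) - f x) ^+ 2 + 2 * (g (x + z) - g x) ^+ 2))).
  apply: I_le => [||x]; first exact: h3.2.
    by apply: igD; apply: igZ; [exact: h1.2|exact: h2.2].
  move: (f (x + z)) (g (x + z)) (f x) (g x) => a b c e.
  rewrite -subr_ge0 [X in 0 <= X](_ : _ = (a - c - (b - e)) ^+ 2); first exact: sqr_ge0.
  by ring.
rewrite ID; [|apply: igZ; exact: h1.2|apply: igZ; exact: h2.2].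
rewrite !IZ; [|exact: h2.2|exact: h1.2].
by move: z1 z2; lra.
Qed.

Lemma L2_0 : L2f mu (fun=> 0).
Proof.
by split => //; apply: ig_ext (@ig0 _ _ _ mu) => x; rewrite expr0n.
Qed.

Lemma good0 : good (fun=> 0).
Proof.
split => [|delta delta0]; first exact: L2_0.
exists 1 => // z _; rewrite subrr expr0n /=.
by rewrite I0 ltW.
Qed.

Lemma good_sum n (h : 'I_n -> 'rV[R]_d -> R) : (forall i, good (h i)) ->
  good (fun x => \sum_(i < n) h i x).
Proof.
elim: n h => [|n IH] h H.
  by rewrite (_ : (fun x => _) = (fun=> 0)); [exact: good0|apply/funext => x; rewrite big_ord0].
rewrite (_ : (fun x => _) = (fun x => h ord0 x + \sum_(i < n) h (lift ord0 i) x)); last first.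
  by apply/funext => x; rewrite big_ord_recl.
by apply: goodD => //; apply: IH.
Qed.

(** The limit is dominated by [F] as well, so [(f_n - f)^2 <= 4 F^2] and dominated convergence
    supplies the approximations for [good_approx]. *)
Lemma good_lim (f_ : nat -> 'rV[R]_d -> R) f F : (forall n, good (f_ n)) ->
  (forall x, f_ n x @[n --> \oo] --> f x) -> L2f mu F ->
  (forall n x, `|f_ n x| <= F x) -> measurable_fun setT f -> good f.
Proof.
move=> Hf cf hF fF mf.
have fF' x : `|f x| <= F x.
  have cn : `|f_ n x| @[n --> \oo] --> `|f x| by exact: cvg_norm.
  rewrite -(cvg_lim _ cn) //; apply: limr_le; first by apply/cvg_ex; eexists; exact: cn.
  exact: nearW.
have F0 x : 0 <= F x by apply: le_trans (fF' x).
have hf : L2f mu f.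
  by apply: (L2_le mf _ hF) => x; rewrite [leRHS]ger0_norm.
apply: good_approx => // delta delta0.
have mE n : measurable_fun setT (fun x => ((f_ n x - f x) ^+ 2)%:E).
  apply/measurable_EFinP; apply: measurable_funX; apply: measurable_funB => //.
  by case: (Hf n) => [] [].
have c0 : {ae mu, forall x, setT x -> ((f_ n x - f x) ^+ 2)%:E @[n --> \oo] --> 0%E}.
  apply: aeW => x _; apply: cvg_EFin; first exact: nearW.
  have : (f_ n x - f x) ^+ 2 @[n --> \oo] --> (f x - f x) ^+ 2.
    rewrite expr2; under eq_fun do rewrite expr2.
    by apply: cvgM; apply: cvgB => //; exact: cvg_cst.
  by rewrite subrr expr0n.
have b0 : {ae mu, forall x n, setT x -> (`|((f_ n x - f x) ^+ 2)%:E| <= (4 * F x ^+ 2)%:E)%E}.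
  apply: aeW => x n _ /=; rewrite lee_fin ger0_norm ?sqr_ge0 //.
  have := fF n x; have := fF' x; rewrite !ler_norml => /andP[h1 h2] /andP[h3 h4].
  by rewrite !expr2; nra.
have [_ _] := dominated_convergence measurableT mE (measurable_cst _) c0 (igZ 4 hF.2) b0.
rewrite integral0 => H.
have {}H : \int[mu]_x ((f_ n x - f x) ^+ 2) @[n --> \oo] --> 0.
  exact: (fine_cvg H).
have /cvgrPdist_lt /(_ _ delta0) [N _ HN] := H.
exists (f_ N) => //; apply: ltW.
have := HN N (leqnn N); rewrite /= sub0r normrN ger0_norm; last by apply: I_ge0 => x; exact: sqr_ge0.
by rewrite (@I_ext _ _ _ _ _ (fun x => (f x - f_ N x) ^+ 2)) // => x; rewrite -sqrrN opprB.
Qed.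

Lemma continuous_sqr (T : topologicalType) (f : T -> R) :
  continuous f -> continuous (fun t => f t ^+ 2).
Proof. by move=> cf t; exact: cvgM (cf t) (cf t). Qed.

Lemma good_smooth r f : smooth f -> bsupp r f -> good f.
Proof.
move=> sf bf; have cf := smooth_continuous sf.
have mf := continuous_measurable_rV cf.
have [M M0 HM] := bsupp_bounded cf bf.
have hf : L2f mu f.
  split => //; apply: (@ig_cc _ _ r); last by move=> x /bf ->; rewrite expr0n.
  exact: continuous_sqr.
split => // delta delta0.
have [L L0 HL] := smooth_lipschitz sf bf.
pose K := \int[mu]_x (\1_(cube (r + 1)) x : R).
have K0 : 0 <= K by apply: I_ge0 => x; rewrite indicE.
exists (Num.min 1 (Num.sqrt (delta / (L ^+ 2 * (K + 1))))).
  rewrite lt_min ltr01 sqrtr_gt0 divr_gt0 // mulr_gt0 ?exprn_gt0 // ltr_wpDl //.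
move=> z; rewrite le_min => /andP[z1 zd].
have zd2 : `|z| ^+ 2 <= delta / (L ^+ 2 * (K + 1)).
  rewrite -[leRHS]sqr_sqrtr; last by rewrite divr_ge0 ?mulr_ge0 ?sqr_ge0 ?addr_ge0 // ltW.
  by rewrite lerXn2r ?nnegrE // sqrtr_ge0.
apply: (@le_trans _ _ (\int[mu]_x ((L * `|z|) ^+ 2 * \1_(cube (r + 1)) x))).
  apply: I_le => [||x]; first exact: (L2B (L2_translate z hf) hf).2.
    by apply: igZ; exact: ig_indic_cube.
  rewrite indicE; have [xr|xr] := leP `|x| (r + 1).
    rewrite mem_set // mulr1 -[leLHS]real_normK ?num_real // lerXn2r ?nnegrE //.
    by rewrite mulr_ge0 // ltW.
  rewrite memNset /= ?mulr0; last by move=> H; rewrite ltNge H in xr.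
  rewrite (bf x) ?(bf (x + z)) ?subr0 ?expr0n //; last by apply: le_lt_trans xr; rewrite lerDl.
  rewrite -(ltrD2r 1); apply: (lt_le_trans xr).
  have -> : x = x + z - z by rewrite addrK.
  by apply: (le_trans (ler_normB _ _)); rewrite addrK lerD2l.
rewrite IZ; last exact: ig_indic_cube.
rewrite -/K exprMn; move: zd2; rewrite ler_pdivlMr; last by rewrite mulr_gt0 ?exprn_gt0 // ltr_wpDl.
apply: le_trans; rewrite [leRHS]mulrCA [leRHS]mulrA ler_wpM2l ?lerDl //.
by rewrite mulr_ge0 // sqr_ge0.
Qed.

(** For [t > 0] the value [flat 0 (n t) = exp (- 1 / (n t))] increases to 1, while it is 0 for
    [t <= 0]. A product of such factors, two per coordinate, converges to the indicator of the box
    from below. *)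
Lemma good_indic_obox (a b : 'I_d -> R) : good (\1_(obox a b) : 'rV[R]_d -> R).
Proof.
pose f_ n (x : 'rV[R]_d) := \prod_(i < d) (flat 0 (n.+1%:R * (x 0 i - a i)) * flat 0 (n.+1%:R * (b i - x 0 i))).
have flat_le1 (t : R) : flat 0 t <= 1.
  by rewrite /flat; case: ifP => // t0; rewrite expr0 mulr1 -expR0 ler_expR oppr_le0 invr_ge0 ltW.
have f0 n x : 0 <= f_ n x by apply: prodr_ge0 => i _; rewrite mulr_ge0 ?flat_ge0.
have fout n x : ~ obox a b x -> f_ n x = 0.
  move=> /existsNP[i /negP]; rewrite negb_and -!leNgt => H.
  rewrite /f_ (bigD1 i) //= (_ : flat 0 _ * flat 0 _ = 0) ?mul0r //.
  case/orP: H => H.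
    by rewrite {1}/flat ltNge pmulr_rle0 // subr_le0 H mul0r.
  have -> : flat 0 (n.+1%:R * (b i - x 0 i)) = 0.
    by rewrite /flat ltNge pmulr_rle0 // subr_le0 H.
  by rewrite mulr0.
have [r Hr] : exists r : R, obox a b `<=` cube r.
  exists (\sum_i (`|a i| + `|b i|)) => x H; apply/norm_rV_leP => [|i].
    by apply: sumr_ge0 => i _; rewrite addr_ge0.
  have /andP[h1 h2] := H i; rewrite (bigD1 i) //=.
  have s0 : 0 <= \sum_(j | j != i) (`|a j| + `|b j|) by apply: sumr_ge0 => j _; rewrite addr_ge0.
  rewrite ler_norml.
  by move: s0 h1 h2 (ler_norm (b i)) (ler_norm (- a i)) (normr_ge0 (a i)) (normr_ge0 (b i));
     rewrite normrN => *; apply/andP; split; lra.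
have bf n : bsupp r (f_ n).
  by move=> x rx; apply: fout => /Hr /= xr; rewrite ltNge xr in rx.
have sf n : smooth (f_ n).
  apply: smooth_prod => i; apply: smoothM; apply: smooth_flat; apply: smoothZ; apply: smoothB;
    by [exact: smooth_cst|exact: smooth_coord].
have Le n x : `|f_ n x| <= \1_(obox a b) x.
  rewrite ger0_norm // indicE; have [xb|xb] := pselect (obox a b x).
    rewrite mem_set //=; apply: prodr_ile1 => i _.
    by rewrite mulr_ge0 ?flat_ge0 //= mulr_ile1 ?flat_ge0.
  by rewrite fout // ler0n.
have L2b : L2f mu (\1_(obox a b) : 'rV[R]_d -> R).
  have m1 : measurable_fun setT (\1_(obox a b) : 'rV[R]_d -> R).
    by apply: measurable_indic; exact: measurable_obox.
  apply: (L2_le m1 _ (L2_indic_cube r)) => x; rewrite !indicE !ger0_norm ?ler0n //.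
  by have [/set_mem xb|] := boolP (x \in obox a b); rewrite ?ler0n // mem_set //; exact: Hr.
apply: (good_lim (fun n => good_smooth (sf n) (bf n)) _ L2b Le); last first.
  by apply: measurable_indic; exact: measurable_obox.
move=> x; have [xb|xb] := pselect (obox a b x); last first.
  by rewrite indicE memNset //=; under eq_fun do rewrite fout //; exact: cvg_cst.
rewrite indicE mem_set //=.
have lim1 (t : R) : 0 < t -> flat 0 (n.+1%:R * t) @[n --> \oo] --> (1 : R).
  move=> t0; have E n : flat 0 (n.+1%:R * t) = expR (- (n.+1%:R^-1 * t^-1)).
    by rewrite /flat mulr_gt0 // expr0 mulr1 invfM.
  under eq_fun do rewrite E.
  have H0 : - (n.+1%:R^-1 * t^-1) @[n --> \oo] --> (0 : R).
    rewrite -oppr0; apply: cvgN; rewrite -(mul0r t^-1); apply: cvgM; last exact: cvg_cst.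
    exact: cvg_harmonic.
  rewrite -[X in nbhs X]expR0.
  exact: (cvg_comp _ _ H0 (@continuous_expR R 0)).
rewrite /f_; elim: (index_enum _) => [|i l IH].
  by under eq_fun do rewrite big_nil; exact: cvg_cst.
under eq_fun do rewrite big_cons.
have /andP[h1 h2] := xb i.
have la : flat 0 (n.+1%:R * (x 0 i - a i)) @[n --> \oo] --> (1 : R).
  by apply: lim1; rewrite subr_gt0.
have lb : flat 0 (n.+1%:R * (b i - x 0 i)) @[n --> \oo] --> (1 : R).
  by apply: lim1; rewrite subr_gt0.
by have := cvgM (cvgM la lb) IH; rewrite !mulr1; apply; exact: eventually_filter.
Qed.

Let Q (N : nat) : set 'rV[R]_d := obox (fun=> - N%:R) (fun=> N%:R).

(** Dynkin induction starting from open boxes. The factor [\1_(Q N)] keeps complements square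
    integrable; [Q N] is itself an open box, so intersecting with it does not leave the
    pi-system. *)
Lemma good_indic_local (S : set 'rV[R]_d) N : measurable S ->
  good (fun x => \1_S x * \1_(Q N) x).
Proof.
move=> mS; rewrite measurable_oboxes in mS; move: S mS.
have mQ : measurable (Q N) by exact: measurable_obox.
have gQ : good (\1_(Q N) : 'rV[R]_d -> R) by exact: good_indic_obox.
apply: (dynkin_induction measurable_oboxes setI_closed_oboxes).
- rewrite (_ : (fun x => _) = \1_(Q N)) //; apply/funext => x.
  by rewrite indicT /= mul1r.
- move=> S [a [b ->]]; rewrite (_ : (fun x => _) = \1_(obox a b `&` Q N)).
    have [a' [b' ->]] := @setI_closed_oboxes (obox a b) (Q N)
      (ex_intro _ a (ex_intro _ b erefl)) (ex_intro _ _ (ex_intro _ _ erefl)).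
    exact: good_indic_obox.
  by apply/funext => x; rewrite indicI.
- move=> S mS gS; have := goodD gQ (goodZ (-1) gS).
  congr good; apply/funext => x; rewrite !indicE in_setC.
  by case: (x \in S); rewrite /= ?(mul1r, mul0r, mulr0, addr0, mulN1r, subrr, subr0).
- move=> F mF tF gF.
  have sumF0 x n : ~ (exists k0, F k0 x) -> \sum_(k < n) (\1_(F k) x : R) = 0.
    move=> nF; rewrite big1 // => k _; rewrite indicE memNset // => Fk; apply: nF.
    by exists k.
  have sumF x n k0 : F k0 x -> \sum_(k < n) (\1_(F k) x : R) = (k0 < n)%N%:R.
    move=> Fk0; elim: n => [|n IH]; first by rewrite big_ord0.
    rewrite big_ord_recr /= IH indicE [in RHS]ltnS [in RHS]leq_eqVlt.
    have [<-|nk] := eqVneq k0 n; first by rewrite mem_set // ltnn add0r.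
    rewrite memNset ?addr0 // => Fn; move/eqP: nk; apply.
    exact: (tF k0 n I I (ex_intro _ x (conj Fk0 Fn))).
  apply: (good_lim (f_ := fun n x => \sum_(k < n) (\1_(F k) x * \1_(Q N) x)) _ _ gQ.1) => [n|x|n x|].
  + exact: good_sum.
  + apply: (@cvg_trans _ ((\sum_(k < n) \1_(F k) x) * \1_(Q N) x @[n --> \oo])).
      by under eq_fun do rewrite -mulr_suml.
    apply: cvgM; last exact: cvg_cst.
    have [[k0 Fk0]|nF] := pselect (exists k0, F k0 x).
      under eq_fun do rewrite (sumF _ _ k0) //.
      rewrite indicE mem_set; last by exists k0.
      apply: cvg_near_cst; exists k0.+1 => //= n /= kn.
      by rewrite kn.
    under eq_fun do rewrite sumF0 //.
    rewrite indicE memNset; first exact: cvg_cst.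
    by move=> [k _ Fk]; apply: nF; exists k.
  + rewrite -mulr_suml normrM ger0_norm; last by apply: sumr_ge0 => k _; rewrite indicE.
    rewrite [`|\1_(Q N) x|]ger0_norm ?indicE // ler_piMl //.
    have [[k0 Fk0]|nF] := pselect (exists k0, F k0 x).
      by rewrite (sumF _ _ k0) // lern1 leq_b1.
    by rewrite sumF0.
  + apply: measurable_funM; apply: measurable_indic => //.
    exact: bigcupT_measurable.
Qed.

Import HBNNSimple.

(** The approximating simple functions are cut off to [Q n], which makes each of them a finite
    combination of indicators of bounded sets, all dominated by [f]. *)
Lemma good_ge0 f : L2f mu f -> (forall x, 0 <= f x) -> good f.
Proof.
move=> hf f0; have mf : measurable_fun setT (EFin \o f) by apply/measurable_EFinP; exact: hf.1.
pose g n := nnsfun_approx measurableT mf n.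
have gf n x : g n x <= f x.
  rewrite -lee_fin /g nnsfun_approxE; apply: (le_approx (f := EFin \o f)) => //.
  by move=> y _; rewrite /= lee_fin.
have Q1 n x : 0 <= (\1_(Q n) x : R) <= 1.
  by rewrite indicE ler0n lern1 leq_b1.
apply: (good_lim (f_ := fun n x => g n x * \1_(Q n) x) _ _ hf) => [n|x|n x|]; last exact: hf.1.
- rewrite (_ : (fun x => _) = (fun x => \sum_(i < size (finmap.enum_fset (fset_set (g n @` setT))))
     (finmap.enum_fset (fset_set (g n @` setT)))`_i * (\1_(g n @^-1` [set (finmap.enum_fset (fset_set (g n @` setT)))`_i]) x * \1_(Q n) x))).
    apply: good_sum => i; apply: goodZ; apply: good_indic_local.
    by rewrite -[X in measurable X]setTI; exact: (@measurable_funPT _ _ _ _ (g n)) measurableT _ (measurable_set1 _).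
  apply/funext => x; rewrite fimfunEord mulr_suml; apply: eq_bigr => i _.
  by rewrite mulrA.
- have h1 : g n x @[n --> \oo] --> f x.
    have fE0 (y : 'rV[R]_d) : setT y -> (0 <= (EFin \o f) y)%E by move=> _; rewrite lee_fin.
    exact: (fine_cvg (@cvg_nnsfun_approx _ _ _ _ measurableT _ mf fE0 x I)).
  have h2 : (\1_(Q n) x : R) @[n --> \oo] --> (1 : R).
    apply: cvg_near_cst; exists (Num.truncn `|x|).+1 => //= n /= xn.
    rewrite indicE mem_set // => i; rewrite -ltr_norml.
    apply: le_lt_trans (ler_coord x i) _; apply: (lt_le_trans (truncnS_gt _)).
    by rewrite ler_nat.
  by have := cvgM h1 h2; rewrite mulr1; apply; exact: eventually_filter.
- have /andP[q0 q1] := Q1 n x; rewrite ger0_norm ?mulr_ge0 ?fun_ge0 //.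
  by apply: le_trans (gf n x); rewrite ler_piMr // fun_ge0.
Qed.

Lemma L2_good f : L2f mu f -> good f.
Proof.
move=> hf.
have P g : L2f mu g -> good (fun x => Num.max (g x) 0).
  move=> hg; apply: good_ge0 => [|x]; last by rewrite le_max lexx orbT.
  apply: (L2_le _ _ hg) => [|x].
    by apply: measurable_maxr => //; exact: hg.1.
  by rewrite ger0_norm ?le_max ?lexx ?orbT // ge_max ler_norm normr_ge0.
have := goodD (P _ hf) (goodZ (-1) (P _ (L2Z (-1) hf))).
congr good; apply/funext => x; rewrite !mulN1r.
by have [h|h] := leP (f x) 0; [rewrite max_l ?oppr_ge0 // add0r opprK|rewrite max_r ?oppr_le0 1?ltW // subr0].
Qed.

(** Jensen's inequality for the density [eta] bounds the squared error at a point [x] of the cube by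
    the [eta]-average over [z] of [(f1 (z + x) - f1 x)^2]. Exchanging the integrals leaves an
    average of squared translation errors, each at most [delta]. *)
Lemma moll_cvg f (r0 delta : R) : L2loc f -> 0 < delta -> exists rho, 0 < rho /\
  forall rho' eta, rho' <= rho -> smooth eta -> bsupp rho' eta -> (forall x, 0 <= eta x) ->
    \int[mu]_x eta x = 1 ->
    ig mu (fun x => \1_(cube r0) x * (moll eta f x - f x) ^+ 2) /\
    \int[mu]_x (\1_(cube r0) x * (moll eta f x - f x) ^+ 2) <= delta.
Proof.
move=> hf delta0.
(* Only a truncation of [f] is globally square integrable. Kernels of radius at most 1 do not see
   the difference from inside [cube r0]. *)
pose f1 x := \1_(cube (r0 + 1)) x * f x.
have hf1 : L2f mu f1 := L2loc_indic (r0 + 1) hf.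
have [rho rho0 Hrho] := (L2_good hf1).2 delta delta0.
exists (Num.min 1 rho); split; first by rewrite lt_min ltr01.
move=> rho' eta; rewrite le_min => /andP[le1 lerho] se be e0 e1.
have ce := smooth_continuous se; have me := continuous_measurable_rV ce.
have ie : ig mu eta by exact: ig_cc be.
have [M M0 HM] := bsupp_bounded ce be.
have mf := hf1.1.
have m1 := @measurable_indic_cube R d r0.
have mm : measurable_fun setT (moll eta f).
  by apply: continuous_measurable_rV; apply: continuous_moll se be hf.
pose H x z := eta z * (f1 (z + x) - f1 x) ^+ 2.
have H0 x z : 0 <= H x z by rewrite /H mulr_ge0 // sqr_ge0.
have HE0 (p : 'rV[R]_d * 'rV[R]_d) : (0 <= (H p.1 p.2)%:E)%E by rewrite lee_fin.
have mH : measurable_fun setT (fun p : 'rV[R]_d * 'rV[R]_d => (H p.1 p.2)%:E).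
  apply/measurable_EFinP; apply: measurable_funM; first exact: measurableT_comp me measurable_snd.
  apply: measurable_funX; apply: measurable_funB; last exact: measurableT_comp mf measurable_fst.
  apply: (measurableT_comp mf); apply: measurable_fun_rVP => i; under eq_fun do rewrite mxE.
  by apply: measurable_funD;
    [exact: measurableT_comp (measurable_coord i) measurable_snd|exact: measurableT_comp (measurable_coord i) measurable_fst].
have pw x : ((\1_(cube r0) x * (moll eta f x - f x) ^+ 2)%:E <= \int[mu]_z (H x z)%:E)%E.
  rewrite indicE; have [xr|xr] := boolP (x \in cube r0); last first.
    by rewrite mul0r; apply: integral_ge0 => z _; rewrite lee_fin.
  rewrite mul1r; have {}xr : `|x| <= r0 by exact: set_mem xr.
  have hs : L2f mu (fun z => f1 (z + x)) := L2_translate x hf1.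
  have hc : L2loc (fun _ : 'rV[R]_d => - f1 x) by apply: L2loc_continuous => y; exact: cst_continuous.
  have hd : L2loc (fun z => f1 (z + x) - f1 x) := L2locD (L2_L2loc hs) hc.
  have i1 : ig mu (fun z => eta z * (f1 (z + x) - f1 x)) by exact: L2loc_bsupp_ig be HM hd.
  have i2 : ig mu (fun z => eta z * (f1 (z + x) - f1 x) ^+ 2).
    apply: (ig_le _ _ (igZ M (hd.2 rho'))) => [|z].
      by apply: measurable_funM => //; apply: measurable_funX; exact: hd.1.
    rewrite ger0_norm; last exact: (H0 x z).
    rewrite indicE; have [zr|zr] := leP `|z| rho'.
      rewrite mem_set // mul1r ler_wpM2r ?sqr_ge0 //; apply: le_trans (HM z); exact: ler_norm.
    by rewrite be // mul0r; apply: mulr_ge0; [exact: ltW|apply: mulr_ge0 => //; exact: sqr_ge0].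
  rewrite EFinI // lee_fin.
  have [i3 ->] := mollE x ce be hf.
  apply: le_trans (jensen_sqr e0 ie e1 i1 i2).
  suff -> : \int[mu]_z (eta z * f (z + x)) - f x = \int[mu]_z (eta z * (f1 (z + x) - f1 x)) by [].
  have -> : f x = \int[mu]_z (f1 x * eta z).
    rewrite IZ // e1 mulr1 /f1 indicE mem_set ?mul1r //=.
    by apply: le_trans xr _; rewrite lerDl.
  rewrite -IB //; last exact: igZ.
  apply: I_ext => z; rewrite mulrBr [f1 x * _]mulrC; congr (_ - _).
  have [zr|zr] := leP `|z| rho'; last by rewrite be // !mul0r.
  rewrite /f1 indicE mem_set ?mul1r //=.
  by rewrite addrC; apply: (le_trans (ler_normD _ _)); apply: lerD => //; exact: le_trans le1.
have mG : measurable_fun setT (fun x => \1_(cube r0) x * (moll eta f x - f x) ^+ 2).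
  by apply: measurable_funM => //; apply: measurable_funX; apply: measurable_funB => //; exact: hf.1.
apply: ig_bound => // [x|].
  by rewrite mulr_ge0 ?sqr_ge0 // indicE.
apply: (@le_trans _ _ (\int[mu]_x \int[mu]_z (H x z)%:E)%E).
  apply: ge0_le_integral => //.
  - by move=> x _; rewrite lee_fin mulr_ge0 ?sqr_ge0 // indicE.
  - exact/measurable_EFinP.
  - exact: (measurable_fun_fubini_tonelli_F _ mH HE0).
have FT : (\int[mu]_x \int[mu]_z (H x z)%:E = \int[mu]_z \int[mu]_x (H x z)%:E)%E.
  exact: (@fubini_tonelli _ _ _ _ R mu mu _ mH HE0).
rewrite FT.
apply: (@le_trans _ _ (\int[mu]_z (delta * eta z)%:E)%E).
  apply: ge0_le_integral => //.
  - by move=> z _; apply: integral_ge0 => x _; rewrite lee_fin.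
  - exact: (measurable_fun_fubini_tonelli_G _ mH HE0).
  - by apply/measurable_EFinP; apply: measurable_funM.
  move=> z _; have [zr|zr] := leP `|z| rho'; last first.
    rewrite be // mulr0 /H be //; under eq_integral do rewrite mul0r.
    by rewrite integral0.
  have hz : L2f mu (fun x => f1 (x + z) - f1 x) := L2B (L2_translate z hf1) hf1.
  rewrite /H; under eq_integral do rewrite [z + _]addrC.
  rewrite EFinI; last by apply: igZ; exact: hz.2.
  rewrite IZ; last exact: hz.2.
  by rewrite lee_fin mulrC ler_wpM2r // Hrho // (le_trans zr).
by rewrite EFinI; [rewrite IZ // e1 mulr1|exact: igZ].
Qed.

End translation_continuity.

(** * The Garding inequality *)

Section integration_by_parts.
Context {R : realType} {d : nat}.
Notation mu := (lebesgue_rV R d).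
Implicit Types (f g : 'rV[R]_d -> R) (x y z : 'rV[R]_d) (i j : 'I_d).

(** By translation invariance every difference quotient has integral 0, and it differs from the
    derivative by at most [L h] on a fixed cube outside which both vanish. *)
Lemma integral_partial r i f : smooth f -> bsupp r f -> \int[mu]_x (partial i f x) = 0.
Proof.
move=> sf bf; have cf := smooth_continuous sf.
have sf' := smooth_partial i sf; have bf' := bsupp_partial i sf bf.
have if' : ig mu (partial i f) by exact: ig_cc (smooth_continuous sf') bf'.
have i_f : ig mu f by exact: ig_cc cf bf.
have [L L0 HL] := smooth_lipschitz sf' bf'.
pose K := \int[mu]_x (\1_(cube (r + 1)) x : R).
have K0 : 0 <= K by apply: I_ge0 => x; rewrite indicE.
have main h : 0 < h -> h <= 1 -> `|\int[mu]_x (partial i f x)| <= L * h * K.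
  move=> h0 h1; set e : 'rV[R]_d := delta_mx 0 i.
  have vh : `|h *: e| <= h by rewrite (le_trans (norm_delta _ _)) // gtr0_norm.
  have ih : ig mu (fun x => f (x + h *: e)) by exact: ig_translate.
  have E : \int[mu]_x (h^-1 * (f (x + h *: e) - f x) - partial i f x) = - \int[mu]_x (partial i f x).
    rewrite IB //; last by apply: igZ; exact: igB.
    rewrite IZ; last exact: igB.
    by rewrite IB // I_translate ?subrr ?mulr0 ?sub0r //; exact: (ig_meas i_f).
  have iE : ig mu (fun x => h^-1 * (f (x + h *: e) - f x) - partial i f x).
    by apply: igB => //; apply: igZ; exact: igB.
  rewrite -normrN -E; apply: (le_trans (I_abs iE)).
  rewrite -IZ; last exact: ig_indic_cube.
  apply: I_le => [||x]; [exact: ig_abs|by apply: igZ; exact: ig_indic_cube|].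
  rewrite indicE; have [xr|xr] := leP `|x| (r + 1).
    rewrite mem_set // mulr1.
    have [c ch ->] := mean_value_line h (fun s => smooth_pd i sf (x + s *: e)).
    rewrite mulKf ?gt_eqF //; apply: (le_trans (HL _ _)).
    rewrite ler_wpM2l ?(ltW L0) //; apply: le_trans (norm_delta _ _) _.
    by rewrite (le_trans ch) // gtr0_norm.
  have xr' : r < `|x| by apply: le_lt_trans xr; rewrite lerDl.
  rewrite (bf' x) // (bf x) // (bf (x + h *: e)) ?subr0 ?mulr0 ?normr0 ?memNset ?mulr0 //.
    by move=> /= H; rewrite ltNge H in xr.
  rewrite -(ltrD2r 1); apply: (lt_le_trans xr).
  have {1}-> : x = x + h *: e - h *: e by rewrite addrK.
  by apply: (le_trans (ler_normB _ _)); rewrite lerD2l (le_trans vh).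
apply/eqP; rewrite -normr_le0; apply/ler_addgt0Pr => eps eps0; rewrite add0r.
pose h := Num.min 1 (eps / (L * (K + 1)) / 2).
have q0 : 0 < eps / (L * (K + 1)) by rewrite divr_gt0 // mulr_gt0 // ltr_wpDl.
have h0 : 0 < h by rewrite lt_min ltr01 divr_gt0.
apply: le_trans (main h h0 _) _; first by rewrite ge_min lexx.
apply: mulr_le_of_lt_div => //; first exact: ltW.
by rewrite gt_min; apply/orP; right; rewrite ltr_pdivrMr // ltr_pMr // ltr1n.
Qed.

End integration_by_parts.

(** Summation turns the products [y i * y j] into a square and each of the two [w] terms into
    [(sum w) |b|^2]. The terms in [H] cost at most [2 (sum |H i j|) |b|^2], because
    [|b_i b_j| <= |b|^2]. *)
Lemma garding_sum {R : realFieldType} {d : nat} (D H : 'I_d -> 'I_d -> R) (y w b : 'I_d -> R) :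
  2 * ((\sum_i w i - \sum_i \sum_j `|H i j|) * \sum_j b j ^+ 2) <=
  \sum_i \sum_j (D i j ^+ 2 + D j i ^+ 2 + 2 * (y i * y j) + w i * b j ^+ 2 + w j * b i ^+ 2
    - (H i j + H j i) * (b i * b j)).
Proof.
set B := \sum_j b j ^+ 2.
have B2 i : b i ^+ 2 <= B by rewrite /B (bigD1 i) //= lerDl sumr_ge0 // => j _; exact: sqr_ge0.
have BB i j : `|b i * b j| <= B.
  rewrite ler_norml; have := B2 i; have := B2 j.
  have := sqr_ge0 (b i - b j); have := sqr_ge0 (b i + b j).
  by rewrite !expr2; move: (b i) (b j) => p q ? ? ? ?; apply/andP; split; nra.
have S1 : \sum_i \sum_j (w i * b j ^+ 2) = (\sum_i w i) * B.
  by rewrite mulr_suml; apply: eq_bigr => i _; rewrite mulr_sumr.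
have S2 : \sum_i \sum_j (w j * b i ^+ 2) = (\sum_i w i) * B by rewrite exchange_big.
have S3 : \sum_i \sum_j (2 * (y i * y j)) = 2 * (\sum_i y i) ^+ 2.
  rewrite expr2 mulr_suml mulr_sumr; apply: eq_bigr => i _.
  by rewrite mulr_sumr mulr_sumr.
have S4 : \sum_i \sum_j (`|H i j| + `|H j i|) * B = 2 * ((\sum_i \sum_j `|H i j|) * B).
  have E : \sum_i \sum_j `|H j i| = \sum_i \sum_j `|H i j| by rewrite exchange_big.
  transitivity ((\sum_i \sum_j `|H i j|) * B + (\sum_i \sum_j `|H j i|) * B); last by rewrite E; ring.
  rewrite -mulrDl -big_split mulr_suml; apply: eq_bigr => i _ /=.
  by rewrite -big_split mulr_suml.
apply: (@le_trans _ _ (\sum_i \sum_j (2 * (y i * y j) + w i * b j ^+ 2 + w j * b i ^+ 2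
    - (`|H i j| + `|H j i|) * B))).
  have -> : \sum_i \sum_j (2 * (y i * y j) + w i * b j ^+ 2 + w j * b i ^+ 2
    - (`|H i j| + `|H j i|) * B) = \sum_i \sum_j (2 * (y i * y j)) +
     \sum_i \sum_j (w i * b j ^+ 2) + \sum_i \sum_j (w j * b i ^+ 2) - \sum_i \sum_j ((`|H i j| + `|H j i|) * B).
    rewrite -!big_split -sumrB; apply: eq_bigr => i _ /=.
    by rewrite -!big_split -sumrB.
  rewrite S1 S2 S3 S4.
  have := sqr_ge0 (\sum_i y i).
  by move: ((\sum_i y i) ^+ 2) (\sum_i w i) (\sum_i \sum_j `|H i j|) => p q s; lra.
apply: ler_sum => i _; apply: ler_sum => j _.
have h1 := sqr_ge0 (D i j); have h2 := sqr_ge0 (D j i).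
have h3 : (H i j + H j i) * (b i * b j) <= (`|H i j| + `|H j i|) * B.
  by apply: (le_trans (ler_norm _)); rewrite normrM ler_pM // ler_normD.
by move: h1 h2 h3; move: (D i j ^+ 2) (D j i ^+ 2) => p q; lra.
Qed.

Section garding.
Context {R : realType} {d : nat}.
Notation mu := (lebesgue_rV R d).
Implicit Types (f g : 'rV[R]_d -> R) (x y z : 'rV[R]_d) (i j : 'I_d).
Variables (V : 'rV[R]_d -> R) (smoothV : smooth V).

Definition confinement x := 4^-1 * grad_sqr V x - 2^-1 * laplacian V x
  - \sum_(i < d) \sum_(j < d) `|partial i (partial j V) x|.

Lemma continuous_sum (T : topologicalType) (J : Type) (s : seq J) (h : J -> T -> R) :
  (forall k, continuous (h k)) -> continuous (fun t => \sum_(k <- s) h k t).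
Proof.
move=> H; elim: s => [|a s IH].
  rewrite (_ : (fun t => _) = (fun=> 0)); first exact: cst_continuous.
  by apply/funext => t; rewrite big_nil.
rewrite (_ : (fun t => _) = (fun t => h a t + \sum_(k <- s) h k t)).
  by move=> t; exact: (continuousD (H a t) (IH t)).
by apply/funext => t; rewrite big_cons.
Qed.

Lemma continuous_confinement : continuous confinement.
Proof.
have c1 : continuous (grad_sqr V).
  apply: continuous_sum => i; apply: continuous_sqr.
  exact (smooth_continuous (smooth_partial i smoothV)).
have c2 : continuous (laplacian V).
  by apply: continuous_sum => i; exact (smooth_continuous (smooth_partial i (smooth_partial i smoothV))).
have c3 : continuous (fun x => \sum_(i < d) \sum_(j < d) `|partial i (partial j V) x|).
  apply: continuous_sum => i; apply: continuous_sum => j x.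
  apply: (continuous_comp (smooth_continuous (smooth_partial i (smooth_partial j smoothV)) (x := x))).
  exact: norm_continuous.
move=> x; apply: (@continuousB _ _ _ (fun x => 4^-1 * grad_sqr V x - 2^-1 * laplacian V x)); last exact: c3.
by apply: (@continuousB _ _ _ (fun x => 4^-1 * grad_sqr V x));
  apply: continuousM; [exact: cst_continuous|exact: c1|exact: cst_continuous|exact: c2].
Qed.

(** Here [Dij] stands for [d_i b_j], [vi] for [d_i V], [Bi] for [b_i] and [Hij] for [d_i d_j V]. The
    variable [M] is the mixed derivative [d_i d_j b_i], which occurs in both divergences with
    opposite signs. *)
Lemma garding_identity (Dij Dji Dii Djj vi vj Bi Bj Hii Hjj Hij Hji M : R) :
  (Dij + 2^-1 * vi * Bj + (Dji + 2^-1 * vj * Bi)) ^+ 2 =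
  (Dij ^+ 2 + Dji ^+ 2 + 2 * ((- Dii + 2^-1 * vi * Bi) * (- Djj + 2^-1 * vj * Bj))
   + (4^-1 * vi ^+ 2 - 2^-1 * Hii) * Bj ^+ 2 + (4^-1 * vj ^+ 2 - 2^-1 * Hjj) * Bi ^+ 2
   - (Hij + Hji) * (Bi * Bj))
  + ((Hii * (2^-1 * (Bj * Bj)) + vi * (2^-1 * (Dij * Bj + Bj * Dij))
      + 2 * (Dij * Dji + Bj * M)
      + (Hij * (Bi * Bj) + vj * (Dii * Bj + Bi * Dij)))
   + (Hjj * (2^-1 * (Bi * Bi)) + vj * (2^-1 * (Dji * Bi + Bi * Dji))
      - 2 * (Djj * Dii + Bj * M)
      + (Hji * (Bi * Bj) + vi * (Dji * Bj + Bi * Djj)))).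
Proof. by field. Qed.

Variables (b : 'I_d -> 'rV[R]_d -> R) (r : R).
Hypotheses (sb : forall j, smooth (b j)) (bb : forall j, bsupp r (b j)).

Definition sym_term i j x := partial i (b j) x + 2^-1 * partial i V x * b j x
  + (partial j (b i) x + 2^-1 * partial j V x * b i x).

(** The formal adjoint of [X_i] applied to [b i]; the sum over [i] is the divergence whose square is
    discarded. *)
Let y i x := - partial i (b i) x + 2^-1 * partial i V x * b i x.

(* [sym_term i j ^ 2] equals [rest i j] up to a divergence. The squares in [rest] are
   discarded and its terms [y i * y j] sum to [(sum_i y i) ^ 2 >= 0]. *)
Let rest i j x := partial i (b j) x ^+ 2 + partial j (b i) x ^+ 2 + 2 * (y i x * y j x)
   + (4^-1 * partial i V x ^+ 2 - 2^-1 * partial i (partial i V) x) * b j x ^+ 2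
   + (4^-1 * partial j V x ^+ 2 - 2^-1 * partial j (partial j V) x) * b i x ^+ 2
   - (partial i (partial j V) x + partial j (partial i V) x) * (b i x * b j x).

(** Fluxes: [F i j] is differentiated in direction [i], [K i j] in direction [j]. Their middle terms
    exchange [2 d_i b_j d_j b_i] for [2 d_i b_i d_j b_j]; the others move derivatives from [b] to
    the gradient of [V]. *)
Let F i j x := partial i V x * (2^-1 * (b j x * b j x)) + 2 * (b j x * partial j (b i) x)
  + partial j V x * (b i x * b j x).

Let K i j x := partial j V x * (2^-1 * (b i x * b i x)) - 2 * (b j x * partial i (b i) x)
  + partial i V x * (b i x * b j x).

Let pb i j : pd i (b j) (partial i (b j)). Proof. exact (smooth_pd i (sb j)). Qed.
Let pV i j : pd i (partial j V) (partial i (partial j V)).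
Proof. exact (smooth_pd i (smooth_partial j smoothV)). Qed.
Let pbb i j k : pd i (partial j (b k)) (partial i (partial j (b k))).
Proof. exact (smooth_pd i (smooth_partial j (sb k))). Qed.

Let sym_termE i j x : sym_term i j x ^+ 2 = rest i j x + (partial i (F i j) x + partial j (K i j) x).
Proof.
have -> : partial i (F i j) = fun x =>
  (partial i (partial i V) x * (2^-1 * (b j x * b j x)) + partial i V x *
     (2^-1 * (partial i (b j) x * b j x + b j x * partial i (b j) x))
      + 2 * (partial i (b j) x * partial j (b i) x + b j x * partial i (partial j (b i)) x)
      + (partial i (partial j V) x * (b i x * b j x) + partial j V x *
     (partial i (b i) x * b j x + b i x * partial i (b j) x))).
  apply: pd_partial; apply: pdD; last by apply: pdM => //; exact: pdM.
  by apply: pdD; [apply: pdM => //; apply: pdZ; exact: pdM|apply: pdZ; exact: pdM].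
have -> : partial j (K i j) = fun x =>
  (partial j (partial j V) x * (2^-1 * (b i x * b i x)) + partial j V x *
     (2^-1 * (partial j (b i) x * b i x + b i x * partial j (b i) x))
      - 2 * (partial j (b j) x * partial i (b i) x + b j x * partial j (partial i (b i)) x)
      + (partial j (partial i V) x * (b i x * b j x) + partial i V x *
     (partial j (b i) x * b j x + b i x * partial j (b j) x))).
  apply: pd_partial; apply: pdD; last by apply: pdM => //; exact: pdM.
  by apply: pdD; [apply: pdM => //; apply: pdZ; exact: pdM|apply: pdN; apply: pdZ; exact: pdM].
rewrite (partialC j i (sb i)); exact: garding_identity.
Qed.

Let sV i : smooth (partial i V). Proof. exact (smooth_partial i smoothV). Qed.
Let sdb i j : smooth (partial i (b j)). Proof. exact (smooth_partial i (sb j)). Qed.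
Let bdb i j : bsupp r (partial i (b j)). Proof. exact (bsupp_partial i (sb j) (bb j)). Qed.

Let sF i j : smooth (F i j).
Proof.
exact (smoothD (smoothD (smoothM (sV i) (smoothZ 2^-1 (smoothM (sb j) (sb j))))
  (smoothZ 2 (smoothM (sb j) (sdb j i)))) (smoothM (sV j) (smoothM (sb i) (sb j)))).
Qed.

Let bF i j : bsupp r (F i j).
Proof. by move=> x rx; rewrite /F !(bb _ rx) !(mul0r, mulr0, addr0). Qed.

Let sK i j : smooth (K i j).
Proof.
exact (smoothD (smoothB (smoothM (sV j) (smoothZ 2^-1 (smoothM (sb i) (sb i))))
  (smoothZ 2 (smoothM (sb j) (sdb i i)))) (smoothM (sV i) (smoothM (sb i) (sb j)))).
Qed.

Let bK i j : bsupp r (K i j).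
Proof. by move=> x rx; rewrite /K !(bb _ rx) !(mul0r, mulr0, addr0, subr0). Qed.

Lemma ig_sym_term i j : ig mu (fun x => sym_term i j x ^+ 2).
Proof.
apply: (@ig_cc _ _ r).
  apply: continuous_sqr; apply: smooth_continuous.
  exact (smoothD (smoothD (sdb i j) (smoothM (smoothZ 2^-1 (sV i)) (sb j)))
    (smoothD (sdb j i) (smoothM (smoothZ 2^-1 (sV j)) (sb i)))).
by move=> x rx; rewrite /sym_term !(bb _ rx) !(bdb _ _ rx) !(mulr0, addr0) expr0n.
Qed.

Let ig_F i j : ig mu (partial i (F i j)).
Proof. exact (ig_cc (smooth_continuous (smooth_partial i (sF i j))) (bsupp_partial i (sF i j) (@bF i j))). Qed.

Let ig_K i j : ig mu (partial j (K i j)).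
Proof. exact (ig_cc (smooth_continuous (smooth_partial j (sK i j))) (bsupp_partial j (sK i j) (@bK i j))). Qed.

Let restE i j x : rest i j x = sym_term i j x ^+ 2 - (partial i (F i j) x + partial j (K i j) x).
Proof. by rewrite sym_termE addrK. Qed.

Let ig_rest i j : ig mu (rest i j).
Proof.
rewrite (_ : rest i j = fun x => sym_term i j x ^+ 2 - (partial i (F i j) x + partial j (K i j) x)).
  exact (igB (@ig_sym_term i j) (igD (@ig_F i j) (@ig_K i j))).
by apply/funext => x; exact: restE.
Qed.

Let I_rest i j : \int[mu]_x (sym_term i j x ^+ 2) = \int[mu]_x rest i j x.
Proof.
rewrite (@I_ext _ _ _ _ _ (fun x => rest i j x + (partial i (F i j) x + partial j (K i j) x))).
  rewrite (ID (@ig_rest i j) (igD (@ig_F i j) (@ig_K i j))) (ID (@ig_F i j) (@ig_K i j)).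
  transitivity (\int[mu]_x rest i j x + (0 + 0)); last by rewrite !addr0.
  exact (congr1 (fun t => \int[mu]_x rest i j x + t)
    (congr2 +%R (integral_partial i (sF i j) (@bF i j)) (integral_partial j (sK i j) (@bK i j)))).
exact: sym_termE.
Qed.

Lemma sum_rest_ge x : 2 * (confinement x * \sum_j b j x ^+ 2) <= \sum_i \sum_j rest i j x.
Proof.
have -> : confinement x = \sum_i (4^-1 * partial i V x ^+ 2 - 2^-1 * partial i (partial i V) x)
    - \sum_i \sum_j `|partial i (partial j V) x|.
  by rewrite /confinement /grad_sqr /laplacian !mulr_sumr -sumrB.
exact (garding_sum (fun i j => partial i (b j) x) (fun i j => partial i (partial j V) x)
  (fun i => y i x) (fun i => 4^-1 * partial i V x ^+ 2 - 2^-1 * partial i (partial i V) x)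
  (fun i => b i x)).
Qed.

Lemma garding_inequality :
  2 * \int[mu]_x (confinement x * \sum_j b j x ^+ 2) <=
  \sum_i \sum_j \int[mu]_x (sym_term i j x ^+ 2).
Proof.
have ic : ig mu (fun x => confinement x * \sum_j b j x ^+ 2).
  apply: (@ig_cc _ _ r).
    move=> x; apply: continuousM; first exact: continuous_confinement.
    by move: x; apply: continuous_sum => j; apply: continuous_sqr; exact: smooth_continuous.
  by move=> x rx; rewrite big1 ?mulr0 // => j _; rewrite (bb _ rx) expr0n.
rewrite -IZ //.
have -> : \sum_i \sum_j \int[mu]_x (sym_term i j x ^+ 2) = \int[mu]_x (\sum_i \sum_j rest i j x).
  rewrite I_sum; last by move=> i _; apply: ig_sum.
  by apply: eq_bigr => i _; rewrite I_sum //; apply: eq_bigr => j _; exact: I_rest.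
apply: I_le => [||x]; [exact: igZ|by apply: ig_sum => i _; exact: ig_sum|exact: sum_rest_ge].
Qed.

End garding.

(** * Korn's inequality on a cube *)

(** The fundamental theorem of calculus followed by Jensen's inequality for the uniform density on
    the unit interval. The right-hand side is an extended real integral over the whole line, ready
    for Tonelli's theorem. *)
Lemma increment_sqr_le {R : realType} (phi psi : R -> R) :
  (forall t : R, is_derive t (1 : R) phi (psi t)) -> continuous psi ->
  (((phi 1 - phi 0) ^+ 2)%:E <=
   \int[lebesgue_measure]_t (\1_(`[0%R, 1%R]%classic : set R) t * psi t ^+ 2)%:E)%E.
Proof.
move=> dphi cpsi; pose mu := @lebesgue_measure R.
pose J : set R := `[0, 1]%classic.
have mJ : measurable (J : set (measurableTypeR R)) by exact: measurable_itv.
have cphi : continuous phi.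
  by move=> s; apply/differentiable_continuous/derivable1_diffP; case: (dphi s).
have EJ (f : R -> R) : (fun t => \1_J t * f t) = f \_ J.
  apply/funext => t; rewrite /patch indicE; case: (t \in J); by rewrite ?mul1r ?mul0r.
have igJ (f : R -> R) : continuous f -> ig mu (fun t => \1_J t * f t).
  move=> cf; have h : mu.-integrable J (EFin \o f).
    apply: continuous_compact_integrable; [exact: segment_compact|exact: continuous_subspaceT].
  have h2 := (@integrable_mkcond _ _ _ mu J (EFin \o f) mJ).1 h.
  rewrite /ig EJ; apply: eq_integrable h2 => // t _; rewrite /patch /=; case: ifP => //.
have c2 := continuous_sqr cpsi.
have i0 : ig mu (fun t => \1_J t).
  have c1 : continuous (fun _ : R => (1 : R)) by move=> t; exact: cst_continuous.
  by apply: ig_ext (igJ _ c1) => t; rewrite mulr1.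
have m1 : mu J = 1%E.
  by rewrite /mu /J lebesgue_measure_itv /= lte_fin ltr01 -EFinB subr0.
have e1 : \int[mu]_t \1_J t = 1.
  transitivity (fine (mu J)); last by rewrite m1.
  by congr fine; rewrite integral_indic //= setIT.
rewrite EFinI; last exact: igJ.
rewrite lee_fin.
have -> : phi 1 - phi 0 = \int[mu]_t (\1_J t * psi t).
  have F : (\int[mu]_(t in J) (psi t)%:E = (phi 1)%:E - (phi 0)%:E)%E.
    apply: continuous_FTC2 => //; first exact: continuous_subspaceT.
      split => [t _||]; first by case: (dphi t).
        by apply: cvg_at_right_filter; exact: cphi.
      by apply: cvg_at_left_filter; exact: cphi.
    by move=> t _; rewrite derive1E; apply: (derive_val (is_derive := dphi t)).
  rewrite EJ -Rintegral_mkcond /Rintegral F.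
  by [].
have J0 t : 0 <= (\1_J t : R) by rewrite indicE.
exact: (@jensen_sqr _ _ R mu \1_J psi J0 i0 e1 (igJ _ cpsi) (igJ _ c2)).
Qed.

Lemma sqr_sum_le {R : realFieldType} n (c : 'I_n -> R) :
  (\sum_i c i) ^+ 2 <= n%:R * \sum_i c i ^+ 2.
Proof.
have : 0 <= \sum_i \sum_j (c i - c j) ^+ 2.
  by apply: sumr_ge0 => i _; apply: sumr_ge0 => j _; exact: sqr_ge0.
have -> : \sum_i \sum_j (c i - c j) ^+ 2 =
    2 * (n%:R * \sum_i c i ^+ 2) - 2 * (\sum_i c i) ^+ 2.
  have E i : \sum_j (c i - c j) ^+ 2 = n%:R * c i ^+ 2 - 2 * (c i * \sum_j c j) + \sum_j c j ^+ 2.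
    rewrite mulr_sumr mulr_sumr.
    have -> : n%:R * c i ^+ 2 = \sum_(j < n) c i ^+ 2 by rewrite sumr_const card_ord mulr_natl.
    by rewrite -sumrB -big_split; apply: eq_bigr => j _ /=; ring.
  under eq_bigr do rewrite E.
  rewrite big_split sumrB /= sumr_const card_ord -!mulr_sumr -mulr_suml -mulr_natl.
  by ring.
by lra.
Qed.

Lemma sqr_sum2_le {R : realFieldType} n (c : 'I_n -> 'I_n -> R) :
  (\sum_i \sum_j c i j) ^+ 2 <= n%:R ^+ 2 * \sum_i \sum_j c i j ^+ 2.
Proof.
apply: (le_trans (sqr_sum_le _)); rewrite expr2 -mulrA ler_wpM2l // mulr_sumr.
by apply: ler_sum => i _; exact: sqr_sum_le.
Qed.

Section korn.
Context {R : realType} {d : nat}.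
Notation mu := (lebesgue_rV R d).
Implicit Types (x y z : 'rV[R]_d) (i j k l : 'I_d).
Variables (u : 'I_d -> 'rV[R]_d -> R) (su : forall k, smooth (u k)).

Definition strain i k x := partial i (u k) x + partial k (u i) x.
Definition strain_sqr x := \sum_i \sum_k strain i k x ^+ 2.
Definition pairing x y := \sum_k (x 0 k - y 0 k) * (u k x - u k y).

Lemma continuous_partial_u i k : continuous (partial i (u k)).
Proof. exact (smooth_continuous (smooth_partial i (su k))). Qed.

Lemma continuous_strain_sqr : continuous strain_sqr.
Proof.
apply: continuous_sum => i; apply: continuous_sum => k; apply: continuous_sqr => x.
by apply: (continuousD (@continuous_partial_u i k x) (@continuous_partial_u k i x)).
Qed.

Lemma strain_sqr_ge0 x : 0 <= strain_sqr x.
Proof. by apply: sumr_ge0 => i _; apply: sumr_ge0 => k _; exact: sqr_ge0. Qed.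

(* The derivative of [u (y + t z).z] in [t] is the quadratic form of the symmetric gradient. *)
Lemma pairing_bound (zeta : R) y z : `|z| <= zeta ->
  ((pairing (y + z) y ^+ 2)%:E <= \int[lebesgue_measure]_t
    (\1_(`[0%R, 1%R]%classic : set R) t * (zeta ^+ 4 * d%:R ^+ 2 * strain_sqr (y + t *: z)))%:E)%E.
Proof.
move=> zz; have z0 : 0 <= zeta by apply: le_trans zz.
pose phi (t : R) := \sum_k z 0 k * u k (y + t *: z).
pose psi (t : R) := \sum_k z 0 k * \sum_i z 0 i * partial i (u k) (y + t *: z).
have dphi (t : R) : is_derive t (1 : R) phi (psi t).
  suff H (s : seq 'I_d) : is_derive t (1 : R) (fun t : R => \sum_(k <- s) z 0 k * u k (y + t *: z))
    (\sum_(k <- s) z 0 k * \sum_i z 0 i * partial i (u k) (y + t *: z)) by exact: H.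
  elim: s => [|k s IH].
    under eq_fun do rewrite big_nil; rewrite big_nil; exact: is_derive_cst.
  under eq_fun do rewrite big_cons; rewrite big_cons; apply: is_deriveD => //.
  apply: is_deriveZ; apply: is_derive_line.
  exact (smooth_is_derive (y + t *: z) z (su k)).
have cline (f : 'rV[R]_d -> R) : continuous f -> continuous (fun t : R => f (y + t *: z)).
  move=> cf t; apply: (@continuous_comp _ _ _ (fun t : R => y + t *: z) f); last exact: cf.
  by apply: continuousD; [exact: cst_continuous|exact: scalel_continuous].
have cpsi : continuous psi.
  have c1 k i : continuous (fun t : R => z 0 i * partial i (u k) (y + t *: z)).
    have h1 : continuous (fun _ : R => z 0 i) by move=> t; exact: cst_continuous.
    move=> t; exact: (continuousM (h1 t) (cline _ (@continuous_partial_u i k) t)).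
  have c2 k : continuous (fun t : R => \sum_i z 0 i * partial i (u k) (y + t *: z)) := continuous_sum (c1 k).
  apply: continuous_sum => k t.
  have h1 : continuous (fun _ : R => z 0 k) by move=> s; exact: cst_continuous.
  exact: (continuousM (h1 t) (c2 k t)).
have mE : measurable_fun setT (fun t : R => strain_sqr (y + t *: z)).
  by apply: continuous_measurable_fun; apply: cline; exact: continuous_strain_sqr.
have mJ : measurable_fun setT (\1_(`[0%R, 1%R]%classic : set R) : R -> R).
  by apply: measurable_indic; exact: measurable_itv.
have -> : pairing (y + z) y = phi 1 - phi 0.
  rewrite /phi -sumrB; apply: eq_bigr => k _.
  by rewrite -mulrBr scale1r scale0r addr0 mxE addrAC subrr add0r.
apply: le_trans (increment_sqr_le dphi cpsi) _; apply: ge0_le_integral => //.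
- by move=> t _; rewrite lee_fin mulr_ge0 ?sqr_ge0 // indicE.
- by apply/measurable_EFinP; apply: measurable_funM => //; apply: measurable_funX; exact: continuous_measurable_fun.
- by apply/measurable_EFinP; apply: measurable_funM => //; exact: measurable_funM.
move=> t _; rewrite lee_fin ler_wpM2l ?indicE //.
have -> : psi t = \sum_i \sum_k (2^-1 * (z 0 i * z 0 k * strain i k (y + t *: z))).
  have E : psi t = \sum_i \sum_k z 0 i * z 0 k * partial i (u k) (y + t *: z).
    rewrite exchange_big; apply: eq_bigr => k _; rewrite mulr_sumr; apply: eq_bigr => i _.
    by rewrite mulrA (mulrC (z 0 k)).
  have E' : psi t = \sum_i \sum_k z 0 i * z 0 k * partial k (u i) (y + t *: z).
    rewrite E exchange_big; apply: eq_bigr => i _; apply: eq_bigr => k _.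
    by rewrite (mulrC (z 0 i)).
  (* Averaging the double sum with its transpose replaces the gradient by half the strain. *)
  rewrite [LHS](_ : _ = 2^-1 * (psi t + psi t)); last by field.
  rewrite {1}E E' -big_split mulr_sumr; apply: eq_bigr => i _ /=.
  by rewrite -big_split mulr_sumr; apply: eq_bigr => k _ /=; rewrite -mulrDr.
apply: (le_trans (sqr_sum2_le _)); rewrite -[leRHS]mulrA [leRHS]mulrCA ler_wpM2l ?exprn_ge0 //.
rewrite /strain_sqr mulr_sumr; apply: ler_sum => i _; rewrite mulr_sumr; apply: ler_sum => k _.
rewrite mulrA exprMn ler_wpM2r ?sqr_ge0 // -[leLHS]real_normK ?num_real //.
have -> : zeta ^+ 4 = (zeta * zeta) ^+ 2 by rewrite -expr2 -exprM.
rewrite lerXn2r ?nnegrE ?mulr_ge0 // !normrM.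
have hz m : `|z 0 m| <= zeta by apply: le_trans zz; exact: ler_coord.
have : `|z 0 i| * `|z 0 k| <= zeta * zeta by apply: ler_pM.
rewrite gtr0_norm //; have : 0 <= `|z 0 i| * `|z 0 k| by rewrite mulr_ge0.
by move: (`|z 0 i| * `|z 0 k|) (zeta * zeta) => p q; lra.
Qed.

End korn.

(** * Averages of the pairing over a cube *)

Section korn_average.
Context {R : realType} {d : nat}.
Notation mu := (lebesgue_rV R d).
Implicit Types (x y z : 'rV[R]_d) (i j k l : 'I_d).
Variables (u : 'I_d -> 'rV[R]_d -> R) (su : forall k, smooth (u k)).
Local Notation E := (strain_sqr u).
Local Notation g := (pairing u).
Local Notation D r := (\1_(cube r : set 'rV[R]_d)).

Lemma indic_cubeE (r : R) x : D r x = (`|x| <= r)%R%:R :> R.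
Proof.
rewrite indicE; have [xr|xr] := leP `|x| r; first by rewrite mem_set.
by rewrite memNset // /cube /= => H; rewrite ltNge H in xr.
Qed.

Lemma ig_cube_continuous (r : R) (f : 'rV[R]_d -> R) : continuous f -> ig mu (fun x => D r x * f x).
Proof.
move=> cf; have [M M0 HM] := continuous_bounded_cube r cf.
apply: ig_le (igZ M (ig_indic_cube r)) => [|x].
  by apply: measurable_funM; [exact: measurable_indic_cube|exact: continuous_measurable_rV].
rewrite indic_cubeE; have [xr|xr] := leP `|x| r; last by rewrite mul0r normr0 mulr0.
by rewrite mul1r mulr1 HM.
Qed.

Lemma measurable_u k : measurable_fun setT (u k).
Proof. apply: continuous_measurable_rV; exact (smooth_continuous (su k)). Qed.

Lemma measurable_strain : measurable_fun setT E.
Proof. apply: continuous_measurable_rV; exact (continuous_strain_sqr su). Qed.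

Lemma cube_convex (r t : R) y z : 0 <= t -> t <= 1 -> `|y| <= r -> `|y + z| <= r ->
  `|y + t *: z| <= r.
Proof.
move=> t0 t1 h1 h2.
have -> : y + t *: z = (1 - t) *: y + t *: (y + z).
  by rewrite scalerDr scalerBl scale1r addrA subrK.
apply: (le_trans (ler_normD _ _)); rewrite !normrZ (ger0_norm t0) ger0_norm ?subr_ge0 //.
have -> : r = (1 - t) * r + t * r by ring.
by apply: lerD; rewrite ler_wpM2l // subr_ge0.
Qed.

(** If [y] and [y + z] lie in the cube, so does the segment between them, so the indicator of the
    cube can be inserted at [y + t z]. After Tonelli, translation by [t z] in the integral over [y]
    makes the bound independent of [t]. *)
Lemma pairing_translate (r zeta : R) z : `|z| <= zeta ->
  ig mu (fun y => D r y * (D r (y + z) * g (y + z) y ^+ 2)) /\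
  \int[mu]_y (D r y * (D r (y + z) * g (y + z) y ^+ 2)) <=
    zeta ^+ 4 * d%:R ^+ 2 * \int[mu]_y (D r y * E y).
Proof.
move=> zz; set c := zeta ^+ 4 * d%:R ^+ 2.
have zeta0 : 0 <= zeta by apply: le_trans zz.
have c0 : 0 <= c by rewrite mulr_ge0 ?exprn_ge0.
have m1 := @measurable_indic_cube R d r.
have mz := measurable_translate z m1.
have mg : measurable_fun setT (fun y => g (y + z) y).
  apply: measurable_sum => k; apply: measurable_funM.
    by apply: measurable_funB; [exact: measurable_translate (measurable_coord k)|exact: measurable_coord].
  by apply: measurable_funB; [exact: measurable_translate (measurable_u k)|exact: measurable_u].
have m0 : measurable_fun setT (fun y => D r y * (D r (y + z) * g (y + z) y ^+ 2)).
  by apply: measurable_funM => //; apply: measurable_funM => //; exact: measurable_funX.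
have ge0 y : 0 <= D r y * (D r (y + z) * g (y + z) y ^+ 2) :> R.
  by rewrite mulr_ge0 ?indicE // mulr_ge0 // sqr_ge0.
have iE : ig mu (fun y => D r y * E y) by apply: ig_cube_continuous; exact (continuous_strain_sqr su).
apply: ig_bound => //.
pose J : set R := `[0, 1]%classic.
pose H (p : 'rV[R]_d * measurableTypeR R) := \1_J p.2 * (c * (D r (p.1 + p.2 *: z) * E (p.1 + p.2 *: z))).
have H0 p : (0 <= (H p)%:E)%E.
  rewrite lee_fin mulr_ge0 ?indicE // mulr_ge0 // mulr_ge0 //.
  exact: strain_sqr_ge0.
have mline : measurable_fun setT (fun p : 'rV[R]_d * measurableTypeR R => p.1 + p.2 *: z).
  apply: measurable_fun_rVP => i; under eq_fun do rewrite !mxE.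
  apply: measurable_funD; first exact: measurableT_comp (measurable_coord i) measurable_fst.
  by apply: measurable_funM => //; exact: measurable_snd.
have mJ : measurable_fun setT (fun p : 'rV[R]_d * measurableTypeR R => \1_J p.2 : R).
  have mJ : measurable_fun setT (\1_J : measurableTypeR R -> R).
    by apply: measurable_indic; exact: measurable_itv.
  exact: (measurableT_comp mJ measurable_snd).
have mH : measurable_fun setT (fun p => (H p)%:E).
  apply/measurable_EFinP; apply: measurable_funM => //; apply: measurable_funM => //.
  apply: measurable_funM; first exact: (measurableT_comp m1 mline).
  exact: (measurableT_comp measurable_strain mline).
apply: (@le_trans _ _ (\int[mu]_y \int[@lebesgue_measure R]_t (H (y, t))%:E)%E).
  apply: ge0_le_integral => //.
  - by move=> y _; rewrite lee_fin.
  - exact/measurable_EFinP.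
  - exact: (measurable_fun_fubini_tonelli_F _ mH H0).
  move=> y _; rewrite !indic_cubeE.
  have [yr|yr] := leP `|y| r; last by rewrite mul0r; apply: integral_ge0 => t _; exact: H0.
  have [zr|zr] := leP `|y + z| r; last by rewrite mul0r mulr0; apply: integral_ge0 => t _; exact: H0.
  rewrite !mul1r; apply: le_trans (pairing_bound su y zz) _.
  rewrite le_eqVlt; apply/orP; left; apply/eqP; apply: eq_integral => t _; congr EFin.
  rewrite /H /= indicE; have [tJ|tJ] := boolP (t \in _); last by rewrite !mul0r.
  have /andP[t0 t1] : 0 <= t <= 1 by move/set_mem: tJ; rewrite /= in_itv.
  by rewrite !mul1r indic_cubeE (cube_convex t0 t1 yr zr) mul1r.
rewrite (fubini_tonelli _ mH H0).
apply: (@le_trans _ _ (\int[@lebesgue_measure R]_t ((c * \int[mu]_y (D r y * E y)) * \1_J t)%:E)%E).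
  rewrite le_eqVlt; apply/orP; left; apply/eqP; apply: eq_integral => t _.
  rewrite /H /=.
  have iT : ig mu (fun y => D r (y + t *: z) * E (y + t *: z)).
    exact: (ig_translate (t *: z) iE).
  rewrite EFinI; last by do 2 apply: igZ.
  rewrite IZ; last exact: igZ.
  rewrite IZ // (I_translate (t *: z) (f := fun y => D r y * E y)); last exact: ig_meas iE.
  by rewrite mulrC.
have iJ : ig (@lebesgue_measure R) (fun t => \1_J t).
  apply: ig_finite => [|t|]; [by apply: measurable_indic; exact: measurable_itv|by rewrite indicE|].
  rewrite integral_indic //=; last exact: measurable_itv.
  by rewrite setIT lebesgue_measure_itv /= lte_fin ltr01 -EFinB ltry.
rewrite EFinI; last exact: igZ.
rewrite IZ // (_ : \int[lebesgue_measure]_t \1_J t = 1) ?mulr1 //.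
apply/eqP; rewrite -eqe -EFinI // integral_indic //=; last exact: measurable_itv.
by rewrite setIT lebesgue_measure_itv /= lte_fin ltr01 -EFinB subr0.
Qed.

Lemma continuous_pairing y : continuous (fun x => g x y).
Proof.
apply: continuous_sum => k x.
have h1 : continuous (fun _ : 'rV[R]_d => y 0 k) by move=> t; exact: cst_continuous.
have h2 : continuous (fun _ : 'rV[R]_d => u k y) by move=> t; exact: cst_continuous.
exact: (continuousM (continuousB (@continuous_coord R d k x) (h1 x))
  (continuousB (smooth_continuous (su k) (x := x)) (h2 x))).
Qed.

Definition pairing_int r y := \int[mu]_x (D r x * g x y ^+ 2).

Lemma ig_pairing r y : ig mu (fun x => D r x * g x y ^+ 2).
Proof. by apply: ig_cube_continuous; apply: continuous_sqr; exact: continuous_pairing. Qed.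

Lemma pairing_int_ge0 r y : 0 <= pairing_int r y.
Proof. by apply: I_ge0 => x; rewrite mulr_ge0 ?indicE // sqr_ge0. Qed.

Lemma I_indic_cube r : 0 <= r -> \int[mu]_z D r z = (r *+ 2) ^+ d.
Proof.
move=> r0; apply/eqP; rewrite -eqe -EFinI; last exact: ig_indic_cube.
rewrite integral_indic //=; last exact: measurable_cube.
by rewrite setIT (lebesgue_rV_cube r0).
Qed.

(** The substitution [x = y + z] reduces the double integral to [pairing_translate] for each [z].
    Only [|z| <= 2 r] contributes, whence the volume of the cube of radius [2 r] in the constant. *)
Lemma pairing_integral r : 0 <= r ->
  ig mu (fun y => D r y * pairing_int r y) /\
  \int[mu]_y (D r y * pairing_int r y) <=
   (r + r) ^+ 4 * d%:R ^+ 2 * ((r + r) *+ 2) ^+ d * \int[mu]_y (D r y * E y).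
Proof.
move=> r0; have m1 := @measurable_indic_cube R d r.
have rr0 : 0 <= r + r by rewrite addr_ge0.
set c := (r + r) ^+ 4 * d%:R ^+ 2.
have c0 : 0 <= c by rewrite mulr_ge0 ?exprn_ge0.
set T := \int[mu]_y (D r y * E y).
have T0 : 0 <= T by apply: I_ge0 => y; rewrite mulr_ge0 ?indicE // strain_sqr_ge0.
pose H (p : 'rV[R]_d * 'rV[R]_d) := D r p.1 * (D r (p.1 + p.2) * g (p.1 + p.2) p.1 ^+ 2).
have H0 p : (0 <= (H p)%:E)%E.
  by rewrite lee_fin mulr_ge0 ?indicE // mulr_ge0 // sqr_ge0.
have madd : measurable_fun setT (fun p : 'rV[R]_d * 'rV[R]_d => p.1 + p.2).
  apply: measurable_fun_rVP => i; under eq_fun do rewrite !mxE.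
  by apply: measurable_funD; [exact: measurableT_comp (measurable_coord i) measurable_fst|
    exact: measurableT_comp (measurable_coord i) measurable_snd].
have mH : measurable_fun setT (fun p => (H p)%:E).
  apply/measurable_EFinP; apply: measurable_funM; first exact: (measurableT_comp m1 measurable_fst).
  apply: measurable_funM; first exact: (measurableT_comp m1 madd).
  apply: measurable_funX; apply: measurable_sum => k; apply: measurable_funM.
    by apply: measurable_funB; [exact: (measurableT_comp (measurable_coord k) madd)|
      exact: (measurableT_comp (measurable_coord k) measurable_fst)].
  by apply: measurable_funB; [exact: (measurableT_comp (measurable_u k) madd)|
    exact: (measurableT_comp (measurable_u k) measurable_fst)].
have EH y : (D r y * pairing_int r y)%:E = (\int[mu]_z (H (y, z))%:E)%E.
  have iy : ig mu (fun x => D r (x + y) * g (x + y) y ^+ 2) := ig_translate y (ig_pairing r y).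
  have E1 : pairing_int r y = \int[mu]_z (D r (z + y) * g (z + y) y ^+ 2).
    by apply/esym; apply: (I_translate y (f := fun x => D r x * g x y ^+ 2)); exact: ig_meas (ig_pairing r y).
  rewrite E1 -IZ // -EFinI; last exact: igZ.
  by apply: eq_integral => z _; rewrite /H /= (addrC y).
apply: ig_bound.
- apply/measurable_EFinP; rewrite (_ : _ \o _ = fun y => \int[mu]_z (H (y, z))%:E)%E.
    exact: (measurable_fun_fubini_tonelli_F _ mH H0).
  by apply/funext => y; rewrite -EH.
- by move=> y; rewrite mulr_ge0 ?indicE // pairing_int_ge0.
under eq_integral do rewrite EH.
rewrite (fubini_tonelli _ mH H0).
apply: (@le_trans _ _ (\int[mu]_z (c * T * D (r + r) z)%:E)%E).
  apply: ge0_le_integral => //.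
  - by move=> z _; apply: integral_ge0 => y _; exact: H0.
  - exact: (measurable_fun_fubini_tonelli_G _ mH H0).
  - by apply/measurable_EFinP; apply: measurable_funM => //; exact: measurable_indic_cube.
  move=> z _; rewrite indic_cubeE; have [zr|zr] := leP `|z| (r + r).
    have [i1 i2] := pairing_translate r zr.
    by rewrite mulr1 /H /= EFinI.
  rewrite mulr0 (_ : (\int[mu]_y _)%E = 0%E) //.
  rewrite (eq_integral (fun=> 0%E)) ?integral0 // => y _; rewrite /H /= !indic_cubeE.
  have [yr|yr] := leP `|y| r; last by rewrite mul0r.
  have [yzr|yzr] := leP `|y + z| r; last by rewrite mul0r mulr0.
  have : `|z| <= r + r.
    have -> : z = (y + z) - y by rewrite addrAC subrr add0r.
    by apply: (le_trans (ler_normB _ _)); rewrite lerD.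
  by move=> /(lt_le_trans zr); rewrite ltxx.
rewrite EFinI; last by apply: igZ; exact: ig_indic_cube.
rewrite IZ; last exact: ig_indic_cube.
rewrite lee_fin mulrAC -mulrA mulrC.
by rewrite I_indic_cube // mulrC mulrA mulrAC.
Qed.

(** The displacements of the [d + 1] base points: [None] is the centre, [Some k] a shift by [s]
    along the axis [k]. An option type treats them uniformly in sums. *)
Definition probe (s : R) (a : option 'I_d) : 'rV[R]_d :=
  if a is Some k then s *: delta_mx 0 k else 0.

Lemma norm_probe s a : 0 <= s -> `|probe s a| <= s.
Proof.
move=> s0; case: a => [k|] /=; last by rewrite normr0.
by apply: (le_trans (norm_delta _ _)); rewrite ger0_norm.
Qed.

(** The first sum collects the bounds of [pairing_integral] for the [d + 1] base points, the second
    those of [pairing_translate] for pairs of base points, whose distance is at most [r]. *)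
Definition korn_const0 (r : R) : R :=
  \sum_(a : option 'I_d) ((r + r) ^+ 4 * d%:R ^+ 2 * ((r + r) *+ 2) ^+ d) +
  \sum_(a : option 'I_d) \sum_(b : option 'I_d) (r ^+ 4 * d%:R ^+ 2).

(* The integral over [y] of all the quantities to be bounded is controlled by the strain, so some
   [y] makes all of them small; [delta] covers the case of a vanishing strain. *)
Lemma good_point r delta : 0 < r -> 0 < delta -> exists2 y, `|y| <= r / 2 &
  let c := (korn_const0 r * \int[mu]_y (D r y * E y) + delta) / r ^+ d in
  (forall a, pairing_int r (y + probe (r / 2) a) <= c) /\
  (forall a b, g (y + probe (r / 2) a) (y + probe (r / 2) b) ^+ 2 <= c).
Proof.
move=> r0 delta0; set T := \int[mu]_y (D r y * E y).
set c := ((korn_const0 r * T + delta) / r ^+ d) => /=.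
pose s := r / 2; have s0 : 0 <= s by rewrite divr_ge0 // ltW.
have ss : s + s = r by rewrite /s; field.
pose A a y := D r (y + probe s a) * pairing_int r (y + probe s a).
pose B a b y := D r (y + probe s b) * (D r (y + probe s a) * g (y + probe s a) (y + probe s b) ^+ 2).
have hA a : ig mu (A a) /\ \int[mu]_y A a y <= (r + r) ^+ 4 * d%:R ^+ 2 * ((r + r) *+ 2) ^+ d * T.
  have [i1 i2] := pairing_integral (ltW r0).
  split; first exact: (ig_translate (probe s a) i1).
  rewrite [X in X <= _](I_translate (probe s a) (f := fun y => D r y * pairing_int r y)) //.
  exact: ig_meas i1.
have hB a b : ig mu (B a b) /\ \int[mu]_y B a b y <= r ^+ 4 * d%:R ^+ 2 * T.
  have zz : `|probe s a - probe s b| <= r.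
    by rewrite -ss; apply: (le_trans (ler_normB _ _)); rewrite lerD // norm_probe.
  have [i1 i2] := pairing_translate r zz.
  have EB : B a b = fun y => (fun y => D r y * (D r (y + (probe s a - probe s b)) *
     g (y + (probe s a - probe s b)) y ^+ 2)) (y + probe s b).
    by apply/funext => y; rewrite /B -[y + probe s b + _]addrA [probe s b + _]addrC subrK.
  split; first by rewrite EB; exact: (ig_translate (probe s b) i1).
  rewrite EB (I_translate (probe s b) (f := fun y => D r y * (D r (y + (probe s a - probe s b)) *
     g (y + (probe s a - probe s b)) y ^+ 2))) //.
  exact: ig_meas i1.
pose Phi y := \sum_a A a y + \sum_a \sum_b B a b y.
have A0 a y : 0 <= A a y by rewrite /A mulr_ge0 ?indicE // pairing_int_ge0.
have B0 a b y : 0 <= B a b y by rewrite /B mulr_ge0 ?indicE // mulr_ge0 // sqr_ge0.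
have iA : ig mu (fun y => \sum_a A a y) by apply: ig_sum => a _; case: (hA a).
have iBa a : ig mu (fun y => \sum_b B a b y) by apply: ig_sum => b _; case: (hB a b).
have iB : ig mu (fun y => \sum_a \sum_b B a b y) by apply: ig_sum => a _; exact: iBa.
have iPhi : ig mu Phi by exact: igD.
have IPhi : \int[mu]_y Phi y <= korn_const0 r * T.
  rewrite /Phi ID // /korn_const0 mulrDl; apply: lerD.
    rewrite I_sum; last by move=> a _; case: (hA a).
    by rewrite mulr_suml; apply: ler_sum => a _; case: (hA a).
  rewrite I_sum; last by move=> a _; exact: iBa.
  rewrite mulr_suml; apply: ler_sum => a _.
  rewrite I_sum; last by move=> b _; case: (hB a b).
  by rewrite mulr_suml; apply: ler_sum => b _; case: (hB a b).
have rd0 : 0 < r ^+ d by rewrite exprn_gt0.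
have [y ys Py] : exists2 y, `|y| <= s & Phi y <= c.
  (* If [Phi] exceeded [c] on all of [cube s], whose volume is [(2 s)^d = r^d], its integral would
     be at least [c * r^d = korn_const0 r * T + delta], more than it is. *)
  apply: contrapT => H.
  have : \int[mu]_y (c * D s y) <= \int[mu]_y Phi y.
    apply: I_le => // [|y]; first by apply: igZ; exact: ig_indic_cube.
    rewrite indic_cubeE; have [ys|ys] := leP `|y| s.
      by rewrite mulr1 leNgt; apply/negP => cy; apply: H; exists y => //; exact: ltW.
    by rewrite mulr0 addr_ge0 // sumr_ge0 // => a _; rewrite sumr_ge0.
  rewrite IZ; last exact: ig_indic_cube.
  rewrite I_indic_cube // mulr2n ss /c divfK ?gt_eqF // => /le_trans /(_ IPhi).
  by rewrite gerDl leNgt delta0.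
exists y => //=.
have in_r a : D r (y + probe s a) = 1 :> R.
  rewrite indic_cubeE (_ : `|_| <= r) // -ss; apply: (le_trans (ler_normD _ _)).
  by rewrite lerD // norm_probe.
have B00 a : 0 <= \sum_b B a b y by rewrite sumr_ge0.
split => [a|a b]; apply: le_trans Py.
  rewrite /Phi (bigD1 a) //= {1}/A in_r mul1r -addrA lerDl addr_ge0 // sumr_ge0 //.
have Bab : g (y + probe s a) (y + probe s b) ^+ 2 = B a b y by rewrite /B !in_r !mul1r.
have SA : 0 <= \sum_a A a y by rewrite sumr_ge0.
rewrite Bab; apply: (@le_trans _ _ (\sum_b B a b y)).
  by rewrite (bigD1 b) //= lerDl sumr_ge0.
apply: (@le_trans _ _ (\sum_a \sum_b B a b y)); last by rewrite lerDr.
by rewrite [leRHS](bigD1 a) //= lerDl sumr_ge0.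
Qed.

End korn_average.

(** * Approximation by a Killing field *)

Section korn_cube.
Context {R : realType} {d : nat}.
Notation mu := (lebesgue_rV R d).
Implicit Types (x y z : 'rV[R]_d) (i j k l : 'I_d).
Local Notation D r := (\1_(cube r : set 'rV[R]_d)).

Lemma L2locB_smooth (f g : 'rV[R]_d -> R) : L2loc f -> smooth g -> L2loc (fun x => f x - g x).
Proof.
move=> hf sg; apply: (L2locD hf (L2loc_continuous (f := fun x => - g x) _)).
exact (smooth_continuous (smoothN sg)).
Qed.

(** The matrix is antisymmetrised inside the definition, so arbitrary coefficients give an
    infinitesimal rigid motion and no side condition on [A] has to be carried along. *)
Definition killing (c : 'I_d -> R) (A : 'I_d -> 'I_d -> R) k x : R :=
  c k + \sum_l (A k l - A l k) * x 0 l.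

Lemma smooth_killing c A k : smooth (killing c A k).
Proof.
apply: smoothD; first exact: smooth_cst.
by apply: smooth_sum => l; apply: smoothM; [exact: smooth_cst|exact: smooth_coord].
Qed.

Lemma sum_delta (s : R) k (F : 'I_d -> R) :
  \sum_m (s * (m == k)%:R) * F m = s * F k.
Proof.
rewrite (bigD1 k) //= eqxx mulr1 big1 ?addr0 // => m /negPf ->.
by rewrite mulr0 mul0r.
Qed.

Section identities.
Variables (u : 'I_d -> 'rV[R]_d -> R) (s : R) (y : 'rV[R]_d).
Local Notation g := (pairing u).
Local Notation yy k := (y + s *: delta_mx 0 k).

(** The quadratic parts of the two pairings cancel: the base points differ only in coordinate [k],
    so one component of [u x] remains next to an affine function of [x]. *)
Lemma pairing_probe_base x k : g x y - g x (yy k) =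
  s * (u k x - u k (yy k)) + \sum_m (x 0 m - y 0 m) * (u m (yy k) - u m y).
Proof.
rewrite -(sum_delta s k (fun m => u m x - u m (yy k))) -sumrB -big_split /=.
apply: eq_bigr => m _; rewrite !mxE eqxx /=; move: (u m _) (u m _) (u m _) => a b e.
move: (x 0 m) (y 0 m) (_%:R) => *; ring.
Qed.

Lemma pairing_probe0 k : g (yy k) y = s * (u k (yy k) - u k y).
Proof.
rewrite -(sum_delta s k (fun m => u m (yy k) - u m y)).
apply: eq_bigr => m _; rewrite !mxE eqxx /=; move: (u m _) (u m _) => a b.
move: (y 0 m) (_%:R) => *; ring.
Qed.

Lemma pairing_probe k l : g (yy k) (yy l) =
  s * (u k (yy k) - u k (yy l)) - s * (u l (yy k) - u l (yy l)).
Proof.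
rewrite -(sum_delta s k (fun m => u m (yy k) - u m (yy l))).
rewrite -(sum_delta s l (fun m => u m (yy k) - u m (yy l))) -sumrB.
apply: eq_bigr => m _; rewrite !mxE eqxx /=; move: (u m _) (u m _) => a b.
move: (y 0 m) (_ == k)%:R (_ == l)%:R => *; ring.
Qed.

End identities.

Lemma korn_cube (r : R) : 0 < r -> exists2 C, 0 < C &
  forall u (su : forall k, smooth (u k)) delta, 0 < delta ->
  exists c A, forall k,
    \int[mu]_x (D r x * (u k x - killing c A k x) ^+ 2) <=
    C * (\int[mu]_x (D r x * strain_sqr u x) + delta).
Proof.
move=> r0; pose s := r / 2; have s0 : 0 < s by rewrite divr_gt0.
have K0 : 0 <= korn_const0 (d := d) r.
  rewrite /korn_const0 addr_ge0 // sumr_ge0 // => a _.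
    by rewrite !mulr_ge0 // ?exprn_ge0 // ?mulrn_wge0 // addr_ge0 // ltW.
  by rewrite sumr_ge0 // => b _; rewrite mulr_ge0 // exprn_ge0 // ltW.
(* The first term comes from two pairing integrals with coefficient [4 s^-2] each; the second is
   half of the bound [36 d^2 r^2 s^-4] for the symmetric part of the difference quotients, times the
   volume of the cube. *)
pose C1 := 8 * s^-1 ^+ 2 + 18 * d%:R ^+ 2 * r ^+ 2 * s^-1 ^+ 4 * (r *+ 2) ^+ d.
have C10 : 0 < C1.
  have t0 : 0 < s^-1 by rewrite invr_gt0.
  rewrite ltr_pwDl //; first by rewrite mulr_gt0 // exprn_gt0.
  have h1 : 0 <= s^-1 ^+ 4 by rewrite exprn_ge0 // ltW.
  have h2 : 0 <= r ^+ 2 by rewrite sqr_ge0.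
  have h3 : 0 <= (r *+ 2) ^+ d by rewrite exprn_ge0 // mulrn_wge0 // ltW.
  by do 4! apply: mulr_ge0 => //.
exists (C1 * ((korn_const0 (d := d) r + 1) / r ^+ d)).
  by rewrite mulr_gt0 // divr_gt0 ?exprn_gt0 // ltr_wpDl.
move=> u su delta delta0.
have [y ys [Hi Hg]] := good_point su r0 delta0.
set T := \int[mu]_x _ in Hi Hg *.
set c := ((korn_const0 r * T + delta) / r ^+ d) in Hi Hg.
have T0 : 0 <= T by apply: I_ge0 => x; rewrite mulr_ge0 ?indicE // strain_sqr_ge0.
have cE : c <= (korn_const0 (d := d) r + 1) / r ^+ d * (T + delta).
  rewrite /c [leRHS]mulrAC ler_pM2r ?invr_gt0 ?exprn_gt0 //.
  by clear -K0 T0 delta0; move: (korn_const0 _) K0 T T0 delta0 => K K0 T T0 delta0; nra.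
have c0 : 0 <= c by apply: le_trans (Hi None); exact: pairing_int_ge0.
pose yy k := y + s *: delta_mx 0 k.
pose a k l := (u l (yy k) - u l y) / s.
(* [a k l] approximates [d_k u_l] at [y]. The witness is [u_k (yy k)] plus the antisymmetric part of
   this linearisation, centred at [y]. *)
exists (fun k => u k (yy k) + \sum_l y 0 l * (a k l - a l k) / 2), (fun k l => - (a k l) / 2) => k.
set kil := killing _ _ k.
have Hy : y + probe (d := d) (r / 2) None = y by rewrite /= addr0.
(* The symmetric part is small: [s^2 (a k l + a l k)] is a signed sum of three pairings among [y],
   [yy k] and [yy l], each of square at most [c], hence the factor 9. *)
have ha l : (a k l + a l k) ^+ 2 <= 9 * s^-1 ^+ 4 * c.
  have h1 := Hg (Some k) None; have h2 := Hg (Some l) None; have h3 := Hg (Some k) (Some l).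
  rewrite Hy in h1 h2; rewrite /= -/s in h1 h2 h3.
  have E : a k l + a l k = s^-1 ^+ 2 * (pairing u (yy k) y + pairing u (yy l) y - pairing u (yy k) (yy l)).
    rewrite pairing_probe !pairing_probe0 /a /yy; move: (u _ _) (u _ _) (u _ _) (u _ _) (u _ _) (u _ _).
    by move=> *; field; rewrite gt_eqF.
  rewrite E exprMn -exprM (_ : 9 * s^-1 ^+ 4 * c = s^-1 ^+ (2 * 2) * (9 * c)); last first.
    by move: (s^-1) c {Hi Hg cE c0 h1 h2 h3} => t q; ring.
  apply: ler_wpM2l; first by rewrite exprn_ge0 // invr_ge0 ltW.
  rewrite /yy; move: h1 h2 h3; move: (pairing _ _ _) (pairing _ _ _) (pairing _ _ _) => p q t h1 h2 h3.
  have := sqr_ge0 (p - q); have := sqr_ge0 (p + t); have := sqr_ge0 (q + t).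
  rewrite !expr2 in h1 h2 h3 *; nra.
have hu x : u k x - kil x = s^-1 * (pairing u x y - pairing u x (yy k)) -
    2^-1 * \sum_l (x 0 l - y 0 l) * (a k l + a l k).
  rewrite pairing_probe_base /kil /killing -/(yy k).
  have -> : \sum_m (x 0 m - y 0 m) * (u m (yy k) - u m y) = s * \sum_m (x 0 m - y 0 m) * a k m.
    rewrite mulr_sumr; apply: eq_bigr => m _; rewrite /a.
    by move: (u _ _) (u _ _) => *; field; rewrite gt_eqF.
  rewrite -mulrDr mulKf ?gt_eqF //.
  have -> : \sum_l (- a k l / 2 - - a l k / 2) * x 0 l =
      - (\sum_l y 0 l * (a k l - a l k) / 2) - \sum_m (x 0 m - y 0 m) * a k m +
      2^-1 * \sum_l (x 0 l - y 0 l) * (a k l + a l k).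
    rewrite mulr_sumr -!sumrN -!big_split /=; apply: eq_bigr => m _.
    by move: (a _ _) (a _ _) => p q; field.
  by rewrite /kil; move: (\sum_l _) (\sum_l _) (\sum_l _) (u _ _) (u _ _) => *; ring.
have hb x : D r x * (u k x - kil x) ^+ 2 <=
    4 * s^-1 ^+ 2 * (D r x * pairing u x y ^+ 2) + 4 * s^-1 ^+ 2 * (D r x * pairing u x (yy k) ^+ 2)
    + 18 * d%:R ^+ 2 * r ^+ 2 * s^-1 ^+ 4 * c * D r x.
  rewrite indic_cubeE; have [xr|xr] := leP `|x| r; last by rewrite !(mul0r, mulr0, addr0).
  rewrite hu !mul1r mulr1.
  set S := \sum_l _; set G1 := pairing _ _ _; set G2 := pairing _ _ _.
  have hS : S ^+ 2 <= 36 * d%:R ^+ 2 * r ^+ 2 * s^-1 ^+ 4 * c.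
    apply: (le_trans (sqr_sum_le _)).
    apply: (@le_trans _ _ (d%:R * \sum_(l < d) (4 * r ^+ 2) * (9 * s^-1 ^+ 4 * c))).
      rewrite ler_wpM2l //; apply: ler_sum => l _; rewrite exprMn ler_pM ?sqr_ge0 //.
      (* As [s = r / 2], the square is at most [(3 r / 2)^2], below the [4 r^2] used above. *)
      have : `|x 0 l - y 0 l| <= r + s.
        by apply: (le_trans (ler_normB _ _)); rewrite lerD //; apply: (le_trans (ler_coord _ _)).
      rewrite -real_normK ?num_real // => h; apply: (@le_trans _ _ ((r + s) ^+ 2)).
        by rewrite ler_sqr ?nnegrE ?addr_ge0 // ltW.
      rewrite /s !expr2; nra.
    rewrite sumr_const card_ord -[_ *+ d]mulr_natl le_eqVlt; apply/orP; left; apply/eqP.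
    by move: (s^-1) c {Hi Hg cE c0 ha} => t q; ring.
  move: hS; move: (s^-1) => t; clearbody S G1 G2.
  have -> : 18 * d%:R ^+ 2 * r ^+ 2 * t ^+ 4 * c = (36 * d%:R ^+ 2 * r ^+ 2 * t ^+ 4 * c) / 2 by field.
  move: (36 * _ * _ * _ * _) => M hS.
  have := sqr_ge0 (t * (G1 - G2) + 2^-1 * S); have := sqr_ge0 (t * (G1 + G2)).
  rewrite !expr2 in hS *; nra.
have ig1 z : ig mu (fun x => D r x * pairing u x z ^+ 2) := ig_pairing su r z.
have igD' : ig mu (D r) by exact: ig_indic_cube.
have ig2 z : ig mu (fun x => 4 * s^-1 ^+ 2 * (D r x * pairing u x z ^+ 2)) by exact: igZ.
have ig3 z : ig mu (fun x => 18 * d%:R ^+ 2 * r ^+ 2 * s^-1 ^+ 4 * c * D r x) by exact: igZ.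
have igl : ig mu (fun x => D r x * (u k x - kil x) ^+ 2).
  apply: ig_cube_continuous; apply: continuous_sqr => x.
  apply: continuousB; first exact: (smooth_continuous (su k) (x := x)).
  exact: (smooth_continuous (smooth_killing _ _ k) (x := x)).
have := I_le igl (igD (igD (ig2 y) (ig2 (yy k))) (ig3 0)) hb.
move=> /le_trans; apply.
rewrite ID; [|exact: (igD (ig2 y) (ig2 (yy k)))|exact: (ig3 0)].
rewrite ID // !IZ // I_indic_cube; last exact: ltW.
have h1 := Hi None; have h2 := Hi (Some k); rewrite Hy in h1; rewrite /= -/s in h2.
apply: (@le_trans _ _ (C1 * c)); last first.
  by rewrite -[leRHS]mulrA; apply: ler_wpM2l => //; exact: ltW.
have s2 : 0 <= 4 * s^-1 ^+ 2 by rewrite mulr_ge0 // sqr_ge0.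
have -> : C1 * c = 4 * s^-1 ^+ 2 * c + 4 * s^-1 ^+ 2 * c +
    18 * d%:R ^+ 2 * r ^+ 2 * s^-1 ^+ 4 * c * (r *+ 2) ^+ d.
  rewrite /C1; move: (s^-1) ((r *+ 2) ^+ d) c {Hi Hg cE c0 ha hb ig3 h1 h2} => t w q; ring.
by apply: lerD => //; apply: lerD; apply: ler_wpM2l.
Qed.

End korn_cube.

(** * Weak symmetric gradients *)

Section weak_strain.
Context {R : realType} {d : nat}.
Notation mu := (lebesgue_rV R d).
Implicit Types (f g eta : 'rV[R]_d -> R) (x y z : 'rV[R]_d) (i j k l : 'I_d).
Local Notation D r := (\1_(cube r : set 'rV[R]_d)).

(** A field and its strain must be mollified by the same kernel for their relation to persist, so a
    single [eta] has to serve finitely many functions. *)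
Lemma moll_cvg_fin (J : finType) (f : J -> 'rV[R]_d -> R) (r delta : R) :
  (forall a, L2loc (f a)) -> 0 < delta -> exists2 eta, smooth eta & exists rho,
    bsupp rho eta /\ forall a, ig mu (fun x => D r x * (moll eta (f a) x - f a x) ^+ 2) /\
      \int[mu]_x (D r x * (moll eta (f a) x - f a x) ^+ 2) <= delta.
Proof.
move=> hf delta0.
have /choice[rho Hrho] := fun a => moll_cvg r (hf a) delta0.
pose rho0 := \big[Order.min/1]_a rho a.
have rho00 : 0 < rho0 by apply: (big_ind (fun p => 0 < p)) => [|p q p0 q0|a _] //; [rewrite lt_min p0|case: (Hrho a)].
have [eta se [be e0 e1]] := @bump_exists R d _ rho00.
exists eta => //; exists rho0; split => // a.
have le1 : rho0 <= rho a by exact: bigmin_le.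
by have [_ H] := Hrho a; exact: (H _ _ le1 se be e0 e1).
Qed.

(** Young's inequality with parameter [s] gives [|g^2 - f^2| <= (1 + 1/s) (g - f)^2 + s f^2]. The
    weight [a] may change sign, and the tolerance [t] depends only on [f], [r], [K] and [eps]. *)
Lemma sqr_perturbation (r K eps : R) f : L2loc f -> 0 <= K -> 0 < eps ->
  exists t, 0 < t /\ forall (a g : 'rV[R]_d -> R),
    measurable_fun setT a -> (forall x, `|a x| <= K * D r x) -> measurable_fun setT g ->
    ig mu (fun x => D r x * (g x - f x) ^+ 2) ->
    \int[mu]_x (D r x * (g x - f x) ^+ 2) <= t ->
    [/\ ig mu (fun x => a x * f x ^+ 2), ig mu (fun x => a x * g x ^+ 2) &
     `|\int[mu]_x (a x * g x ^+ 2) - \int[mu]_x (a x * f x ^+ 2)| <= eps].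
Proof.
move=> [mf hf] K0 eps0; set F := \int[mu]_x (D r x * f x ^+ 2).
have F0 : 0 <= F by apply: I_ge0 => x; rewrite mulr_ge0 ?sqr_ge0 // indicE.
(* First [s] makes the part proportional to [f^2] at most [eps / 2]; then [t] does the same for the
   part with the large factor [1 + 1/s]. *)
pose s := eps / 2 / (K * F + 1).
have KF0 : 0 <= K * F by rewrite mulr_ge0.
have s0 : 0 < s by rewrite !divr_gt0 // ltr_wpDl.
pose t := eps / 2 / (K * (1 + s^-1) + 1).
have Ks0 : 0 <= K * (1 + s^-1) by rewrite mulr_ge0 // addr_ge0 // invr_ge0 ltW.
have t0 : 0 < t by rewrite !divr_gt0 // ltr_wpDl.
exists t; split => // a g ma ha mg hg It.
have pw x : `|a x * g x ^+ 2 - a x * f x ^+ 2| <=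
    K * ((1 + s^-1) * (D r x * (g x - f x) ^+ 2) + s * (D r x * f x ^+ 2)).
  rewrite -mulrBr normrM; apply: (@le_trans _ _ (K * D r x * `|g x ^+ 2 - f x ^+ 2|)).
    by apply: ler_wpM2r => //; exact: ha.
  rewrite -mulrA; apply: ler_wpM2l => //; rewrite (mulrCA _ (D r x)) (mulrCA s) -mulrDr.
  apply: ler_wpM2l; first by rewrite indicE.
  have sV : s * s^-1 = 1 by rewrite divff // gt_eqF.
  have sV0 : 0 < s^-1 by rewrite invr_gt0.
  move: (f x) (g x) => p q; clear -sV s0 sV0; move: (s^-1) sV sV0 => w sV w0.
  have E : w * (q - p - s * p) ^+ 2 = w * (q - p) ^+ 2 - 2 * (s * w) * (q - p) * p + (s * w) * s * p ^+ 2 by ring.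
  have E' : w * (q - p + s * p) ^+ 2 = w * (q - p) ^+ 2 + 2 * (s * w) * (q - p) * p + (s * w) * s * p ^+ 2 by ring.
  rewrite sV !mulr1 !mul1r in E E'.
  have h : 0 <= w * (q - p - s * p) ^+ 2 by rewrite mulr_ge0 ?sqr_ge0 // ltW.
  have h' : 0 <= w * (q - p + s * p) ^+ 2 by rewrite mulr_ge0 ?sqr_ge0 // ltW.
  rewrite E in h; rewrite E' in h'; rewrite ler_norml; have h3 := sqr_ge0 (q - p).
  by rewrite !expr2 in h h' h3 *; apply/andP; split; lra.
have iaf : ig mu (fun x => a x * f x ^+ 2).
  apply: (ig_le _ _ (igZ K (hf r))); first by apply: measurable_funM => //; exact: measurable_funX.
  move=> x; rewrite normrM mulrA; apply: ler_pM => //.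
  by rewrite ger0_norm ?sqr_ge0.
have ib := igZ K (igD (igZ (1 + s^-1) hg) (igZ s (hf r))).
have mag : measurable_fun setT (fun x => a x * g x ^+ 2).
  by apply: measurable_funM => //; exact: measurable_funX.
have iag : ig mu (fun x => a x * g x ^+ 2).
  apply: (ig_le mag _ (igD ib (ig_abs iaf))) => x.
  by apply: le_trans (lerD (pw x) (lexx _)); rewrite -{1}(subrK (a x * f x ^+ 2) (a x * g x ^+ 2)) ler_normD.
split => //; rewrite -IB //.
apply: (le_trans (I_abs (igB iag iaf))).
apply: (le_trans (I_le (ig_abs (igB iag iaf)) ib pw)).
rewrite IZ; last exact: (igD (igZ (1 + s^-1) hg) (igZ s (hf r))).
rewrite ID; [|exact: igZ|exact: igZ]; rewrite !IZ // -/F.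
have e1 : K * (1 + s^-1) * t <= eps / 2.
  rewrite /t mulrCA ger_pMr ?divr_gt0 // ler_pdivrMr ?ltr_wpDl // mul1r lerDl //.
have e2 : K * F * s <= eps / 2.
  rewrite /s mulrCA ger_pMr ?divr_gt0 // ler_pdivrMr ?ltr_wpDl // mul1r lerDl //.
rewrite mulrDr; have -> : eps = eps / 2 + eps / 2 by field.
apply: lerD; last by rewrite (_ : K * (s * F) = K * F * s) //; clear; ring.
by apply: le_trans e1; rewrite mulrA; apply: ler_wpM2l.
Qed.

(** The distributional identity [d_i u_j + d_j u_i = e i j], tested against all translated kernels
    at once: every mollification of [u] is a smooth field whose strain is the mollified [e]. *)
Definition weak_strain (u : 'I_d -> 'rV[R]_d -> R) (e : 'I_d -> 'I_d -> 'rV[R]_d -> R) :=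
  forall rho eta, smooth eta -> bsupp rho eta ->
    forall i j x, strain (fun k => moll eta (u k)) i j x = moll eta (e i j) x.

Lemma smooth_shift x eta : smooth eta -> smooth (fun y => eta (y - x)).
Proof.
move=> se; have -> : (fun y => eta (y - x)) = fun y => eta (1 *: y + - x).
  by apply/funext => y; rewrite scale1r.
exact (smooth_affine 1 (- x) se).
Qed.

Lemma smooth_half f : smooth f -> smooth (fun x => f x / 2).
Proof.
move=> sf; have -> : (fun x => f x / 2) = fun x => 2^-1 * f x.
  by apply/funext => y; rewrite mulrC.
exact (smoothZ 2^-1 sf).
Qed.

(** This is [X_i g = e^{-V/2} d_i (e^{V/2} g)] in weak form. Against the test function
    [eta (y - x) e^{V/2}], the derivative of the exponential cancels the term with [d_i V]. *)
Lemma weak_X_moll (V : 'rV[R]_d -> R) i g rho eta x : smooth V -> L2loc g ->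
  smooth eta -> bsupp rho eta ->
  weak_X V i g (fun y => eta (y - x) * expR (V y / 2)) =
  partial i (moll eta (fun y => expR (V y / 2) * g y)) x.
Proof.
move=> sV hg se be; set W := fun y => expR (V y / 2).
have pV := smooth_pd i sV.
have sW : smooth W.
  exact (smooth_expR (smooth_half sV)).
have hWg : L2loc (fun y => W y * g y) := L2loc_mul_continuous (smooth_continuous sW) hg.
have hVg : L2loc (fun y => partial i V y * (W y * g y)) :=
  L2loc_mul_continuous (smooth_continuous (smooth_partial i sV)) hWg.
have pW : pd i W (fun y => W y * (2^-1 * partial i V y)).
  apply: pd_expR; have := pdZ 2^-1 pV.
  by rewrite (_ : (fun x => 2^-1 * V x) = fun x => V x / 2) //; apply/funext => y; rewrite mulrC.
have pe : pd i (fun y => eta (y - x)) (fun y => partial i eta (y - x)).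
  have := pd_affine 1 (- x) (smooth_pd i se).
  by under eq_fun do rewrite scale1r; under [X in pd _ _ X]eq_fun do rewrite mul1r scale1r.
have -> : partial i (moll eta (fun y => W y * g y)) = fun x => - moll (partial i eta) (fun y => W y * g y) x.
  exact: (pd_partial (pd_moll i se be hWg)).
rewrite /weak_X /distr_of_fun /weak_partial (pd_partial (pdM pe pW)).
have i1 := moll_ig x (smooth_continuous se) be hVg.
have i2 := moll_ig x (smooth_continuous (smooth_partial i se)) (bsupp_partial i se be) hWg.
have -> : \int[mu]_x0 (2^-1 * partial i V x0 * g x0 * (eta (x0 - x) * W x0)) =
    2^-1 * \int[mu]_y (eta (y - x) * (partial i V y * (W y * g y))).
  by rewrite -IZ //; apply: I_ext => y; move: (eta _) (W _) (g _) (partial _ _ _) => *; ring.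
have -> : \int[mu]_x0 (g x0 * (partial i eta (x0 - x) * W x0 + eta (x0 - x) * (W x0 * (2^-1 * partial i V x0)))) =
   \int[mu]_y (partial i eta (y - x) * (W y * g y)) +
    2^-1 * \int[mu]_y (eta (y - x) * (partial i V y * (W y * g y))).
  rewrite -IZ // -ID //; last exact: igZ.
  by apply: I_ext => y; move: (eta _) (W _) (g _) (partial _ _ _) (partial _ _ _) => *; ring.
by rewrite /moll opprD addrCA subrr addr0.
Qed.

Lemma weak_strain_of_weak_X (V : 'rV[R]_d -> R) (b : 'I_d -> 'rV[R]_d -> R)
  (S : 'I_d -> 'I_d -> 'rV[R]_d -> R) : smooth V -> (forall j, L2loc (b j)) ->
  (forall i j phi, test_function phi ->
     weak_X V i (b j) phi + weak_X V j (b i) phi = \int[mu]_x (S i j x * phi x)) ->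
  weak_strain (fun j x => expR (V x / 2) * b j x) (fun i j x => expR (V x / 2) * S i j x).
Proof.
move=> sV hb H rho eta se be i j x; rewrite /strain.
rewrite -(weak_X_moll i x sV (hb j) se be) -(weak_X_moll j x sV (hb i) se be) H.
  by apply: I_ext => y; move: (eta _) (expR _) (S _ _ _) => *; ring.
apply: (@test_functionP R d (rho + `|x|)).
  exact (smoothM (smooth_shift x se) (smooth_expR (smooth_half sV))).
by apply: bsuppMl; exact: bsupp_shift.
Qed.

(** The estimate on a cube is applied to one mollification close enough in L^2. The Killing field
    depends on that mollification; the error [delta] in the statement avoids extracting a limit of
    these fields. *)
Lemma weak_korn (r : R) : 0 < r -> exists2 C, 0 < C &
  forall u e, (forall j, L2loc (u j)) -> (forall i j, L2loc (e i j)) -> weak_strain u e ->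
  forall delta, 0 < delta -> exists c A, forall k,
    \int[mu]_x (D r x * (u k x - killing c A k x) ^+ 2) <=
    C * (\int[mu]_x (D r x * \sum_i \sum_j e i j x ^+ 2) + delta).
Proof.
move=> r0; have [C C0 HC] := @korn_cube R d r r0.
exists (4 * C); first by rewrite mulr_gt0.
move=> u e hu he H delta delta0.
(* The total coefficient of the tolerance [t] in the final sum: 2 from replacing [u] by its
   mollification, the rest from the strain, with its [d^2] components, and from the error of Korn's
   inequality. *)
pose c1 := 2 + 2 * C * (2 * d%:R ^+ 2 + 1).
have c10 : 0 < c1 by rewrite ltr_pwDl // !mulr_ge0 // ?addr_ge0 // ?mulr_ge0 ?exprn_ge0 // ltW.
pose t := 2 * C * delta / c1.
have t0 : 0 < t by rewrite divr_gt0 // !mulr_gt0.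
pose J : finType := ('I_d + 'I_d * 'I_d)%type.
pose f (a : J) := match a with inl k => u k | inr p => e p.1 p.2 end.
have hf a : L2loc (f a) by case: a => [k|[i j]] /=.
have [eta se [rho [be Heta]]] := moll_cvg_fin r hf t0.
pose m k := moll eta (u k).
have sm k : smooth (m k) by exact: smooth_moll se be (hu k).
have [c [A HA]] := HC m sm t t0.
exists c, A => k.
pose Q := \int[mu]_x (D r x * \sum_i \sum_j e i j x ^+ 2).
have ie i j : ig mu (fun x => D r x * e i j x ^+ 2) := (he i j).2 r.
have Heq i j := Heta (inr (i, j)).
have iQ : ig mu (fun x => D r x * \sum_i \sum_j e i j x ^+ 2).
  have : ig mu (fun x => \sum_i \sum_j D r x * e i j x ^+ 2) by apply: ig_sum => i _; exact: ig_sum.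
  by apply: ig_ext => x; rewrite mulr_sumr; apply: eq_bigr => i _; rewrite mulr_sumr.
have iS : ig mu (fun x => D r x * strain_sqr m x).
  by apply: ig_cube_continuous; exact: continuous_strain_sqr.
have HS : \int[mu]_x (D r x * strain_sqr m x) <= 2 * Q + 2 * d%:R ^+ 2 * t.
  pose G i j x := D r x * (moll eta (e i j) x - e i j x) ^+ 2.
  have iG i j : ig mu (G i j) by case: (Heq i j).
  have iGs : ig mu (fun x => \sum_i \sum_j G i j x) by apply: ig_sum => i _; exact: ig_sum.
  apply: (@le_trans _ _ (\int[mu]_x (2 * (D r x * \sum_i \sum_j e i j x ^+ 2) + 2 * \sum_i \sum_j G i j x))).
    apply: I_le => //; first by apply: igD; exact: igZ.
    move=> x; rewrite -mulrDr /strain_sqr !mulr_sumr -big_split /= mulr_sumr.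
    apply: ler_sum => i _; rewrite !mulr_sumr -big_split /= mulr_sumr.
    apply: ler_sum => j _; rewrite (H _ _ se be) /G; rewrite -mulrDr [leRHS]mulrCA.
    apply: ler_wpM2l; first by rewrite indicE.
    move: (moll _ _ _) (e _ _ _) => p q; have := sqr_ge0 (p - 2 * q).
    by rewrite !expr2; lra.
  rewrite ID; [|exact: igZ|exact: igZ]; rewrite !IZ // lerD2l -mulrA ler_wpM2l //.
  rewrite I_sum; last by move=> i _; exact: ig_sum.
  apply: (@le_trans _ _ (\sum_(i < d) \sum_(j < d) t)).
    by apply: ler_sum => i _; rewrite I_sum //; apply: ler_sum => j _; case: (Heq i j).
  by rewrite !sumr_const !card_ord -mulrnA -[leLHS]mulr_natl natrM expr2.
have [iu Iu] := Heta (inl k); rewrite /= in iu Iu.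
have mD := @measurable_indic_cube R d r.
have mk := continuous_measurable_rV (smooth_continuous (smooth_killing c A k)).
have iK : ig mu (fun x => D r x * (m k x - killing c A k x) ^+ 2).
  by apply: ig_cube_continuous; apply: continuous_sqr; exact: (smooth_continuous (smoothB (sm k) (smooth_killing c A k))).
have pw x : D r x * (u k x - killing c A k x) ^+ 2 <=
    2 * (D r x * (moll eta (u k) x - u k x) ^+ 2) + 2 * (D r x * (m k x - killing c A k x) ^+ 2).
  rewrite !(mulrCA 2) -mulrDr; apply: ler_wpM2l; first by rewrite indicE.
  rewrite /m; move: (moll _ _ _) (u _ _) (killing _ _ _ _) => p q s.
  by have := sqr_ge0 (p - q + (p - s)); rewrite !expr2; lra.
have iL : ig mu (fun x => D r x * (u k x - killing c A k x) ^+ 2).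
  apply: (ig_le _ _ (igD (igZ 2 iu) (igZ 2 iK))).
    apply: measurable_funM => //; apply: measurable_funX; apply: measurable_funB => //.
    by case: (hu k).
  by move=> x; rewrite ger0_norm // mulr_ge0 ?indicE // sqr_ge0.
apply: (le_trans (I_le iL (igD (igZ 2 iu) (igZ 2 iK)) pw)).
rewrite ID; [|exact: igZ|exact: igZ]; rewrite !IZ //.
have h4 := le_trans (HA k) (ler_wpM2l (ltW C0) (lerD HS (lexx t))).
have h5 : t * c1 = 2 * C * delta by rewrite /t divfK // gt_eqF.
have h6 : 0 <= C * delta by rewrite mulr_ge0 // ltW.
apply: (le_trans (lerD (ler_wpM2l (ler0n R 2) Iu) (ler_wpM2l (ler0n R 2) h4))).
rewrite -/Q (_ : 2 * t + _ = 4 * (C * Q) + t * c1); last by rewrite /c1; clear; ring.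
rewrite h5; clear -h6; move: Q h6 => q h6; nra.
Qed.

End weak_strain.

(** * Limits of quadratic inequalities under mollification *)

Section limit_inequality.
Context {R : realType} {d : nat}.
Notation mu := (lebesgue_rV R d).
Local Notation D r := (\1_(cube r : set 'rV[R]_d)).

(** The weights are bounded and supported in a cube, so each integral is continuous under
    mollification whatever the sign of its weight. Collecting everything in one sum bounded by 0
    allows both sides of an inequality to be treated together. *)
Lemma moll_limit_inequality (J : finType) (f h a : J -> 'rV[R]_d -> R) (r K : R) :
  (forall i, L2loc (f i)) -> (forall i, smooth (h i)) ->
  (forall i, measurable_fun setT (a i)) -> (forall i x, `|a i x| <= K * D r x) -> 0 <= K ->
  (forall rho eta, smooth eta -> bsupp rho eta ->
    \sum_i \int[mu]_x (a i x * (moll eta (f i) x - h i x) ^+ 2) <= 0) ->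
  (forall i, ig mu (fun x => a i x * (f i x - h i x) ^+ 2)) /\
  \sum_i \int[mu]_x (a i x * (f i x - h i x) ^+ 2) <= 0.
Proof.
move=> hf sh ma ba K0 H.
have hfh i : L2loc (fun x => f i x - h i x) := L2locB_smooth (hf i) (sh i).
have key eps : 0 < eps -> (forall i, ig mu (fun x => a i x * (f i x - h i x) ^+ 2)) /\
    \sum_i \int[mu]_x (a i x * (f i x - h i x) ^+ 2) <= #|J|%:R * eps.
  move=> eps0.
  have /choice[t Ht] := fun i => sqr_perturbation r (hfh i) K0 eps0.
  pose t0 := \big[Order.min/1]_i t i.
  have t00 : 0 < t0.
    by apply: (big_ind (fun p => 0 < p)) => [|p q p0 q0|i _] //; [rewrite lt_min p0|case: (Ht i)].
  have [eta se [rho [be Heta]]] := moll_cvg_fin r hf t00.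
  have P i : [/\ ig mu (fun x => a i x * (f i x - h i x) ^+ 2),
       ig mu (fun x => a i x * (moll eta (f i) x - h i x) ^+ 2) &
      `|\int[mu]_x (a i x * (moll eta (f i) x - h i x) ^+ 2) -
        \int[mu]_x (a i x * (f i x - h i x) ^+ 2)| <= eps].
    have [_ Hi] := Ht i; have [i1 i2] := Heta i.
    have E x : moll eta (f i) x - h i x - (f i x - h i x) = moll eta (f i) x - f i x.
      by rewrite opprB addrA subrK.
    apply: Hi => //.
    - apply: measurable_funB; apply: continuous_measurable_rV; last exact (smooth_continuous (sh i)).
      exact: continuous_moll se be (hf i).
    - by under eq_fun do rewrite E.
    - under eq_Rintegral do rewrite E.
      apply: (le_trans i2); exact: bigmin_le.
  split; first by move=> i; case: (P i).
  have -> : #|J|%:R * eps = 0 + \sum_(i : J) eps by rewrite add0r sumr_const mulr_natl.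
  apply: le_trans (lerD (H rho eta se be) (lexx _)).
  rewrite -big_split /=; apply: ler_sum => i _.
  have [_ _] := P i; rewrite distrC ler_norml => /andP[_].
  by rewrite lerBlDl.
split; first by case: (key 1).
apply/ler_addgt0Pr => eps eps0; rewrite add0r.
have n0 : 0 < #|J|%:R + 1 :> R by rewrite ltr_wpDl.
have [|_ h1] := key (eps / (#|J|%:R + 1)); first by rewrite divr_gt0.
apply: (le_trans h1); rewrite mulrCA ger_pMr // ler_pdivrMr // mul1r lerDl.
exact: ler01.
Qed.

End limit_inequality.

(** * The weighted Garding inequality for weak symmetric gradients *)

Section weak_garding.
Context {R : realType} {d : nat}.
Notation mu := (lebesgue_rV R d).
Implicit Types (f g eta : 'rV[R]_d -> R) (x y z : 'rV[R]_d) (i j k l : 'I_d).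
Local Notation D r := (\1_(cube r : set 'rV[R]_d)).
Variables (V : 'rV[R]_d -> R) (sV : smooth V).
Variables (chi : 'rV[R]_d -> R) (r M : R).
Hypotheses (schi : smooth chi) (bchi : bsupp r chi) (M0 : 0 <= M).
Hypothesis (HM : forall x, \sum_i partial i chi x ^+ 2 <= M).
Local Notation om x := (expR (- V x)).

(** The subtracted term is the cutoff error, with [M] bounding the squared gradient of [chi];
    [4 * M] is half of the 8 in [garding_pointwise], because the Garding inequality has a factor 2
    on its left. *)
Definition garding_weight x := om x * (chi x ^+ 2 * confinement V x - 4 * M * D r x).

(** Two uses of [(p + q)^2 <= 2 p^2 + 2 q^2]: to separate the strain from the cutoff terms, then to
    separate the two cutoff terms. *)
Lemma garding_pointwise (x : R) (E : 'I_d -> 'I_d -> R) (p w : 'I_d -> R) N :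
  \sum_i p i ^+ 2 <= N ->
  \sum_i \sum_j (x * E i j + (p i * w j + p j * w i)) ^+ 2 <=
  2 * \sum_i \sum_j x ^+ 2 * E i j ^+ 2 + 8 * (N * \sum_j w j ^+ 2).
Proof.
move=> pN.
apply: (@le_trans _ _ (\sum_i \sum_j (2 * (x ^+ 2 * E i j ^+ 2) +
    4 * (p i ^+ 2 * w j ^+ 2 + p j ^+ 2 * w i ^+ 2)))).
  apply: ler_sum => i _; apply: ler_sum => j _.
  move: (p i) (p j) (w i) (w j) (E i j) => a b c e q.
  have h1 := sqr_ge0 (x * q - (a * e + b * c)); have h2 := sqr_ge0 (a * e - b * c).
  have E1 : 2 * (x ^+ 2 * q ^+ 2) + 4 * (a ^+ 2 * e ^+ 2 + b ^+ 2 * c ^+ 2) =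
    (x * q + (a * e + b * c)) ^+ 2 + (x * q - (a * e + b * c)) ^+ 2 + 2 * (a * e - b * c) ^+ 2 by ring.
  by rewrite E1 -addrA lerDl addr_ge0 // mulr_ge0.
have S : \sum_i \sum_j p i ^+ 2 * w j ^+ 2 = (\sum_i p i ^+ 2) * \sum_j w j ^+ 2.
  by rewrite mulr_suml; apply: eq_bigr => i _; rewrite mulr_sumr.
have S' : \sum_i \sum_j p j ^+ 2 * w i ^+ 2 = (\sum_i p i ^+ 2) * \sum_j w j ^+ 2.
  by rewrite exchange_big.
have -> : \sum_i \sum_j (2 * (x ^+ 2 * E i j ^+ 2) + 4 * (p i ^+ 2 * w j ^+ 2 + p j ^+ 2 * w i ^+ 2)) =
    2 * (\sum_i \sum_j x ^+ 2 * E i j ^+ 2) +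
    4 * (\sum_i \sum_j p i ^+ 2 * w j ^+ 2 + \sum_i \sum_j p j ^+ 2 * w i ^+ 2).
  rewrite -big_split /= !mulr_sumr -big_split /=; apply: eq_bigr => i _.
  by rewrite -big_split /= !mulr_sumr -big_split.
have E8 (z : R) : 4 * (z + z) = 8 * z by ring.
rewrite S S' lerD2l E8.
by rewrite ler_wpM2l // ler_wpM2r // sumr_ge0 // => j _; exact: sqr_ge0.
Qed.

(** The factor [e^{-V/2}] cancels the zeroth-order part of [X_i]; only the strain of [w] and
    derivatives of the cutoff remain. *)
Lemma sym_term_weighted (w : 'I_d -> 'rV[R]_d -> R) i j x : (forall k, smooth (w k)) ->
  sym_term V (fun k x => chi x * (expR (- V x / 2) * w k x)) i j x =
  expR (- V x / 2) * (chi x * strain w i j x + (partial i chi x * w j x + partial j chi x * w i x)).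
Proof.
move=> sw; pose Wm x := expR (- V x / 2).
have P m k : partial m (fun x => chi x * (Wm x * w k x)) =
    fun x => partial m chi x * (Wm x * w k x) +
      chi x * (Wm x * (2^-1 * - partial m V x) * w k x + Wm x * partial m (w k) x).
  apply: pd_partial; apply: pdM; first exact (smooth_pd m schi).
  apply: pdM; last exact (smooth_pd m (sw k)).
  have -> : Wm = fun x => expR (2^-1 * - V x) by apply/funext => y; rewrite /Wm mulrC.
  exact (pd_expR (pdZ 2^-1 (pdN (smooth_pd m sV)))).
rewrite /sym_term /strain -/(Wm x).
rewrite -[fun x => chi x * (expR (- V x / 2) * w j x)]/(fun x => chi x * (Wm x * w j x)).
rewrite -[fun x => chi x * (expR (- V x / 2) * w i x)]/(fun x => chi x * (Wm x * w i x)).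
rewrite !P -/(Wm x); move: (Wm x) (chi x) (w i x) (w j x) => a b c e.
move: (partial i _ _) (partial j _ _) (partial i _ _) (partial j _ _) (partial i _ _) (partial j _ _).
by move=> *; field.
Qed.

Let som : smooth (fun x => om x). Proof. exact (smooth_expR (smoothN sV)). Qed.
Let com := smooth_continuous som.
Let cchi := smooth_continuous schi.

Lemma grad_cutoff x : \sum_i partial i chi x ^+ 2 <= M * D r x.
Proof.
rewrite indic_cubeE; have [xr|xr] := leP `|x| r; first by rewrite mulr1.
by rewrite mulr0 big1 // => i _; rewrite (bsupp_partial i schi bchi xr) expr0n.
Qed.

Lemma continuous_om_chi2 : continuous (fun x => om x * chi x ^+ 2).
Proof. by move=> x; exact: (continuousM (com (x := x)) (continuous_sqr cchi (x := x))). Qed.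

Lemma bsupp_chi2 : bsupp r (fun x => om x * chi x ^+ 2).
Proof. by move=> x xr; rewrite (bchi xr) expr0n mulr0. Qed.

(** [garding_inequality] is applied to the compactly supported field [chi e^{-V/2} w]. The
    derivatives of the cutoff are moved to the left, where they form the negative part of
    [garding_weight]. *)
Lemma garding_smooth (w : 'I_d -> 'rV[R]_d -> R) : (forall k, smooth (w k)) ->
  \sum_j \int[mu]_x (garding_weight x * w j x ^+ 2) <=
  \sum_i \sum_j \int[mu]_x (om x * chi x ^+ 2 * strain w i j x ^+ 2).
Proof.
have combine (p q s : R) : 2 * p <= 2 * s + 8 * M * q -> p - 4 * M * q <= s by lra.
move=> sw; pose b k x := chi x * (expR (- V x / 2) * w k x).
have sb k : smooth (b k).
  exact (smoothM schi (smoothM (smooth_expR (smooth_half (smoothN sV))) (sw k))).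
have bb k : bsupp r (b k) by exact: bsuppMl.
have W2 x : expR (- V x / 2) ^+ 2 = om x by rewrite expr2 -expRD -splitr.
have cw k : continuous (fun x => w k x ^+ 2) := continuous_sqr (smooth_continuous (sw k)).
have cs i j : continuous (fun x => strain w i j x ^+ 2).
  apply: continuous_sqr.
  exact (smooth_continuous (smoothD (smooth_partial i (sw j)) (smooth_partial j (sw i)))).
have i1 i j : ig mu (fun x => om x * chi x ^+ 2 * strain w i j x ^+ 2).
  apply: (ig_cc (r := r)); last by apply: bsuppMl; exact: bsupp_chi2.
  by move=> x; exact: (continuousM (continuous_om_chi2 (x := x)) (cs i j x)).
have i2 j : ig mu (fun x => D r x * (om x * w j x ^+ 2)).
  apply: ig_cube_continuous => x; exact: (continuousM (com (x := x)) (cw j x)).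
have i3 j : ig mu (fun x => confinement V x * (om x * chi x ^+ 2 * w j x ^+ 2)).
  apply: (ig_cc (r := r)); last first.
    by move=> x xr; rewrite (bsupp_chi2 xr) mul0r mulr0.
  move=> x; apply: (continuousM (continuous_confinement sV (x := x))).
  exact: (continuousM (continuous_om_chi2 (x := x)) (cw j x)).
have i1s : ig mu (fun x => \sum_i \sum_j om x * chi x ^+ 2 * strain w i j x ^+ 2).
  by apply: ig_sum => i _; exact: ig_sum.
have i2s : ig mu (fun x => \sum_j D r x * (om x * w j x ^+ 2)) by exact: ig_sum.
have := garding_inequality sV sb bb.
have -> : \int[mu]_x (confinement V x * \sum_j b j x ^+ 2) =
    \sum_j \int[mu]_x (confinement V x * (om x * chi x ^+ 2 * w j x ^+ 2)).
  rewrite -I_sum //; apply: I_ext => x; rewrite mulr_sumr; apply: eq_bigr => j _.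
  by rewrite /b !exprMn W2 mulrA [chi x ^+ 2 * _]mulrC.
have -> : \sum_i \sum_j \int[mu]_x (sym_term V b i j x ^+ 2) =
    \int[mu]_x (\sum_i \sum_j sym_term V b i j x ^+ 2).
  rewrite I_sum; last by move=> i _; apply: ig_sum => j _; exact (ig_sym_term sV sb bb i j).
  by apply: eq_bigr => i _; rewrite I_sum // => j _; exact (ig_sym_term sV sb bb i j).
have pw x : \sum_i \sum_j sym_term V b i j x ^+ 2 <=
    2 * (\sum_i \sum_j om x * chi x ^+ 2 * strain w i j x ^+ 2) +
    8 * M * \sum_j D r x * (om x * w j x ^+ 2).
  have -> : \sum_i \sum_j sym_term V b i j x ^+ 2 = om x * \sum_i \sum_j
     (chi x * strain w i j x + (partial i chi x * w j x + partial j chi x * w i x)) ^+ 2.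
    rewrite mulr_sumr; apply: eq_bigr => i _; rewrite mulr_sumr; apply: eq_bigr => j _.
    by rewrite (sym_term_weighted i j x sw) exprMn W2.
  apply: (le_trans (ler_wpM2l (expR_ge0 _) (garding_pointwise _ _ _ (grad_cutoff x)))).
  rewrite mulrDr lerD //.
    rewrite mulrCA ler_wpM2l // mulr_sumr; apply: ler_sum => i _.
    by rewrite mulr_sumr; apply: ler_sum => j _; rewrite mulrA.
  rewrite mulrCA -mulrA ler_wpM2l // -[M * _ * _]mulrA mulrCA ler_wpM2l //.
  rewrite !mulr_sumr; apply: ler_sum => j _.
  by rewrite mulrCA.
have iR := igD (igZ 2 i1s) (igZ (8 * M) i2s).
have iL : ig mu (fun x => \sum_i \sum_j sym_term V b i j x ^+ 2).
  by apply: ig_sum => i _; apply: ig_sum => j _; exact (ig_sym_term sV sb bb i j).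
move=> /le_trans /(_ (I_le iL iR pw)).
rewrite ID; [|exact: igZ|exact: igZ]; rewrite !IZ //.
rewrite [X in 2 * X + _](_ : _ = \sum_i \sum_j \int[mu]_x (om x * chi x ^+ 2 * strain w i j x ^+ 2)); last first.
  rewrite I_sum; last by move=> i _; exact: ig_sum.
  by apply: eq_bigr => i _; rewrite I_sum.
rewrite I_sum //.
have -> : \sum_j \int[mu]_x (garding_weight x * w j x ^+ 2) =
   \sum_j \int[mu]_x (confinement V x * (om x * chi x ^+ 2 * w j x ^+ 2)) -
   4 * M * \sum_j \int[mu]_x (D r x * (om x * w j x ^+ 2)).
  rewrite mulr_sumr -sumrB; apply: eq_bigr => j _; rewrite -IZ // -IB //; last exact: igZ.
  apply: I_ext => x; rewrite /garding_weight.
  move: (om x) (chi x) (confinement V x) (D r x) (w j x) => *; ring.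
exact: combine.
Qed.

(** [garding_smooth] is applied to the mollified [u] minus [kap]; subtracting a field without strain
    leaves the right-hand side unchanged, so the mollified [e] still appears there. *)
Lemma weak_garding u e (kap : 'I_d -> 'rV[R]_d -> R) :
  (forall j, L2loc (u j)) -> (forall i j, L2loc (e i j)) -> weak_strain u e ->
  (forall k, smooth (kap k)) -> (forall i j x, strain kap i j x = 0) ->
  [/\ forall j, ig mu (fun x => garding_weight x * (u j x - kap j x) ^+ 2),
    forall i j, ig mu (fun x => om x * chi x ^+ 2 * e i j x ^+ 2) &
  \sum_j \int[mu]_x (garding_weight x * (u j x - kap j x) ^+ 2) <=
  \sum_i \sum_j \int[mu]_x (om x * chi x ^+ 2 * e i j x ^+ 2)].
Proof.
move=> hu he H sk k0.
pose J : finType := ('I_d + 'I_d * 'I_d)%type.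
pose f (a : J) := match a with inl k => u k | inr p => e p.1 p.2 end.
pose h (a : J) := match a with inl k => kap k | inr p => fun=> 0 end.
(* The components of [e] get a negative weight, which brings the inequality to the form of a single
   sum at most 0. *)
pose a (a : J) := match a with inl k => garding_weight | inr p => fun x => - (om x * chi x ^+ 2) end.
have hf b : L2loc (f b) by case: b => [k|[i j]] /=.
have ch b : smooth (h b).
  by case: b => [k|[i j]] /=; [exact (sk k)|exact: smooth_cst].
have cw : continuous (fun x => om x * (chi x ^+ 2 * confinement V x)).
  move=> x; apply: (continuousM (com (x := x))).
  exact: (continuousM (continuous_sqr cchi (x := x)) (continuous_confinement sV (x := x))).
have mD := @measurable_indic_cube R d r.
have m1 := continuous_measurable_rV continuous_om_chi2.
have mw : measurable_fun setT garding_weight.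
  apply: measurable_funM; first exact: continuous_measurable_rV.
  apply: measurable_funB; last exact: measurable_funM.
  apply: measurable_funM; first exact: (continuous_measurable_rV (continuous_sqr cchi)).
  exact: (continuous_measurable_rV (continuous_confinement sV)).
have ma b : measurable_fun setT (a b).
  by case: b => [k|[i j]] /=; [exact: mw|exact: measurableT_comp].
have [K1 K10 HK1] := continuous_bounded_cube r cw.
have [K2 K20 HK2] := continuous_bounded_cube r com.
have [K3 K30 HK3] := continuous_bounded_cube r continuous_om_chi2.
pose K := K1 + K2 * (4 * M) + K3.
have K24 : 0 <= K2 * (4 * M) by rewrite !mulr_ge0 // ltW.
have K0 : 0 <= K by rewrite !addr_ge0 // ltW.
have ba b x : `|a b x| <= K * D r x.
  rewrite indic_cubeE; have [xr|xr] := leP `|x| r; last first.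
    rewrite mulr0 normr_le0; apply/eqP; case: b => [k|[i j]] /=.
      by rewrite /garding_weight indic_cubeE (bchi xr) leNgt xr expr0n /= !mul0r !mulr0 subrr mulr0.
    by rewrite (bchi xr) expr0n mulr0 oppr0.
  rewrite mulr1; case: b => [k|[i j]] /=; last first.
    by rewrite normrN; apply: (le_trans (HK3 x xr)); rewrite lerDr addr_ge0 // ltW.
  rewrite /garding_weight indic_cubeE xr mulr1 mulrBr; apply: (le_trans (ler_normB _ _)).
  apply: (@le_trans _ _ (K1 + K2 * (4 * M))); last by rewrite lerDl ltW.
  apply: lerD; first exact: HK1.
  rewrite normrM; apply: ler_pM => //; first exact: HK2.
  by rewrite ger0_norm // mulr_ge0.
have big_J (F : J -> R) : \sum_b F b = \sum_j F (inl j) + \sum_i \sum_j F (inr (i, j)).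
  by rewrite big_sumType pair_big /=; congr (_ + _); apply: eq_bigr => -[].
have [|i1 i2] := @moll_limit_inequality R d J f h a r K hf ch ma ba K0.
  move=> rho eta se be; rewrite big_J /=.
  have sw k : smooth (fun x => moll eta (u k) x - kap k x).
    exact (smoothB (smooth_moll se be (hu k)) (sk k)).
  have := garding_smooth sw; rewrite -subr_le0; apply: le_trans.
  rewrite lerD2l -sumrN; apply: ler_sum => i _; rewrite -sumrN; apply: ler_sum => j _.
  have cE : continuous (fun x => moll eta (e i j) x ^+ 2).
    by apply: continuous_sqr; exact (continuous_moll se be (he i j)).
  have iE : ig mu (fun x => om x * chi x ^+ 2 * moll eta (e i j) x ^+ 2).
    apply: (ig_cc (r := r)); last by apply: bsuppMl; exact: bsupp_chi2.
    by move=> x; exact: (continuousM (continuous_om_chi2 (x := x)) (cE x)).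
  rewrite le_eqVlt; apply/orP; left; apply/eqP.
  transitivity (- \int[mu]_x (om x * chi x ^+ 2 * moll eta (e i j) x ^+ 2)).
    by rewrite -IN //; apply: I_ext => x; rewrite subr0 mulNr.
  congr (- _); apply: I_ext => x; congr (_ * _ ^+ 2).
  have P m k : partial m (fun x => moll eta (u k) x - kap k x) =
      fun x => partial m (moll eta (u k)) x - partial m (kap k) x.
    apply: pd_partial; have p1 := smooth_pd m (smooth_moll se be (hu k)).
    exact: (pdD p1 (pdN (smooth_pd m (sk k)))).
  rewrite -(H _ _ se be) /strain !P; have := k0 i j x; rewrite /strain.
  move: (partial i _ _) (partial j _ _) (partial i _ _) (partial j _ _) => p q s t.
  by move=> st; rewrite addrACA -opprD st subr0.
have ie i j : ig mu (fun x => om x * chi x ^+ 2 * e i j x ^+ 2).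
  by have := igN (i1 (inr (i, j))) ; apply: ig_ext => x /=; rewrite subr0 mulNr opprK.
split => //; first by move=> j; exact: (i1 (inl j)).
rewrite -subr_le0; move: i2; rewrite big_J /=; apply: le_trans.
rewrite lerD2l -sumrN; apply: ler_sum => i _; rewrite -sumrN; apply: ler_sum => j _.
rewrite -IN // le_eqVlt; apply/orP; left; apply/eqP.
by apply: I_ext => x; rewrite subr0 mulNr.
Qed.

End weak_garding.

(** * The global estimate *)

Section exhaustion.
Context {R : realType} {d : nat}.
Notation mu := (lebesgue_rV R d).
Implicit Types (f g eta : 'rV[R]_d -> R) (x y z : 'rV[R]_d) (i j k l : 'I_d).
Local Notation D r := (\1_(cube r : set 'rV[R]_d)).

Lemma ig_exhaustion f (B : R) : measurable_fun setT f -> (forall x, 0 <= f x) ->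
  (forall n : nat, ig mu (fun x => D n%:R x * f x)) ->
  (forall n : nat, \int[mu]_x (D n%:R x * f x) <= B) -> ig mu f /\ \int[mu]_x f x <= B.
Proof.
move=> mf f0 iD HB; apply: ig_bound => //.
have mE : measurable_fun setT (EFin \o f) by exact/measurable_EFinP.
have := @ge0_nondecreasing_set_cvg_integral _ _ R (fun n : nat => cube n%:R : set 'rV[R]_d) (EFin \o f) mu.
rewrite bigcup_cube => H.
have {H} : (\int[mu]_(x in cube n%:R) (f x)%:E @[n --> \oo] --> \int[mu]_x (f x)%:E)%E.
  apply: (H).
  - move=> n m nm; rewrite subsetEset => x /= xn; apply: (le_trans xn).
    by rewrite ler_nat.
  - by move=> n; exact: measurable_cube.
  - by move=> n; apply: measurable_funS mE.
  - by move=> n x _ /=; rewrite lee_fin.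
move=> H; apply: (cvge_to_le H); apply: nearW => n.
apply: le_trans (_ : ((\int[mu]_x (D n%:R x * f x))%:E <= _)%E); last by rewrite lee_fin.
rewrite -EFinI // [leLHS]integral_mkcond le_eqVlt; apply/orP; left; apply/eqP.
apply: eq_integral => x _; rewrite patchE indicE.
by case: ifP => _ /=; rewrite ?mul1r ?mul0r.
Qed.

Lemma ig_cube_weighted r (a : 'rV[R]_d -> R) f : continuous a -> L2loc f -> ig mu (fun x => D r x * (a x * f x ^+ 2)).
Proof.
move=> ca hf; have [K K0 HK] := continuous_bounded_cube r ca.
apply: (ig_le _ _ (igZ K (hf.2 r))).
  apply: measurable_funM; first exact: measurable_indic_cube.
  apply: measurable_funM; first exact: continuous_measurable_rV.
  by apply: measurable_funX; case: hf.
move=> x; rewrite indic_cubeE; have [xr|xr] := leP `|x| r; last by rewrite !mul0r mulr0 normr0.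
by rewrite !mul1r normrM [`|f x ^+ 2|]ger0_norm ?sqr_ge0 // ler_wpM2r ?sqr_ge0 // HK.
Qed.

(** The indicator of the cube of radius 2 is mollified with a kernel of radius 1, which gives 1 on
    the cube of radius 1 and 0 outside that of radius 3. Rescaling by [m] puts the factor [m^-2] on
    the squared gradient. *)
Lemma cutoff_exists : exists2 M, 0 <= M & forall m : R, 0 < m ->
  exists2 chi : 'rV[R]_d -> R, smooth chi &
  [/\ bsupp (3 * m) chi, forall x, 0 <= chi x <= 1, forall x, `|x| <= m -> chi x = 1 &
    forall x, \sum_i partial i chi x ^+ 2 <= M / m ^+ 2].
Proof.
have [eta se [be e0 e1]] := @bump_exists R d 1 ltr01.
have ce := smooth_continuous se.
have hI : L2loc (D 2) := L2_L2loc (L2_indic_cube 2).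
pose chi0 := moll eta (D 2).
have s0 : smooth chi0 by exact: smooth_moll se be hI.
have b0 : bsupp 3 chi0.
  move=> x x3; rewrite /chi0 /moll -[RHS](@I0 _ _ R mu); apply: I_ext => y.
  rewrite indic_cubeE; have [y2|y2] := leP `|y| 2; last by rewrite mulr0.
  rewrite be ?mul0r //; move: x3; rewrite -{1}(subKr y x) => /lt_le_trans /(_ (ler_normB _ _)).
  by move: y2; lra.
have ie x : ig mu (fun y => eta (y - x)).
  exact: (ig_cc (smooth_continuous (smooth_shift x se)) (bsupp_shift (x := x) be)).
have Ie x : \int[mu]_y (eta (y - x)) = 1.
  by rewrite (I_translate (- x) (f := eta)) //; exact: continuous_measurable_rV.
have i0 x : ig mu (fun y => eta (y - x) * D 2 y) := moll_ig x ce be hI.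
have p0 x : 0 <= chi0 x <= 1.
  apply/andP; split; first by apply: I_ge0 => y; rewrite mulr_ge0 // indicE.
  rewrite -(Ie x); apply: I_le => // y; rewrite indic_cubeE; case: (`|y| <= 2); first by rewrite mulr1.
  by rewrite mulr0.
have q0 x : `|x| <= 1 -> chi0 x = 1.
  move=> x1; rewrite -(Ie x); apply: I_ext => y.
  rewrite indic_cubeE; have [y2|y2] := leP `|y| 2; first by rewrite mulr1.
  rewrite be ?mul0r //; move: y2; rewrite -{1}(subrK x y) => /lt_le_trans /(_ (ler_normD _ _)).
  by move: x1; lra.
have cg : continuous (fun x => \sum_i partial i chi0 x ^+ 2).
  by apply: continuous_sum => i; exact (continuous_sqr (smooth_continuous (smooth_partial i s0))).
have bg : bsupp 3 (fun x => \sum_i partial i chi0 x ^+ 2).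
  by move=> x x3; rewrite big1 // => i _; rewrite (bsupp_partial i s0 b0 x3) expr0n.
have [M M0 HM] := bsupp_bounded cg bg.
exists M; first exact: ltW.
move=> m m0; have mV : 0 < m^-1 by rewrite invr_gt0.
exists (fun x => chi0 (m^-1 *: x + 0)); first exact (smooth_affine m^-1 0 s0).
have nm x : `|m^-1 *: x + 0| = `|x| / m by rewrite addr0 normrZ gtr0_norm // mulrC.
split => [x xm||x xm|x].
- by apply: b0; rewrite nm ltr_pdivlMr.
- by move=> x; exact: p0.
- by apply: q0; rewrite nm ler_pdivrMr // mul1r.
have -> : \sum_i partial i (fun x => chi0 (m^-1 *: x + 0)) x ^+ 2 =
    m^-1 ^+ 2 * \sum_i partial i chi0 (m^-1 *: x + 0) ^+ 2.
  rewrite mulr_sumr; apply: eq_bigr => i _.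
  by rewrite (pd_partial (pd_affine m^-1 0 (smooth_pd i s0))) exprMn.
rewrite mulrC exprVn ler_pM2r ?invr_gt0 ?exprn_gt0 //.
by apply: le_trans (HM _); exact: ler_norm.
Qed.

End exhaustion.

(* The quadratic growth is offset by the [m ^ -2], which first gives boundedness of [P] and then, as
   [m] grows, removes the middle term. *)
Lemma absorb {R : realType} (P : R -> R) (Q A M B c : R) :
  (forall s t, s <= t -> P s <= P t) -> 0 <= M -> 0 <= B -> 0 <= c ->
  (forall t, 0 < t -> P t <= B + c * t ^+ 2) ->
  (forall m, 0 < m -> P m <= Q + 4 * (M / m ^+ 2) * P (3 * m) + A) ->
  forall t, P t <= Q + A.
Proof.
move=> mono M0 B0 c0 growth step.
(* For [m >= 1] the growth bound gives [P (3 m) <= (B + 9 c) m^2], and the [m^2] cancels in the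
   middle term. *)
pose T := Num.max 0 (Q + A + 4 * M * (B + 9 * c)).
have T0 : 0 <= T by rewrite le_max lexx.
have PT m : 1 <= m -> P m <= T.
  move=> m1; have m0 : 0 < m := lt_le_trans ltr01 m1.
  rewrite le_max; apply/orP; right; apply: (le_trans (step m m0)).
  rewrite addrAC lerD2l -mulrA -[leRHS]mulrA ler_wpM2l // -mulrA ler_wpM2l //.
  rewrite mulrC ler_pdivrMr ?exprn_gt0 //.
  apply: (le_trans (growth _ _)); first by rewrite mulr_gt0.
  have mm : 1 <= m ^+ 2 by rewrite exprn_ege1.
  rewrite exprMn mulrDl lerD //; first by rewrite ler_peMr.
  by rewrite mulrCA mulrA -natrX.
move=> t; apply/ler_addgt0Pr => eps eps0.
(* The last bound makes [4 M T / m^2 <= eps], as [m <= m^2]. *)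
pose m := Num.max t (Num.max 1 (4 * M * T / eps)).
have m1 : 1 <= m by rewrite !le_max lexx orbT.
have tm : t <= m by rewrite le_max lexx.
have em : 4 * M * T / eps <= m by rewrite !le_max lexx !orbT.
have m0 : 0 < m := lt_le_trans ltr01 m1.
apply: (le_trans (mono _ _ tm)); apply: (le_trans (step m m0)).
rewrite addrAC lerD2l; apply: (@le_trans _ _ (4 * (M / m ^+ 2) * T)).
  rewrite ler_wpM2l //; first by rewrite mulr_ge0 // divr_ge0 // exprn_ge0 // ltW.
  by apply: PT; move: m1; lra.
rewrite mulrA mulrAC ler_pdivrMr ?exprn_gt0 //.
move: em; rewrite ler_pdivrMr // => em; apply: (le_trans em).
by rewrite mulrC expr2 ler_wpM2l // ?(ltW eps0) // ler_peMr // ltW.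
Qed.

Section arithmetic.
Context {R : realFieldType}.
Implicit Types X Y Z T a b c e w o : R.

Lemma cutoff_arith X Y Z T : X <= 1 -> 0 <= X -> Y <= X -> 0 <= T ->
  X * (1 - T) <= X * Z -> Y <= X * Z + T.
Proof. move=> *; nra. Qed.

Lemma weight_arith w o X Z (T1 T2 T3 a0 M : R) :
  o * w ^+ 2 * T1 <= o * w ^+ 2 * (X ^+ 2 * Z + a0 * T2) ->
  T1 * (o * w ^+ 2) <= o * (X ^+ 2 * Z - 4 * M * T3) * w ^+ 2 +
    4 * M * (T3 * (o * w ^+ 2)) + a0 * (T2 * (o * w ^+ 2)).
Proof. by rewrite !expr2 => h; lra. Qed.

Lemma growth_arith a b c e : 0 <= c * (a + b) ^+ 2 -> c * b ^+ 2 <= c * e ->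
  c * (a - b) ^+ 2 <= 2 * (c * a ^+ 2) + 2 * e * c.
Proof. by rewrite !expr2 => *; nra. Qed.

End arithmetic.

Section global.
Context {R : realType} {d : nat}.
Notation mu := (lebesgue_rV R d).
Implicit Types (f g eta : 'rV[R]_d -> R) (x y z : 'rV[R]_d) (i j k l : 'I_d).
Local Notation D r := (\1_(cube r : set 'rV[R]_d)).
Variables (V : 'rV[R]_d -> R) (sV : smooth V).
Local Notation om x := (expR (- V x)).
Variables (Rr a0 : R) (a00 : 0 <= a0).
Hypothesis conf : forall x, 1 - a0 * D Rr x <= confinement V x.
Variables (u : 'I_d -> 'rV[R]_d -> R) (e : 'I_d -> 'I_d -> 'rV[R]_d -> R).
Hypotheses (hu : forall j, L2loc (u j)) (he : forall i j, L2loc (e i j)) (ue : weak_strain u e).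
Hypothesis ige : forall i j, ig mu (fun x => om x * e i j x ^+ 2).
Variable kap : 'I_d -> 'rV[R]_d -> R.
Hypotheses (sk : forall k, smooth (kap k)) (k0 : forall i j x, strain kap i j x = 0).

Definition residual x := \sum_j om x * (u j x - kap j x) ^+ 2.
Local Notation f := residual.
Local Notation Q := (\sum_i \sum_j \int[mu]_x (om x * e i j x ^+ 2)).

Let com : continuous (fun x => om x).
Proof. exact (smooth_continuous (smooth_expR (smoothN sV))). Qed.

Let hw j : L2loc (fun x => u j x - kap j x).
Proof. exact: L2locB_smooth. Qed.

Lemma residual_ge0 x : 0 <= f x.
Proof. by apply: sumr_ge0 => j _; rewrite mulr_ge0 ?expR_ge0 ?sqr_ge0. Qed.

Lemma measurable_residual : measurable_fun setT f.
Proof.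
apply: measurable_sum => j; apply: measurable_funM; first exact: continuous_measurable_rV.
by apply: measurable_funX; case: (hw j).
Qed.

Lemma ig_cube_residual r : ig mu (fun x => D r x * f x).
Proof.
have : ig mu (fun x => \sum_j D r x * (om x * (u j x - kap j x) ^+ 2)).
  by apply: ig_sum => j _; exact: (ig_cube_weighted r com (hw j)).
by apply: ig_ext => x; rewrite mulr_sumr.
Qed.

(** Where [conf] is multiplied by [chi^2], it shows that the Garding weight dominates the indicator
    of [cube m] up to two errors, one from the cutoff on [cube r] and one from the fixed cube
    [Rr]. *)
Lemma local_estimate chi (r m M : R) : smooth chi -> bsupp r chi -> 0 <= M ->
  (forall x, \sum_i partial i chi x ^+ 2 <= M) -> (forall x, 0 <= chi x <= 1) ->
  (forall x, `|x| <= m -> chi x = 1) ->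
  \int[mu]_x (D m x * f x) <= Q + 4 * M * \int[mu]_x (D r x * f x) + a0 * \int[mu]_x (D Rr x * f x).
Proof.
move=> sc bc M0 HM c01 c1.
have [i1 i2 i3] := weak_garding sV sc bc M0 HM hu he ue sk k0.
pose G x := \sum_j garding_weight V chi r M x * (u j x - kap j x) ^+ 2.
have iG : ig mu G by apply: ig_sum => j _; exact: i1.
have IG : \int[mu]_x G x <= Q.
  rewrite I_sum //; apply: (le_trans i3); apply: ler_sum => i _; apply: ler_sum => j _.
  apply: I_le => // x; rewrite mulrAC ler_piMr //.
    by rewrite mulr_ge0 ?expR_ge0 ?sqr_ge0.
  by have /andP[p q] := c01 x; rewrite expr_le1.
have pw x : D m x * f x <= G x + 4 * M * (D r x * f x) + a0 * (D Rr x * f x).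
  rewrite /G /residual !mulr_sumr -!big_split /=; apply: ler_sum => j _.
  rewrite /garding_weight.
  have h : D m x <= chi x ^+ 2 * confinement V x + a0 * D Rr x.
    have /andP[p q] := c01 x.
    have t1 : chi x ^+ 2 <= 1 by rewrite expr_le1.
    have t0 : 0 <= chi x ^+ 2 by rewrite sqr_ge0.
    have tm : D m x <= chi x ^+ 2.
      rewrite indic_cubeE; have [/c1 ->|_] := leP `|x| m; first by rewrite expr1n.
      exact: sqr_ge0.
    have s0 : 0 <= a0 * D Rr x by rewrite mulr_ge0 // indicE.
    exact: (cutoff_arith t1 t0 tm s0 (ler_wpM2l t0 (conf x))).
  have w0 : 0 <= om x * (u j x - kap j x) ^+ 2 by rewrite mulr_ge0 ?expR_ge0 ?sqr_ge0.
  exact: (weight_arith _ _ (ler_wpM2l w0 h)).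
have iF r' := ig_cube_residual r'.
have iR := igD (igD iG (igZ (4 * M) (iF r))) (igZ a0 (iF Rr)).
apply: (le_trans (I_le (iF m) iR pw)).
rewrite ID; [|exact: (igD iG (igZ (4 * M) (iF r)))|exact: igZ].
by rewrite ID ?IZ //; [rewrite !lerD2r|exact: igZ].
Qed.

Hypotheses (igu : forall j, ig mu (fun x => om x * u j x ^+ 2)) (igom : ig mu (fun x => om x)).

(** Finiteness of the integral is part of the conclusion. At most quadratic growth of [kap^2] and
    the finite mass of [e^{-V}] give the a priori growth required by [absorb], whose uniform bound
    on cubes passes to the whole space. *)
Lemma residual_bound (p q : R) : (forall j x, kap j x ^+ 2 <= p + q * `|x| ^+ 2) ->
  0 <= p -> 0 <= q ->
  ig mu f /\ \int[mu]_x f x <= Q + a0 * \int[mu]_x (D Rr x * f x).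
Proof.
move=> Hk p0 q0; set A := a0 * _.
pose P r := \int[mu]_x (D r x * f x).
have iF r := ig_cube_residual r.
have mono s t : s <= t -> P s <= P t.
  move=> st; apply: I_le => // x; rewrite ler_wpM2r ?residual_ge0 // !indic_cubeE.
  by have [xs|xs] := leP `|x| s; [rewrite (le_trans xs st)|exact: ler0n].
have [M M0 HM] := @cutoff_exists R d.
have step m : 0 < m -> P m <= Q + 4 * (M / m ^+ 2) * P (3 * m) + A.
  move=> m0; have [chi sc [bc c01 c1 gc]] := HM m m0.
  apply: (local_estimate sc bc _ gc c01 c1).
  by rewrite divr_ge0 // exprn_ge0 // ltW.
pose B0 := \sum_j 2 * \int[mu]_x (om x * u j x ^+ 2).
have B00 : 0 <= B0.
  by apply: sumr_ge0 => j _; rewrite mulr_ge0 // I_ge0 // => x; rewrite mulr_ge0 ?expR_ge0 ?sqr_ge0.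
pose o := \int[mu]_x om x.
have o0 : 0 <= o by apply: I_ge0 => x; exact: expR_ge0.
have growth t : 0 < t -> P t <= (B0 + d%:R * (2 * p * o)) + d%:R * (2 * q * o) * t ^+ 2.
  move=> t0.
  have i1 : ig mu (fun x => \sum_(j < d) (2 * (om x * u j x ^+ 2) + 2 * (p + q * t ^+ 2) * om x)).
    by apply: ig_sum => j _; apply: igD; exact: igZ.
  apply: (@le_trans _ _ (\int[mu]_x (\sum_(j < d) (2 * (om x * u j x ^+ 2) + 2 * (p + q * t ^+ 2) * om x)))).
    apply: I_le => // x; rewrite /residual mulr_sumr; apply: ler_sum => j _.
    have oo : 0 <= om x by exact: expR_ge0.
    have pq : 0 <= p + q * t ^+ 2 by rewrite addr_ge0 // mulr_ge0 // sqr_ge0.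
    rewrite indic_cubeE; have [xt|xt] := leP `|x| t; last first.
      by rewrite mul0r; apply: addr_ge0; [apply: mulr_ge0 => //; apply: mulr_ge0 => //; exact: sqr_ge0|apply: mulr_ge0 => //; exact: mulr_ge0].
    rewrite mul1r.
    have kk : kap j x ^+ 2 <= p + q * t ^+ 2.
      apply: (le_trans (Hk j x)); rewrite lerD2l ler_wpM2l //.
      by rewrite ler_sqr ?nnegrE // ltW.
    exact: (growth_arith (mulr_ge0 oo (sqr_ge0 (u j x + kap j x))) (ler_wpM2l oo kk)).
  rewrite I_sum; last by move=> j _; apply: igD; exact: igZ.
  have -> : \sum_(j < d) \int[mu]_x (2 * (om x * u j x ^+ 2) + 2 * (p + q * t ^+ 2) * om x) =
    \sum_(j < d) (2 * \int[mu]_x (om x * u j x ^+ 2) + 2 * (p + q * t ^+ 2) * o).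
    apply: eq_bigr => j _; rewrite ID; [|exact: igZ|exact: igZ].
    by rewrite !IZ.
  rewrite big_split /= sumr_const card_ord -[_ *+ d]mulr_natl -/B0.
  rewrite le_eqVlt; apply/orP; left; apply/eqP; move: B0 o d%:R {B00 o0} => B o n; ring.
have bound t : P t <= Q + A.
  apply: (absorb mono M0 _ _ growth step).
    by rewrite addr_ge0 // !mulr_ge0.
  by rewrite !mulr_ge0.
by apply: ig_exhaustion => //; [exact: measurable_residual|exact: residual_ge0|move=> n; exact: bound].
Qed.

End global.

(** * Killing fields *)

Section killing_fields.
Context {R : realType} {d : nat}.
Implicit Types (x : 'rV[R]_d) (i j k l : 'I_d) (c : 'I_d -> R) (A : 'I_d -> 'I_d -> R).

Lemma strain_killing c A i j x : strain (killing c A) i j x = 0.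
Proof.
have P m k : partial m (killing c A k) = fun=> A k m - A m k.
  have -> : killing c A k = fun x => c k + \sum_(l <- index_enum 'I_d) (A k l - A l k) * x 0 l by [].
  apply: pd_partial.
  have h (s : seq 'I_d) : pd m (fun x => \sum_(l <- s) (A k l - A l k) * x 0 l)
      (fun=> \sum_(l <- s) (A k l - A l k) * (m == l)%:R).
    elim: s => [|l s IH].
      have -> : (fun x => \sum_(l <- [::]) (A k l - A l k) * x 0 l) = fun=> 0.
        by apply/funext => y; rewrite big_nil.
      by rewrite big_nil; exact: pd_cst.
    have -> : (fun x => \sum_(l <- l :: s) (A k l - A l k) * x 0 l) =
        fun x => (A k l - A l k) * x 0 l + \sum_(l <- s) (A k l - A l k) * x 0 l.
      by apply/funext => y; rewrite big_cons.
    rewrite big_cons; exact (pdD (pdZ (A k l - A l k) (@pd_coord R d m l)) IH).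
  have := pdD (pd_cst m (c k)) (h (index_enum 'I_d)); congr pd; apply/funext => y.
  rewrite add0r (bigD1 m) //= eqxx mulr1 big1 ?addr0 // => l.
  by rewrite eq_sym => /negPf ->; rewrite mulr0.
by rewrite /strain !P addrC subrKA subrr.
Qed.

Lemma killing_growth c A : exists2 p, 0 <= p & exists2 q, 0 <= q &
  forall k x, killing c A k x ^+ 2 <= p + q * `|x| ^+ 2.
Proof.
pose a k := \sum_l `|A k l - A l k|.
exists (\sum_k 2 * c k ^+ 2); first by apply: sumr_ge0 => k _; rewrite mulr_ge0 ?sqr_ge0.
exists (\sum_k 2 * a k ^+ 2); first by apply: sumr_ge0 => k _; rewrite mulr_ge0 ?sqr_ge0.
move=> k x; set S := \sum_l (A k l - A l k) * x 0 l.
have hS : S ^+ 2 <= a k ^+ 2 * `|x| ^+ 2.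
  rewrite -exprMn -real_normK ?num_real // ler_sqr ?nnegrE ?mulr_ge0 ?sumr_ge0 //.
  apply: (le_trans (ler_norm_sum _ _ _)); rewrite mulr_suml; apply: ler_sum => l _.
  by rewrite normrM ler_wpM2l // ler_coord.
apply: (@le_trans _ _ (2 * c k ^+ 2 + 2 * a k ^+ 2 * `|x| ^+ 2)).
  rewrite /killing -/S -mulrA; apply: (@le_trans _ _ (2 * c k ^+ 2 + 2 * S ^+ 2)).
    by have := sqr_ge0 (c k - S); rewrite !expr2; lra.
  by rewrite lerD2l ler_wpM2l.
have h (F : 'I_d -> R) : (forall k, 0 <= F k) -> F k <= \sum_k F k.
  by move=> F0; rewrite (bigD1 k) //= lerDl sumr_ge0.
apply: lerD; first by apply: (h (fun k => 2 * c k ^+ 2)) => l; rewrite mulr_ge0 ?sqr_ge0.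
apply: ler_wpM2r; first exact: sqr_ge0.
by apply: (h (fun k => 2 * a k ^+ 2)) => l; rewrite mulr_ge0 ?sqr_ge0.
Qed.

(** The reason for the two families of orthogonality conditions: pairing with Killing fields
    involves only the components [b_j] and the moments [x_l b_j - x_j b_l]. *)
Lemma sum_killing c A (b : 'I_d -> R) x : \sum_j b j * killing c A j x =
  \sum_j c j * b j + \sum_j \sum_l A j l * (x 0 l * b j - x 0 j * b l).
Proof.
have -> : \sum_j b j * killing c A j x = \sum_j c j * b j +
    (\sum_j \sum_l A j l * x 0 l * b j - \sum_j \sum_l A l j * x 0 l * b j).
  rewrite -sumrB -big_split /=; apply: eq_bigr => j _; rewrite -sumrB /killing mulrDr mulrC; congr (_ + _).
  by rewrite mulr_sumr; apply: eq_bigr => l _; ring.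
congr (_ + _); rewrite [X in _ - X]exchange_big /= -sumrB; apply: eq_bigr => j _.
by rewrite -sumrB; apply: eq_bigr => l _; ring.
Qed.

End killing_fields.

(** * The inequality for square integrable fields under confinement *)

Section korn_confined.
Context {R : realType} {d : nat}.
Notation mu := (lebesgue_rV R d).
Implicit Types (x y z : 'rV[R]_d) (i j k l : 'I_d).
Local Notation D r := (\1_(cube r : set 'rV[R]_d)).
Variables (V : 'rV[R]_d -> R) (sV : smooth V).
Hypothesis confV : tends_to_pinfty_at_infinity (confinement V).
Hypothesis igom : ig mu (fun x => expR (- V x)).
Local Notation om x := (expR (- V x)).
Local Notation W x := (expR (V x / 2)).
Local Notation Wm x := (expR (- V x / 2)).

Lemma confinement_lower : exists2 r, 0 < r & exists2 a0, 0 <= a0 &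
  forall x, 1 - a0 * D r x <= confinement V x.
Proof.
have [r0 Hr] := confV 1; pose r := Num.max 1 r0.
have rp : 0 < r by rewrite lt_max ltr01.
exists r => //; have [K K0 HK] := continuous_bounded_cube r (continuous_confinement sV).
(* On the cube [1 - (K + 1) = - K], a lower bound for the confinement function there. *)
exists (K + 1); first by rewrite addr_ge0 // ltW.
move=> x; rewrite indic_cubeE; have [xr|xr] := leP `|x| r.
  rewrite mulr1 opprD addrCA subrr addr0.
  by have := HK x xr; rewrite ler_norml => /andP[].
(* The hypothesis is stated with the Euclidean norm, which dominates the sup norm defining the
   cubes. *)
rewrite mulr0 subr0; apply/ltW/Hr; apply: lt_le_trans (_ : `|x| <= _).
  by apply: le_lt_trans xr; rewrite le_max lexx orbT.
apply/norm_rV_leP => [|i]; first exact: sqrtr_ge0.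
rewrite /euclidean_norm -sqrtr_sqr ler_wsqrtr // (bigD1 i) //= lerDl.
by apply: sumr_ge0 => j _; exact: sqr_ge0.
Qed.

Lemma W_Wm x : W x * Wm x = 1.
Proof. by rewrite -expRD mulNr subrr expR0. Qed.

Lemma omE x : om x = Wm x ^+ 2.
Proof. by rewrite expr2 -expRD -splitr. Qed.

(** Korn's inequality on the fixed cube chooses the Killing field, [residual_bound] makes the
    estimate global, and orthogonality removes the field. The [delta] of Korn's inequality
    disappears because [C] is fixed before [eps]. *)
Lemma korn_confined : exists2 C, 0 < C & forall b S,
  (forall j, L2f mu (b j)) -> (forall i j, L2f mu (S i j)) ->
  weak_strain (fun j x => W x * b j x) (fun i j x => W x * S i j x) ->
  (forall c A, ig mu (fun x => Wm x * \sum_j b j x * killing c A j x) /\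
     \int[mu]_x (Wm x * \sum_j b j x * killing c A j x) = 0) ->
  \sum_j \int[mu]_x (b j x ^+ 2) <= C * \sum_i \sum_j \int[mu]_x (S i j x ^+ 2).
Proof.
have [r r0 [a0 a00 conf]] := confinement_lower.
have [C1 C10 HK] := @weak_korn R d r r0.
have cV := smooth_continuous sV.
have cW : continuous (fun x => W x) := smooth_continuous (smooth_expR (smooth_half sV)).
have com : continuous (fun x => om x) := smooth_continuous (smooth_expR (smoothN sV)).
have cW2 : continuous (fun x => W x ^+ 2) := continuous_sqr cW.
have [K1 K10 HK1] := continuous_bounded_cube r com.
have [K2 K20 HK2] := continuous_bounded_cube r cW2.
(* [a0] weighs the integral over the cube in [residual_bound], [K1] bounds [e^{-V}] there, and [C1]
   is Korn's constant for each of the [d] components. [K2] bounds [e^V] and converts the strain of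
   [u] back to [S]. *)
pose N := a0 * (K1 * (d%:R * C1)).
have N0 : 0 <= N by rewrite !mulr_ge0 // ltW.
exists (1 + N * K2); first by rewrite ltr_pwDl // mulr_ge0 // ltW.
move=> b S hb hS ws orth.
pose u j x := W x * b j x; pose e i j x := W x * S i j x.
have hu j : L2loc (u j) by exact: (L2loc_mul_continuous cW (L2_L2loc (hb j))).
have he i j : L2loc (e i j) by exact: (L2loc_mul_continuous cW (L2_L2loc (hS i j))).
have omW x t : om x * (W x * t) ^+ 2 = t ^+ 2.
  by rewrite omE -exprMn mulrA [Wm x * _]mulrC W_Wm mul1r.
have ige i j : ig mu (fun x => om x * e i j x ^+ 2).
  by apply: ig_ext (hS i j).2 => x; rewrite omW.
have igu j : ig mu (fun x => om x * u j x ^+ 2).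
  by apply: ig_ext (hb j).2 => x; rewrite omW.
set Q := \sum_i \sum_j _.
have EQ : \sum_i \sum_j \int[mu]_x (om x * e i j x ^+ 2) = Q.
  by apply: eq_bigr => i _; apply: eq_bigr => j _; apply: I_ext => x; rewrite omW.
apply/ler_addgt0Pr => eps eps0.
pose delta := eps / (N + 1).
have delta0 : 0 < delta by rewrite divr_gt0 // ltr_wpDl.
have [c [A HcA]] := HK u e hu he ws delta delta0.
pose kap := killing c A.
have sk k : smooth (kap k) by exact: smooth_killing.
have [p p0 [q q0 Hpq]] := killing_growth c A.
have [igf If] := residual_bound sV a00 conf hu he ws ige sk (strain_killing c A) igu igom Hpq p0 q0.
have [io Io] := orth c A.
have ibs : ig mu (fun x => \sum_j b j x ^+ 2) by apply: ig_sum => j _; case: (hb j).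
have step1 : \sum_j \int[mu]_x (b j x ^+ 2) <= \int[mu]_x (residual V u kap x).
  rewrite -I_sum; last by move=> j _; case: (hb j).
  (* The added term has integral 0 by orthogonality; with it the integrand becomes
     [|b|^2 + |e^{-V/2} k|^2]. *)
  have -> : \int[mu]_x (residual V u kap x) = \int[mu]_x (residual V u kap x +
      2 * (Wm x * \sum_j b j x * killing c A j x)).
    by rewrite ID; [rewrite IZ // Io mulr0 addr0|exact: igf|exact: igZ].
  apply: I_le => //; first by apply: igD; [exact: igf|exact: igZ].
  move=> x; rewrite /residual !mulr_sumr -big_split /=; apply: ler_sum => j _.
  rewrite omE -exprMn mulrBr /u /kap.
  rewrite (_ : Wm x * (W x * b j x) = b j x); last by rewrite mulrCA mulrA W_Wm mul1r.
  move: (Wm x) (b j x) (killing c A j x) => w t s.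
  rewrite (_ : _ + _ = t ^+ 2 + (w * s) ^+ 2); last by ring.
  by rewrite lerDl sqr_ge0.
apply: (le_trans step1); apply: (le_trans If); rewrite EQ mulrDl mul1r -addrA lerD2l.
have iDe i j : ig mu (fun x => D r x * e i j x ^+ 2) := (he i j).2 r.
have loc : \int[mu]_x (D r x * \sum_i \sum_j e i j x ^+ 2) <= K2 * Q.
  have i1 : ig mu (fun x => \sum_i \sum_j S i j x ^+ 2).
    by apply: ig_sum => i _; apply: ig_sum => j _; case: (hS i j).
  have -> : Q = \int[mu]_x (\sum_i \sum_j S i j x ^+ 2).
    rewrite I_sum; last by move=> i _; apply: ig_sum => j _; case: (hS i j).
    by apply: eq_bigr => i _; rewrite I_sum // => j _; case: (hS i j).
  rewrite -IZ //; apply: I_le; last first.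
  - move=> x; rewrite indic_cubeE; have [xr|xr] := leP `|x| r.
      rewrite mul1r mulr_sumr; apply: ler_sum => i _; rewrite mulr_sumr; apply: ler_sum => j _.
      rewrite /e exprMn ler_wpM2r ?sqr_ge0 //.
      by apply: le_trans (HK2 x xr); exact: ler_norm.
    rewrite mul0r mulr_ge0 //; first exact: ltW.
    by apply: sumr_ge0 => i _; apply: sumr_ge0 => j _; exact: sqr_ge0.
  - exact: igZ.
  have : ig mu (fun x => \sum_i \sum_j D r x * e i j x ^+ 2).
    by apply: ig_sum => i _; exact: ig_sum.
  by apply: ig_ext => x; rewrite mulr_sumr; apply: eq_bigr => i _; rewrite mulr_sumr.
have hw j : L2loc (fun x => u j x - kap j x) := L2locB_smooth (hu j) (sk j).
have step2 : \int[mu]_x (D r x * residual V u kap x) <= K1 * (d%:R * C1) * (K2 * Q + delta).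
  have iw j : ig mu (fun x => D r x * (u j x - kap j x) ^+ 2) := (hw j).2 r.
  apply: (@le_trans _ _ (\int[mu]_x (K1 * \sum_j D r x * (u j x - kap j x) ^+ 2))).
    apply: I_le.
    - exact: (ig_cube_residual sV hu sk r).
    - by apply: igZ; exact: ig_sum.
    move=> x; rewrite /residual !mulr_sumr; apply: ler_sum => j _.
    rewrite indic_cubeE; have [xr|xr] := leP `|x| r; last by rewrite !mul0r mulr0.
    rewrite !mul1r ler_wpM2r ?sqr_ge0 //.
    by apply: le_trans (HK1 x xr); exact: ler_norm.
  rewrite IZ; last exact: ig_sum.
  rewrite -mulrA ler_wpM2l; [|exact: ltW|] => //.
  rewrite I_sum // -mulrA.
  apply: (@le_trans _ _ (\sum_(j < d) (C1 * (K2 * Q + delta)))); last first.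
    by rewrite sumr_const card_ord -[_ *+ d]mulr_natl.
  apply: ler_sum => j _; apply: (le_trans (HcA j)); rewrite ler_wpM2l ?lerD2r //.
  exact: ltW.
apply: (le_trans (ler_wpM2l a00 step2)).
rewrite mulrA -/N mulrDr mulrA lerD2l /delta mulrCA ger_pMr //.
by rewrite ler_pdivrMr ?mul1r ?lerDl ?ltr_wpDl.
Qed.

End korn_confined.

(** * Representatives in L^2 and orthogonality to Killing fields *)

Section weighted_orthogonality.
Context {R : realType} {d : nat}.
Notation mu := (lebesgue_rV R d).
Implicit Types (x : 'rV[R]_d) (i j k l : 'I_d).

Lemma L2_L2f (f : 'rV[R]_d -> R) : f \in L2 -> L2f mu f.
Proof.
move=> fL; split; last exact: Lfun2_integrable_sqr.
by have := sub_Lfun_mfun fL; rewrite inE.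
Qed.

Lemma L2_sqr_norm_ge0 (T : ('rV[R]_d -> R) -> R) : (0 <= L2_sqr_norm T)%E.
Proof.
rewrite /L2_sqr_norm; case: pselect => [ex|_]; last exact: leey.
by apply: integral_ge0 => x _; rewrite lee_fin sqr_ge0.
Qed.

Lemma EFinI_sqr (f : 'rV[R]_d -> R) : L2f mu f ->
  (\int[mu]_x (`|f x| ^+ 2)%:E = (\int[mu]_x (f x ^+ 2))%:E)%E.
Proof.
move=> hf; rewrite -EFinI; last by case: hf.
by apply: eq_integral => x _; rewrite real_normK ?num_real.
Qed.

Lemma L2_sqr_normP (T : ('rV[R]_d -> R) -> R) : L2_sqr_norm T != +oo%E ->
  exists S, [/\ L2f mu S, represented_by T S & L2_sqr_norm T = (\int[mu]_x (S x ^+ 2))%:E].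
Proof.
rewrite /L2_sqr_norm; case: pselect => [ex|nex]; last by rewrite eqxx.
move=> _; have hS := L2_L2f (s2valP (cid2 ex)).
by exists (s2val (cid2 ex)); split; [|exact: (s2valP' (cid2 ex))|rewrite EFinI_sqr].
Qed.

Lemma killing_orthogonal (w : 'rV[R]_d -> R) (b : 'I_d -> 'rV[R]_d -> R) c A :
  (forall i, ig mu (fun x => w x * b i x) /\ \int[mu]_x (w x * b i x) = 0) ->
  (forall i j, ig mu (fun x => w x * (x 0 i * b j x - x 0 j * b i x)) /\
     \int[mu]_x (w x * (x 0 i * b j x - x 0 j * b i x)) = 0) ->
  ig mu (fun x => w x * \sum_j b j x * killing c A j x) /\
     \int[mu]_x (w x * \sum_j b j x * killing c A j x) = 0.
Proof.
move=> h1 h2.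
have E x : w x * \sum_j b j x * killing c A j x = \sum_j c j * (w x * b j x) +
    \sum_j \sum_l A j l * (w x * (x 0 l * b j x - x 0 j * b l x)).
  rewrite sum_killing mulrDr !mulr_sumr; congr (_ + _).
    by apply: eq_bigr => j _; rewrite mulrCA.
  by apply: eq_bigr => j _; rewrite mulr_sumr; apply: eq_bigr => l _; rewrite mulrCA.
have i1 : ig mu (fun x => \sum_j c j * (w x * b j x)).
  by apply: ig_sum => j _; apply: igZ; case: (h1 j).
have i2j j : ig mu (fun x => \sum_l A j l * (w x * (x 0 l * b j x - x 0 j * b l x))).
  by apply: ig_sum => l _; apply: igZ; case: (h2 l j).
have i2 : ig mu (fun x => \sum_j \sum_l A j l * (w x * (x 0 l * b j x - x 0 j * b l x))).
  by apply: ig_sum => j _.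
split; first by apply: ig_ext (igD i1 i2) => x; rewrite E.
under eq_Rintegral do rewrite E.
rewrite ID // I_sum; last by move=> j _; apply: igZ; case: (h1 j).
rewrite I_sum // big1 ?add0r => [|j _]; last by have [? h] := h1 j; rewrite IZ // h mulr0.
apply: big1 => j _; rewrite I_sum; last by move=> l _; apply: igZ; case: (h2 l j).
by apply: big1 => l _; have [? h] := h2 l j; rewrite IZ // h mulr0.
Qed.

End weighted_orthogonality.

Theorem theorem5p1 (R : realType) (d : nat) (V : 'rV[R]_d -> R)
    (d_ge2 : (2 <= d)%N) (smoothV : smooth V)
    (expV : (\int[lebesgue_rV R d]_x (expR (- V x))%:E = 1)%E)
    (confV : tends_to_pinfty_at_infinity (fun x =>
       4^-1 * grad_sqr V x - 2^-1 * laplacian V x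
       - \sum_(i < d) \sum_(j < d) `|partial i (partial j V) x|)) :
  exists2 lambda : R, 0 < lambda &
    forall b : 'rV[R]_d -> 'rV[R]_d,
      (forall i : 'I_d, (fun x => b x 0 i) \in L2) ->
      (forall i : 'I_d,
         \int[lebesgue_rV R d]_x (expR (- V x / 2) * b x 0 i)%:E = 0)%E ->
      (forall i j : 'I_d, i != j ->
         \int[lebesgue_rV R d]_x
           (expR (- V x / 2) * (x 0 i * b x 0 j - x 0 j * b x 0 i))%:E = 0)%E ->
      (lambda%:E * (\sum_(i < d) \int[lebesgue_rV R d]_x (`|b x 0 i| ^+ 2)%:E)
       <= \sum_(i < d) \sum_(j < d) L2_sqr_norm (weak_sym_X V b i j))%E.
Proof.
set mu := lebesgue_rV R d.
have cV := smooth_continuous (smooth_expR (smoothN smoothV)).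
have igom : ig mu (fun x => expR (- V x)).
  apply: ig_finite; [exact: continuous_measurable_rV|by move=> x; exact: expR_ge0|].
  by rewrite expV ltry.
have [C C0 HC] := korn_confined smoothV confV igom.
exists C^-1; first by rewrite invr_gt0.
move=> b hb o1 o2; pose bb j x := b x 0 j.
have hbb j : L2f mu (bb j) := L2_L2f (hb j).
(* If some combination is not represented in L^2, or its norm is infinite, the right-hand side is
   [+oo]. Otherwise every combination has a representative [S] to which [korn_confined] applies. *)
have [[i [j Tij]]|nT] := pselect (exists i j, L2_sqr_norm (weak_sym_X V b i j) = +oo%E).
  apply: le_trans (leey _) _; rewrite -Tij.
  apply: (@le_trans _ _ (\sum_(j < d) L2_sqr_norm (weak_sym_X V b i j))%E).
    by rewrite [leRHS](bigD1 j) //= leeDl // sume_ge0 // => k _; exact: L2_sqr_norm_ge0.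
  rewrite [leRHS](bigD1 i) //= leeDl // sume_ge0 // => k _.
  by rewrite sume_ge0 // => l _; exact: L2_sqr_norm_ge0.
have /choice[S HS] : forall p : 'I_d * 'I_d, exists S,
    [/\ L2f mu S, represented_by (weak_sym_X V b p.1 p.2) S &
     L2_sqr_norm (weak_sym_X V b p.1 p.2) = (\int[mu]_x (S x ^+ 2))%:E].
  by move=> p; apply: L2_sqr_normP; apply/eqP => h; apply: nT; exists p.1, p.2.
have mW : measurable_fun setT (fun x => expR (- V x / 2)).
  exact: (continuous_measurable_rV (smooth_continuous (smooth_expR (smooth_half (smoothN smoothV))))).
have h1 i : ig mu (fun x => expR (- V x / 2) * bb i x) /\
    \int[mu]_x (expR (- V x / 2) * bb i x) = 0.
  have hi : ig mu (fun x => expR (- V x / 2) * bb i x).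
    by apply: ig_eq0; [apply: measurable_funM => //; case: (hbb i)|exact: o1].
  by split => //; apply/eqP; rewrite -eqe -EFinI // o1.
have h2 i j : ig mu (fun x => expR (- V x / 2) * (x 0 i * bb j x - x 0 j * bb i x)) /\
    \int[mu]_x (expR (- V x / 2) * (x 0 i * bb j x - x 0 j * bb i x)) = 0.
  have [<-|ij] := eqVneq i j.
    have E x : expR (- V x / 2) * (x 0 i * bb i x - x 0 i * bb i x) = 0 by rewrite subrr mulr0.
    split; first by apply: ig_ext (ig0 mu) => x; rewrite E.
    by under eq_Rintegral do rewrite E; exact: I0.
  have hi : ig mu (fun x => expR (- V x / 2) * (x 0 i * bb j x - x 0 j * bb i x)).
    apply: ig_eq0; last exact: o2.
    apply: measurable_funM => //; apply: measurable_funB; apply: measurable_funM.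
    - exact: measurable_coord.
    - by case: (hbb j).
    - exact: measurable_coord.
    - by case: (hbb i).
  by split => //; apply/eqP; rewrite -eqe -EFinI // o2.
have H := HC bb (fun i j => S (i, j)) hbb (fun i j => let: And3 h _ _ := HS (i, j) in h)
  _ (fun c A => killing_orthogonal c A h1 h2).
have -> : (\sum_(i < d) \sum_(j < d) L2_sqr_norm (weak_sym_X V b i j) =
    (\sum_i \sum_j \int[mu]_x (S (i, j) x ^+ 2))%:E)%E.
  rewrite -sumEFin; apply: eq_bigr => i _; rewrite -sumEFin; apply: eq_bigr => j _.
  by case: (HS (i, j)).
have -> : (\sum_(i < d) \int[mu]_x (`|b x 0 i| ^+ 2)%:E = (\sum_i \int[mu]_x (bb i x ^+ 2))%:E)%E.
  by rewrite -sumEFin; apply: eq_bigr => i _; rewrite -EFinI_sqr.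
rewrite -EFinM lee_fin mulrC ler_pdivrMr // mulrC; apply: H.
apply: weak_strain_of_weak_X => // [j|i j phi tphi]; first exact: L2_L2loc.
by case: (HS (i, j)) => _ rep _; exact: rep.
Qed.
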